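(* Let $p>1$ be an integer. There exists $\epsilon>0$ such that for any bounded operator $a$ on a complex Hilbert space with numerical range $W(a)$ contained in the set $$\mathcal{D}=\{z\in\mathbb{C}:\mathrm{Re}(z)>0 \text{ and } |z|\le1+\epsilon\}\cup\{z\in\mathbb{C}:\mathrm{Re}(z)>0\text{ and }|z-1|\le1\},$$ Newton's method for the $p$th root, $$X_{k+1}=\tfrac1p\,X_k\,\big((p-1)I+X_k^{-p}\,a\big),$$ with initial point $X_0=I$, converges in norm to $a^{1/p}$.
   Context: $W(a)$ is the closed numerical range, i.e. the closure of $\{\langle a\zeta,\zeta\rangle:\|\zeta\|=1\}$. For $a$ with spectrum disjoint from $(-\infty,0]$, $a^{1/p}$ denotes the principal $p$th root: the unique $p$th root with spectrum in the interior of the sector $S_{\pi/p}=\{z:|\arg z|\le\pi/p\}$. It is part of the claim that the iterates are well defined. *)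

(* Defs.v *)
From HB Require Import structures.
From mathcomp Require Import all_boot all_order all_algebra.
From mathcomp Require Import complex.
From mathcomp Require Import all_classical all_reals all_analysis.

Set Implicit Arguments.
Unset Strict Implicit.
Unset Printing Implicit Defensive.

Import Order.TTheory GRing.Theory Num.Theory.
Import numFieldNormedType.Exports.

Local Open Scope classical_set_scope.
Local Open Scope ring_scope.
Local Open Scope complex_scope.

Section Domains.
Variable R : realType.

(* [R[i]^o] rather than [R[i]] is the type that carries the topology used by
   [closure] and [interior]; the two are convertible. *)

Definition domainD (eps : R) : set R[i]^o :=
  [set z : R[i] | 0 < complex.Re z /\ `|z| <= (1 + eps)%:C] `|`
  [set z : R[i] | 0 < complex.Re z /\ `|z - 1| <= 1].

(* {z : |arg z| <= theta} in polar coordinates, with 0 included. *)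
Definition sector (theta : R) : set R[i]^o :=
  [set z : R[i] | exists r t : R,
     [/\ 0 <= r, `|t| <= theta & z = (r * cos t) +i* (r * sin t)]].

End Domains.

Section Operators.
Variables (R : realType) (H : completeNormedModType R[i]).

(* The norm of [H] takes its values in R[i]. *)
Definition bounded_op (f : H -> H) : Prop :=
  linear f /\ exists M : R, forall x, `|f x| <= M%:C * `|x|.

Definition opnorm (f : H -> H) : R :=
  sup [set complex.Re `|f x| | x in [set x : H | `|x| <= 1]].

Definition is_op_inverse (f g : H -> H) : Prop :=
  [/\ bounded_op g, f \o g = idfun & g \o f = idfun].

Definition op_invertible (f : H -> H) : Prop := exists g, is_op_inverse f g.

(* The inverse of [f], and the zero operator if [f] is not invertible. *)
Definition op_inv (f : H -> H) : H -> H :=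
  xget (fun=> 0) [set g | is_op_inverse f g].

Definition op_spectrum (f : H -> H) : set R[i]^o :=
  [set l : R[i] | ~ op_invertible (fun x => f x - l *: x)].

Definition numerical_range (dot : {dot H for Num.conj}) (a : H -> H) :
    set R[i]^o :=
  closure [set dot (a z) z | z in [set z : H | `|z| = 1]].

Definition principal_root (p : nat) (a r : H -> H) : Prop :=
  [/\ bounded_op r, iter p r = a &
      op_spectrum r `<=` interior (sector (pi / p%:R))].

(* Equal to [r = a^{1/p}], with the uniqueness that makes this meaningful. *)
Definition is_the_principal_root (p : nat) (a r : H -> H) : Prop :=
  unique (principal_root p a) r.

Definition newton_step (p : nat) (a X : H -> H) : H -> H :=
  fun x => (p%:R : R[i])^-1 *:
             X ((p%:R - 1 : R[i]) *: x + iter p (op_inv X) (a x)).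

Definition newton (p : nat) (a : H -> H) (k : nat) : H -> H :=
  iter k (newton_step p a) idfun.

End Operators.

(* Main.v *)
Require Import Defs.
From HB Require Import structures.
From mathcomp Require Import all_boot all_order all_algebra.
From mathcomp Require Import complex.
From mathcomp Require Import all_classical all_reals all_analysis.
From mathcomp Require Import ring lra.
Set Implicit Arguments.
Unset Strict Implicit.
Unset Printing Implicit Defensive.
Import Order.TTheory GRing.Theory Num.Theory.
Import numFieldNormedType.Exports.
Local Open Scope classical_set_scope.
Local Open Scope ring_scope.
Local Open Scope complex_scope.

(* Let [p = n.+1] and let [zeta] be the principal [p]th root of a scalar [z].  For
   the quotients [h = zeta / x] of [zeta] by the Newton iterates [x] started at
   [1], each step decreases [|1 / h - 1|] by the factor [1 - 1 / p] as long as [h]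
   stays in the sector of half angle [alpha = pi / (2 p)] of the unit disc.  A step
   cannot leave that sector, and if it leaves the disc, it lands in a small ball
   around [1], which Newton's method contracts.  The numbers [z] of [D] give after
   at most one step a starting point in one of the two regions, and the speed of
   convergence is uniform for [|z| >= delta].

   For an operator [a], a half-line issued from [1] and leaving [D] does not come
   back, so the spectrum of [a] lies in [D], and it avoids a neighbourhood of [0].
   The spectral mapping theorem for rational functions shows that the iterates
   [X_k] are invertible and that the spectral radius of [1 - X_k ^- p a] becomes
   small; in a norm for which this residual of some iterate has a small multiplier
   norm, the residuals then decrease geometrically, which makes [X_k] converge. *)

(** * Trigonometric and exponential bounds *)

Section RealTrig.
Variable R : realType.
Implicit Types x t a b : R.

(** Convergence of the scalar iteration at each point of the spectrum does not give norm convergence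
    when [a] is not normal. This is why one number of steps has to serve the whole spectrum: a
    single residual then has small spectral radius, and after a change of norm the quadratic
    convergence of Newton's method takes over.

    The scalar difficulty is that the contraction of [1 / h - 1] is available only for [|h| <= 1].
    The radius of the ball that catches the points leaving the disc, written [b / p], is squeezed
    from two sides. For large [p] the binomial remainder gives a contraction only if
    [exp b < 1 + 2 * b], that is, for [b] below about 1.256; the estimate of the landing points for
    [p >= 3] needs [b] above about 1.246. Hence [b = 5 / 4], and hence the sharp rational bounds on
    [pi] and [exp]. For [p = 2] the landing estimate is weaker, but there the ball may be larger. *)

Lemma le_of_derive_ge0 (f df : R -> R) a b : a <= b ->
  (forall x, is_derive x (1 : R) f (df x)) ->
  (forall x, a <= x <= b -> 0 <= df x) -> f a <= f b.
Proof.
move=> ab fd df0.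
have cf : {within `[a, b], continuous f}.
  apply: derivable_within_continuous => x _.
  by have [] := fd x.
have [c] := MVT_segment ab (fun x _ => fd x) cf.
rewrite in_itv/= => /df0 dc e; rewrite -subr_ge0 e.
by rewrite mulr_ge0 ?subr_ge0.
Qed.

Lemma sin_le t : 0 <= t -> sin t <= t.
Proof.
move=> t0; rewrite -subr_ge0.
have D x : is_derive x (1 : R) (id - sin : R -> R) (1 - cos x) by exact: is_derive_eq.
have := le_of_derive_ge0 t0 D => h.
have : 0 - sin 0 <= t - sin t.
  by apply: h => x _; rewrite subr_ge0 cos_le1.
by rewrite sin0 subr0.
Qed.

Lemma cos_ge t : 1 - t ^+ 2 / 2 <= cos t.
Proof.
wlog t0 : t / 0 <= t => [W|].
  have [/W//|/ltW t0] := leP 0 t.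
  by have := W (- t); rewrite oppr_ge0 cosN sqrrN; apply.
have D x : is_derive x (1 : R) (cos + 2^-1 \*: id ^+ 2 : R -> R) (x - sin x).
  by apply: is_derive_eq; rewrite /GRing.scale/=; field.
have := le_of_derive_ge0 t0 D => h.
have : cos 0 + 2^-1 * 0 ^+ 2 <= cos t + 2^-1 * t ^+ 2.
  by apply: h => x /andP[x0 _]; rewrite subr_ge0 sin_le.
rewrite cos0; lra.
Qed.

Lemma sin_ge3 t : 0 <= t -> t - t ^+ 3 / 6 <= sin t.
Proof.
move=> t0.
have D x : is_derive x (1 : R) (sin - id + 6^-1 \*: id ^+ 3 : R -> R)
    (cos x - 1 + x ^+ 2 / 2).
  by apply: is_derive_eq; rewrite /GRing.scale/=; field.
have := le_of_derive_ge0 t0 D => h.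
have : sin 0 - 0 + 6^-1 * 0 ^+ 3 <= sin t - t + 6^-1 * t ^+ 3.
  apply: h => x _; have := cos_ge x; lra.
rewrite sin0; lra.
Qed.

Lemma cos_le4 t : cos t <= 1 - t ^+ 2 / 2 + t ^+ 4 / 24.
Proof.
wlog t0 : t / 0 <= t => [W|].
  have [/W//|/ltW t0] := leP 0 t.
  have := W (- t); rewrite oppr_ge0 cosN sqrrN => /(_ t0).
  by rewrite (_ : (- t) ^+ 4 = t ^+ 4) //; ring.
have D x : is_derive x (1 : R) (24^-1 \*: id ^+ 4 - 2^-1 \*: id ^+ 2 - cos : R -> R)
    (sin x - (x - x ^+ 3 / 6)).
  by apply: is_derive_eq; rewrite /GRing.scale/=; field.
have := le_of_derive_ge0 t0 D => h.
have : 24^-1 * 0 ^+ 4 - 2^-1 * 0 ^+ 2 - cos 0 <= 24^-1 * t ^+ 4 - 2^-1 * t ^+ 2 - cos t.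
  by apply: h => x /andP[x0 _]; have := sin_ge3 x0; lra.
rewrite cos0; lra.
Qed.

Lemma sin_le5 t : 0 <= t -> sin t <= t - t ^+ 3 / 6 + t ^+ 5 / 120.
Proof.
move=> t0.
have D x : is_derive x (1 : R)
    (id - 6^-1 \*: id ^+ 3 + 120^-1 \*: id ^+ 5 - sin : R -> R)
    (1 - x ^+ 2 / 2 + x ^+ 4 / 24 - cos x).
  by apply: is_derive_eq; rewrite /GRing.scale/=; field.
have := le_of_derive_ge0 t0 D => h.
have : 0 - 6^-1 * 0 ^+ 3 + 120^-1 * 0 ^+ 5 - sin 0
    <= t - 6^-1 * t ^+ 3 + 120^-1 * t ^+ 5 - sin t.
  by apply: h => x _; have := cos_le4 x; lra.
rewrite sin0; lra.
Qed.

Lemma sin_pi6 : sin (pi / 6 : R) = 2^-1.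
Proof.
set s := sin _.
have s0 : 0 < s by apply: sin_gt0_pi; have := @pi_gt0 R; lra.
(* The triple angle formula at [pi / 2], namely [3 * s - 4 * s ^+ 3 = 1], in factored form. *)
have : (s + 1) * (2 * s - 1) ^+ 2 = 0.
  have := @sin_pihalf R.
  rewrite (_ : pi / 2 = pi / 6 + (pi / 6 + pi / 6)); last by field.
  rewrite !sinD !cosD -/s.
  have := cos2Dsin2 (pi / 6 : R); rewrite -/s.
  set c := cos _ => cs h.
  have c2 : c ^+ 2 = 1 - s ^+ 2 by lra.
  have h' : 3 * (c ^+ 2) * s - s ^+ 3 = 1 by rewrite -[RHS]h; ring.
  by move: h'; rewrite c2; lra.
move=> /eqP; rewrite mulf_eq0 sqrf_eq0 => /orP[]/eqP; lra.
Qed.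

(** The constant is [6 * 524 / 1000], and the cubic lower bound of the sine at [524 / 1000] just
    exceeds [1 / 2 = sin (pi / 6)]. The lower bound on [pi] comes in the same way from the quintic
    upper bound at [523 / 1000]. *)
Lemma pi_lt : pi < (3144 / 1000 : R).
Proof.
rewrite ltNge; apply/negP => h.
have : sin (524 / 1000 : R) <= sin (pi / 6 : R).
  have := @pi_gt0 R; have := @pi_ge2 R => ? ?.
  by rewrite -subr_ge0 leNgt subr_lt0 ltr_sin ?in_itv/= -?leNgt; try (apply/andP; split); lra.
rewrite sin_pi6; have := @sin_ge3 (524 / 1000); lra.
Qed.

Lemma pi_gt : (3138 / 1000 : R) < pi.
Proof.
rewrite ltNge; apply/negP => h.
have : sin (pi / 6 : R) <= sin (523 / 1000 : R).
  have := @pi_gt0 R; have := @pi_ge2 R => ? ?.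
  by rewrite -subr_ge0 leNgt subr_lt0 ltr_sin ?in_itv/= -?leNgt; try (apply/andP; split); lra.
rewrite sin_pi6; have := @sin_le5 (523 / 1000); lra.
Qed.

Lemma expRN_ge3 x : 0 <= x -> 1 - x + x ^+ 2 / 2 - x ^+ 3 / 6 <= expR (- x).
Proof.
move=> x0.
have D t : is_derive t (1 : R) (fun t => expR (- t)) (- expR (- t)).
  have := is_derive1_comp (@is_derive_expR R (- t)) (is_deriveN (is_derive_id t (1 : R))).
  by rewrite mulrN mulr1.
have le2 t : 0 <= t -> expR (- t) <= 1 - t + t ^+ 2 / 2.
  move=> t0.
  have D2 u : is_derive u (1 : R) (2^-1 \*: id ^+ 2 - id - (fun t => expR (- t)) : R -> R)
      (expR (- u) - (1 - u)).
    by apply: is_derive_eq; rewrite /GRing.scale/=; field.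
  have h := le_of_derive_ge0 t0 D2.
  have : 2^-1 * 0 ^+ 2 - 0 - expR (- 0) <= 2^-1 * t ^+ 2 - t - expR (- t).
    by apply: h => u _; have := expR_ge1Dx (- u); lra.
  rewrite oppr0 expR0; lra.
have D3 u : is_derive u (1 : R)
    ((fun t => expR (- t)) + id - 2^-1 \*: id ^+ 2 + 6^-1 \*: id ^+ 3 : R -> R)
    (1 - u + u ^+ 2 / 2 - expR (- u)).
  by apply: is_derive_eq; rewrite /GRing.scale/=; field.
have h := le_of_derive_ge0 x0 D3.
have : expR (- 0) + 0 - 2^-1 * 0 ^+ 2 + 6^-1 * 0 ^+ 3
    <= expR (- x) + x - 2^-1 * x ^+ 2 + 6^-1 * x ^+ 3.
  by apply: h => u /andP[u0 _]; have := le2 _ u0; lra.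
rewrite oppr0 expR0; lra.
Qed.

(** At [1] itself the cubic bound yields only [1 / 3], so it is applied at [1 / 4] and raised to the
    fourth power. *)
Lemma expRN1_ge : (367 / 1000 : R) <= expR (- 1).
Proof.
have := @expRN_ge3 4^-1.
have -> : (-1 : R) = 4%:R * (- 4^-1) by field.
rewrite expRM_natl; set e := expR _ => h.
have {}h : 7786 / 1000 / 10 <= e by apply: le_trans (h _); lra.
have : 606 / 1000 <= e ^+ 2 by rewrite expr2; nra.
rewrite (_ : e ^+ 4 = e ^+ 2 * e ^+ 2); last by ring.
by set q := e ^+ 2; nra.
Qed.

Lemma sin_natmul_le t n : 0 <= t -> n%:R * t <= pi / 2 -> sin (n%:R * t) <= n%:R * sin t.
Proof.
move=> t0; elim: n => [|n IH] h; first by rewrite !mul0r sin0.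
have p0 := @pi_gt0 R.
have [->|n0] := eqVneq n 0%N; first by rewrite !mul1r.
have n1 : (1 : R) <= n%:R by rewrite ler1n lt0n.
have nt : n%:R * t <= pi / 2 by apply: le_trans h; rewrite ler_wpM2r // ler_nat.
have tp : t <= pi / 2 by apply: le_trans nt; rewrite ler_peMl.
have st : 0 <= sin t by apply: sin_ge0_pi; lra.
have snt : 0 <= sin (n%:R * t).
  by apply: sin_ge0_pi; rewrite mulr_ge0 ?ler0n //=; lra.
have /IH {}IH := nt.
rewrite -natr1 !mulrDl !mul1r sinD.
have := cos_le1 t; have := cos_le1 (n%:R * t); nra.
Qed.

(** The sum is [2 * cos ((a + b) / 2) * cos ((a - b) / 2)], and both angles have absolute value at
    most [pi / 4]. *)
Lemma cos_pair_ge1 a b : 0 <= a -> 0 <= b -> a + b <= pi / 2 -> 1 <= cos a + cos b.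
Proof.
move=> a0 b0 ab.
have p0 := @pi_gt0 R.
have c4 : cos (pi / 4 : R) ^+ 2 = 2^-1.
  have := @cos_pihalf R; rewrite (_ : pi / 2 = (pi / 4) *+ 2); last by rewrite mulr2n; field.
  rewrite cos_mulr2n mulr2n; lra.
have c40 : 0 <= cos (pi / 4 : R) by apply: cos_ge0_pihalf; lra.
have mono x : `|x| <= pi / 4 -> cos (pi / 4) <= cos x.
  move=> hx; rewrite -(cos_norm x) leNgt ltr_cos ?in_itv/= -?leNgt //; have := normr_ge0 x; lra.
have h1 : `|(a + b) / 2| <= pi / 4 by rewrite ger0_norm; lra.
have h2 : `|(a - b) / 2| <= pi / 4 by rewrite ler_norml; lra.
have ea : a = (a + b) / 2 + (a - b) / 2 by field.
have eb : b = (a + b) / 2 - (a - b) / 2 by field.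
move: h1 h2 ea eb; set u := (a + b) / 2; set v := (a - b) / 2; move=> h1 h2 -> ->.
rewrite cosD cosB; have := mono _ h1; have := mono _ h2; nra.
Qed.

Lemma cos_ge_half a : 0 <= a <= pi / 4 -> 2^-1 <= cos a.
Proof.
move=> h; have := @cos_pair_ge1 a a.
have := @pi_gt0 R; case/andP: h => *.
suff : 1 <= cos a + cos a by lra.
by apply: cos_pair_ge1; lra.
Qed.

End RealTrig.

(** * Moduli and polar coordinates *)

Section Modulus.
Variable R : realType.
Local Notation C := R[i].
Implicit Types (z w : C) (t : R).

(** The norm of [R[i]] takes its values in [R[i]]; real values give access to the arithmetic of
    ordered fields. *)
Definition cabs z : R := complex.Re `|z|.

Lemma cabsE z : `|z| = (cabs z)%:C.
Proof. by rewrite /cabs RRe_real// normr_real. Qed.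

Lemma cabs_ge0 z : 0 <= cabs z.
Proof. by rewrite -lecR -cabsE normr_ge0. Qed.

Lemma cabsM z w : cabs (z * w) = cabs z * cabs w.
Proof. by apply: complexI; rewrite -cabsE normrM !cabsE -rmorphM. Qed.

Lemma cabsD z w : cabs (z + w) <= cabs z + cabs w.
Proof. by rewrite -lecR rmorphD /= -!cabsE ler_normD. Qed.

Lemma cabsN z : cabs (- z) = cabs z.
Proof. by rewrite /cabs normrN. Qed.

Lemma cabsB z w : cabs (z - w) <= cabs z + cabs w.
Proof. by rewrite (le_trans (cabsD _ _))// cabsN. Qed.

Lemma cabs_distC z w : cabs (z - w) = cabs (w - z).
Proof. by rewrite /cabs distrC. Qed.

Lemma cabsV z : cabs z^-1 = (cabs z)^-1.
Proof. by apply: complexI; rewrite -cabsE normfV !cabsE fmorphV. Qed.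

Lemma cabs0 : cabs 0 = 0. Proof. by rewrite /cabs normr0. Qed.

Lemma cabs1 : cabs 1 = 1. Proof. by rewrite /cabs normr1. Qed.

Lemma cabsX z n : cabs (z ^+ n) = cabs z ^+ n.
Proof. by apply: complexI; rewrite -cabsE normrX !cabsE rmorphXn. Qed.

Lemma cabs_eq0 z : (cabs z == 0) = (z == 0).
Proof. by rewrite -(inj_eq (@complexI R)) /= -cabsE normr_eq0. Qed.

Lemma cabs_gt0 z : (0 < cabs z) = (z != 0).
Proof. by rewrite lt_def cabs_eq0 cabs_ge0 andbT. Qed.

Lemma cabs_real (x : R) : cabs x%:C = `|x|.
Proof. by rewrite /cabs normc_def /= expr0n addr0 sqrtr_sqr. Qed.

Lemma cabs_nat n : cabs n%:R = n%:R.
Proof. by rewrite -(rmorph_nat (real_complex R)) cabs_real normr_nat. Qed.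

Lemma cabs_sum n (F : nat -> C) : cabs (\sum_(i < n) F i) <= \sum_(i < n) cabs (F i).
Proof.
elim/big_ind2 : _ => [|a x b y xa yb|//]; first by rewrite cabs0.
by rewrite (le_trans (cabsD _ _))// lerD.
Qed.

Lemma cabs_sqr (x y : R) : cabs (x +i* y) ^+ 2 = x ^+ 2 + y ^+ 2.
Proof. by apply: complexI; rewrite rmorphXn /= -cabsE -add_Re2_Im2. Qed.

Lemma Re_le_cabs z : complex.Re z <= cabs z.
Proof.
case: z => x y /=; have := cabs_sqr x y; have := cabs_ge0 (x +i* y).
by set c := cabs _ => c0 h; rewrite leNgt; apply/negP => ?; nra.
Qed.

Definition cis t : C := cos t +i* sin t.

Lemma cis0 : cis 0 = 1. Proof. by rewrite /cis cos0 sin0. Qed.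

Lemma cisD s t : cis (s + t) = cis s * cis t.
Proof. by rewrite /cis cosD sinD; simpc; rewrite addrC [X in _ +i* X]addrC. Qed.

Lemma cisX t n : cis t ^+ n = cis (n%:R * t).
Proof.
elim: n => [|n IH]; first by rewrite mul0r cis0.
by rewrite exprSr IH -cisD -[in RHS]natr1 mulrDl mul1r.
Qed.

Lemma cabs_cis t : cabs (cis t) = 1.
Proof.
by apply/eqP; rewrite -sqrp_eq1 ?cabs_ge0// cabs_sqr cos2Dsin2.
Qed.

Lemma cabs_polar r t : 0 <= r -> cabs (r%:C * cis t) = r.
Proof. by move=> r0; rewrite cabsM cabs_cis mulr1 cabs_real ger0_norm. Qed.

Lemma cis_neq0 t : cis t != 0.
Proof. by rewrite -cabs_eq0 cabs_cis oner_eq0. Qed.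

Lemma cisN t : cis (- t) = (cis t)^-1.
Proof. by apply: (mulIf (cis_neq0 t)); rewrite -cisD addNr cis0 mulVf// cis_neq0. Qed.

Lemma polarX r t n : (r%:C * cis t) ^+ n = (r ^+ n)%:C * cis (n%:R * t).
Proof. by rewrite exprMn cisX -rmorphXn. Qed.

Lemma polarV r t : (r%:C * cis t)^-1 = (r^-1)%:C * cis (- t).
Proof. by rewrite invfM cisN fmorphV. Qed.

Lemma polarE r t : r%:C * cis t = (r * cos t) +i* (r * sin t).
Proof. by rewrite /cis; simpc. Qed.

Lemma cabs_1B_polar r t : cabs (1 - r%:C * cis t) ^+ 2 = 1 - r * cos t *+ 2 + r ^+ 2.
Proof.
rewrite polarE (_ : 1 - _ = (1 - r * cos t) +i* (- (r * sin t))); last by simpc.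
rewrite cabs_sqr mulr2n; have := cos2Dsin2 t => h.
transitivity (1 - 2 * (r * cos t) + r ^+ 2 * (cos t ^+ 2 + sin t ^+ 2)); first by ring.
by rewrite h; ring.
Qed.

Lemma polar_of_Re_gt0 z : 0 < complex.Re z ->
  exists2 t, `|t| < pi / 2 & z = (cabs z)%:C * cis t.
Proof.
case: z => x y /= x0; exists (atan (y / x)).
  by rewrite ltr_norml atan_gtNpi2 atan_ltpi2.
set t := atan _.
have ct : 0 < cos t by apply: cos_gt0_pihalf; rewrite atan_gtNpi2 atan_ltpi2.
have e : sin t = y / x * cos t.
  by rewrite -(atanK (y / x)) /tan -/t divfK// gt_eqF.
have r0 : 0 < cabs (x +i* y) by rewrite cabs_gt0 eq_complex/= negb_and gt_eqF.
have cs : cabs (x +i* y) * cos t = x.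
  have h : (cabs (x +i* y) * cos t) ^+ 2 = x ^+ 2.
    have h := cos2Dsin2 t; rewrite e in h; rewrite exprMn cabs_sqr.
    have -> : x ^+ 2 + y ^+ 2 = x ^+ 2 * (1 + (y / x) ^+ 2) by field; rewrite gt_eqF.
    rewrite -mulrA (_ : (1 + _) * _ = 1) ?mulr1// -[RHS]h; ring.
  have : 0 < cabs (x +i* y) * cos t by rewrite mulr_gt0.
  move/eqP: h; rewrite eqf_sqr => /orP[/eqP//|/eqP ->]; lra.
by rewrite polarE cs e mulrCA cs divfK// gt_eqF.
Qed.

(** The hypothesis is [|Im z| / Re z <= tan al] without the division; it also forces [Re z > 0]. An
    argument beyond [al] is excluded by the sign of [sin (|t| - al)]. *)
Lemma polar_of_sector z al : 0 < al < pi / 2 -> z != 0 ->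
    `|complex.Im z| * cos al <= complex.Re z * sin al ->
  exists2 t, `|t| <= al & z = (cabs z)%:C * cis t.
Proof.
move=> /andP[al0 al1] z0 h.
have ca : 0 < cos al by apply: cos_gt0_pihalf; lra.
have sa : 0 < sin al by apply: sin_gt0_pihalf; rewrite al0.
have x0 : 0 < complex.Re z.
  have x0 : 0 <= complex.Re z.
    rewrite -(pmulr_lge0 _ sa); apply: le_trans h.
    by rewrite mulr_ge0// ltW.
  rewrite lt_def x0 andbT; apply/eqP => e.
  move: h; rewrite e mul0r pmulr_lle0// normr_le0 => /eqP f.
  by move: z0; rewrite (complexE z) e f mulr0 addr0 eqxx.
have [t ht ez] := polar_of_Re_gt0 x0.
exists t => //.
have c0 : 0 < cabs z by rewrite cabs_gt0.
move: h; rewrite ez polarE/= ler_norml; set c := cabs z in c0 *.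
rewrite normrM (gtr0_norm c0) -!mulrA ler_pM2l//.
move: ht; rewrite ltr_norml => /andP[t1 t2].
have p0 := @pi_gt0 R.
move=> H; apply/andP; split; rewrite leNgt; apply/negP => t3.
  have : 0 < sin (- t - al) by apply: sin_gt0_pi; lra.
  rewrite sinB sinN cosN; have := ler_norm (- sin t); rewrite normrN; nra.
have : 0 < sin (t - al) by apply: sin_gt0_pi; lra.
rewrite sinB; have := ler_norm (sin t); nra.
Qed.

End Modulus.

(** * The scalar iteration *)

Section HalfDisc.
Variable R : realType.
Local Notation C := R[i].
Implicit Types (h z : C) (r t : R) (n : nat).

Definition alpha n : R := pi / (2 * n.+1%:R).

Lemma alpha_gt0 n : 0 < alpha n.
Proof. by rewrite divr_gt0 ?pi_gt0// mulr_gt0// ltr0n. Qed.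

Lemma alphaM n : n.+1%:R * alpha n = pi / 2.
Proof. by rewrite /alpha; field; rewrite addrC natr1 pnatr_eq0. Qed.

Lemma alpha_lt n : (0 < n)%N -> alpha n <= pi / 4.
Proof.
move=> n0; have := alphaM n; have : (2 : R) <= n.+1%:R by rewrite ler_nat.
by have := alpha_gt0 n; nra.
Qed.

(* Pairs the indices [j] and [n.+1 - j]. *)
Lemma sum_polar_le0 n r t : 0 <= r <= 1 -> 0 <= t -> n.+1%:R * t <= pi / 2 ->
  \sum_(i < n) r ^+ i.+1 * (1 - cos (i.+1%:R * t) *+ 2) <= 0.
Proof.
move=> /andP[r0 r1] t0 ht.
pose d j := r ^+ j * (1 - cos (j%:R * t) *+ 2).
have p0 := @pi_gt0 R.
have pair j k : (j <= k)%N -> (j + k = n.+1)%N -> d j + d k <= 0.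
  move=> jk e.
  have s : j%:R * t + k%:R * t <= pi / 2 by rewrite -mulrDl -natrD e.
  have jt : 0 <= j%:R * t by rewrite mulr_ge0.
  have kt : 0 <= k%:R * t by rewrite mulr_ge0.
  have h1 := cos_pair_ge1 jt kt s.
  have : j%:R * t <= k%:R * t by rewrite ler_wpM2r// ler_nat.
  move=> jlek; have h2 : 2^-1 <= cos (j%:R * t) by apply: cos_ge_half; lra.
  have hk : 0 <= r ^+ k by rewrite exprn_ge0.
  have hjk : r ^+ k <= r ^+ j by rewrite ler_wiXn2l.
  by rewrite /d !mulr2n; nra.
have pair' j k : (j + k = n.+1)%N -> d j + d k <= 0.
  by case/orP: (leq_total j k) => ? ?; [|rewrite addrC]; apply: pair => //; rewrite addnC.
have : \sum_(i < n) d i.+1 + \sum_(i < n) d i.+1 <= 0.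
  rewrite [X in _ + X](reindex_inj rev_ord_inj)/= -big_split/= -oppr_ge0 -sumrN.
  apply: sumr_ge0 => i _; rewrite oppr_ge0; apply: pair'.
  by rewrite subnSK// addSn subnKC// ltnW.
rewrite /d; lra.
Qed.

(** The moduli are made linear in the cosines by [c <= (1 + c ^+ 2) / 2], and [q ^+ 2 <= q] removes
    the square of [q = r ^+ i.+1]. What then exceeds [1] in each term is half a term of the sum in
    [sum_polar_le0]. *)
Lemma cabs_sum_polar_le n r t : 0 <= r <= 1 -> `|t| <= alpha n ->
  cabs (\sum_(i < n) (1 - (r%:C * cis t) ^+ i.+1)) <= n%:R.
Proof.
move=> r01 ht; apply: le_trans (cabs_sum _ (fun i => 1 - _ ^+ i.+1)) _.
have le1 i : cabs (1 - (r%:C * cis t) ^+ i.+1) <=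
    1 + r ^+ i.+1 * (1 - cos (i.+1%:R * `|t|) *+ 2) / 2.
  rewrite polarX; have := cabs_1B_polar (r ^+ i.+1) (i.+1%:R * t).
  set c := cabs _; have -> : cos (i.+1%:R * `|t|) = cos (i.+1%:R * t).
    by rewrite -[LHS]cos_norm -[RHS]cos_norm !normrM normr_id.
  have : 0 <= r ^+ i.+1 <= 1.
    by case/andP: r01 => *; rewrite exprn_ge0// exprn_ile1.
  move: (r ^+ i.+1) => q /andP[q0 q1] e.
  have h1 := sqr_ge0 (c - 1); have h2 : q ^+ 2 <= q by rewrite expr2 ler_piMl.
  nra.
apply: le_trans (ler_sum _ (fun (i : 'I_n) _ => le1 i)) _.
rewrite big_split/= sumr_const card_ord -mulr_suml.
have := @sum_polar_le0 n r `|t| r01 (normr_ge0 t).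
rewrite -(alphaM n) ler_pM2l ?ltr0n// => /(_ ht); lra.
Qed.

(* Newton's step for [x ^+ p = zeta ^+ p] with [p = n.+1], in the variable
   [h = zeta / x]. *)
Definition hstep n h : C := n.+1%:R * h / (n%:R + h ^+ n.+1).

Lemma hstepV n h : h != 0 -> (hstep n h)^-1 = (n%:R * h^-1 + h ^+ n) / n.+1%:R.
Proof.
move=> h0; rewrite /hstep exprS invf_div.
have p0 : (n.+1%:R : C) != 0 by rewrite pnatr_eq0.
by move: (h ^+ n) p0 => q; move: (n.+1%:R) => p p0; field; apply/andP.
Qed.

(** The right side is [p * (1 / h' - 1)] for [h' = hstep n h]. So the error [1 / h - 1] is
    multiplied in one step by [1 / p] times a sum of modulus at most [n]. *)
Lemma sum_telescope n h : h != 0 ->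
  (h^-1 - 1) * \sum_(i < n) (1 - h ^+ i.+1) = n%:R * (h^-1 - 1) + h ^+ n - 1.
Proof.
move=> h0; elim: n => [|n IH]; first by rewrite big_ord0 expr0; ring.
rewrite big_ord_recr/= mulrDr IH -natr1 exprS.
by move: (h ^+ n) => q; move: n%:R => p; field.
Qed.

Lemma hstep_contract n r t h : 0 < r <= 1 -> `|t| <= alpha n ->
  h = r%:C * cis t ->
  cabs ((hstep n h)^-1 - 1) <= n%:R / n.+1%:R * cabs (h^-1 - 1).
Proof.
move=> /andP[r0 r1] ht eh.
have h0 : h != 0 by rewrite eh mulf_neq0 ?cis_neq0// (inj_eq (@complexI R)) gt_eqF.
have p0 : (n.+1%:R : C) != 0 by rewrite pnatr_eq0.
have -> : (hstep n h)^-1 - 1 = (h^-1 - 1) * (\sum_(i < n) (1 - h ^+ i.+1)) / n.+1%:R.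
  rewrite sum_telescope// hstepV// -[X in _ - X](mulfV p0) -mulrBl; congr (_ / _).
  rewrite -[in LHS]natr1; ring.
rewrite !cabsM cabsV cabs_nat -mulrA [leRHS]mulrC ler_wpM2l ?cabs_ge0//.
rewrite ler_wpM2r ?invr_ge0//; rewrite eh; apply: cabs_sum_polar_le => //.
by rewrite ltW.
Qed.

(** For [h = r%:C * cis t] and [w = n / h + h ^ n] this says that [w * cis (alpha n)] has
    nonnegative imaginary part, so [w] is not below the lower ray of the sector; [- t] gives the
    upper ray. For [t >= 0] both contributions have the right sign; for [t < 0] the first one
    dominates, because [sin (n * s) <= n * sin s] and [r ^+ n <= 1 <= r^-1]. *)
Lemma sector_ineq n r t : (0 < n)%N -> 0 < r <= 1 -> `|t| <= alpha n ->
  n%:R * r^-1 * sin (t - alpha n) <= r ^+ n * sin (n%:R * t + alpha n).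
Proof.
move=> n1 /andP[r0 r1] ht.
have p0 := @pi_gt0 R; have a0 := alpha_gt0 n; have a1 := alpha_lt n1.
have e : n%:R * alpha n + alpha n = pi / 2 by rewrite -(alphaM n) -natr1 mulrDl mul1r.
have n0 : (0 : R) <= n%:R by [].
have rn : 0 <= r ^+ n <= 1 by rewrite exprn_ge0 ?exprn_ile1// ltW.
have ri : 1 <= r^-1 by rewrite invf_ge1.
move: ht; rewrite ler_norml => /andP[t1 t2].
have nt1 : n%:R * t <= n%:R * alpha n by rewrite ler_wpM2l.
have nt2 : - (n%:R * alpha n) <= n%:R * t by rewrite -mulrN ler_wpM2l.
have [t0|t0] := leP 0 t.
  have ntp : 0 <= n%:R * t by rewrite mulr_ge0.
  have s1 : 0 <= sin (n%:R * t + alpha n) by apply: sin_ge0_pi; lra.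
  have s2 : 0 <= sin (alpha n - t) by apply: sin_ge0_pi; nra.
  rewrite -opprB sinN; have : 0 <= n%:R * r^-1 by nra.
  by case/andP: rn; nra.
have [s s0 es] : exists2 s, 0 <= s & t = - s by exists (- t); lra.
subst t; have ns0 : 0 <= n%:R * s by rewrite mulr_ge0.
rewrite -opprD sinN !mulrN (_ : - _ + alpha n = - (n%:R * s - alpha n)); last by ring.
rewrite sinN mulrN lerN2.
have s1 : sin (n%:R * s - alpha n) <= sin (n%:R * s).
  by rewrite leNgt ltr_sin ?in_itv/= -?leNgt; try (apply/andP; split); lra.
have s2 : sin s <= sin (s + alpha n).
  by rewrite leNgt ltr_sin ?in_itv/= -?leNgt; try (apply/andP; split); lra.
have s3 : sin (n%:R * s) <= n%:R * sin s by apply: sin_natmul_le => //; lra.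
have s4 : 0 <= sin s by apply: sin_ge0_pi; lra.
have s5 : 0 <= sin (n%:R * s) by apply: sin_ge0_pi; lra.
have s6 : n%:R * sin s <= n%:R * sin (s + alpha n) by rewrite ler_wpM2l.
have s7 : 0 <= n%:R * sin s by rewrite mulr_ge0.
by case/andP: rn; nra.
Qed.

Lemma hstep_sector n r t h : (0 < n)%N -> 0 < r <= 1 -> `|t| <= alpha n ->
  h = r%:C * cis t ->
  exists2 s, `|s| <= alpha n & hstep n h = (cabs (hstep n h))%:C * cis s.
Proof.
move=> n0 r01 ht eh; have /andP[r0 r1] := r01.
have pi0 := @pi_gt0 R; have a0 := alpha_gt0 n; have a1 := alpha_lt n0.
have e : n%:R * alpha n + alpha n = pi / 2 by rewrite -(alphaM n) -natr1 mulrDl mul1r.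
have h0 : h != 0 by rewrite eh mulf_neq0 ?cis_neq0// (inj_eq (@complexI R)) gt_eqF.
have p0 : (n.+1%:R : C) != 0 by rewrite pnatr_eq0.
set w := n%:R * h^-1 + h ^+ n.
have wE : w = (n%:R * r^-1 * cos t + r ^+ n * cos (n%:R * t))
    +i* (- (n%:R * r^-1 * sin t) + r ^+ n * sin (n%:R * t)).
  rewrite /w eh polarX polarV !polarE cosN sinN -(rmorph_nat (real_complex R)).
  by simpc; rewrite !mulrA.
have n1 : (1 : R) <= n%:R by rewrite ler1n.
have rn : 0 < r ^+ n by rewrite exprn_gt0.
have ri : 0 < r^-1 by rewrite invr_gt0.
have ht' : `|n%:R * t| <= n%:R * alpha n by rewrite normrM normr_nat ler_wpM2l.
have ct : 0 < cos t.
  by apply: cos_gt0_pihalf; move: ht; rewrite ler_norml; lra.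
have cnt : 0 <= cos (n%:R * t).
  by apply: cos_ge0_pihalf; move: ht'; rewrite ler_norml; lra.
have w0 : w != 0.
  rewrite wE eq_complex/= negb_and gt_eqF//.
  have : 0 < n%:R * r^-1 * cos t by rewrite !mulr_gt0// ltr0n.
  by have : 0 <= r ^+ n * cos (n%:R * t) by [rewrite mulr_ge0 // ltW]; lra.
have ha : 0 < alpha n < pi / 2 by apply/andP; split => //; lra.
have hw : `|complex.Im w| * cos (alpha n) <= complex.Re w * sin (alpha n).
  rewrite wE/=; have := sector_ineq n0 r01 ht.
  have := @sector_ineq n r (- t) n0 r01; rewrite normrN => /(_ ht).
  rewrite mulrN !sinD !sinN !cosN => h1 h2.
  rewrite -[cos (alpha n)]ger0_norm; last by apply: cos_ge0_pihalf; lra.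
  by rewrite -normrM ler_norml; apply/andP; split; lra.
have [s hs ws] := polar_of_sector ha w0 hw.
have wE' : hstep n h = (w / n.+1%:R)^-1 by rewrite -hstepV// invrK.
exists (- s); first by rewrite normrN.
rewrite wE' ws cabsV cabsM cabs_polar ?cabs_ge0// cabsV cabs_nat.
rewrite cisN !fmorphV rmorphM fmorphV rmorph_nat -invfM; congr (_^-1).
by rewrite mulrAC.
Qed.

End HalfDisc.

(** * Steps that leave the unit disc: the numerator *)

Section Crossing.
Variable R : realType.
Local Notation C := R[i].
Implicit Types (h z : C) (r t x v : R) (n : nat).

Lemma bernoulli_le r n : 0 <= r -> 1 + n%:R * (r - 1) <= r ^+ n.
Proof.
move=> r0; elim: n => [|n IH]; first by rewrite mul0r addr0.
have n0 : (0 : R) <= n%:R by [].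
rewrite exprS -natr1; apply: le_trans (ler_wpM2l r0 IH).
have := mulr_ge0 n0 (sqr_ge0 (r - 1)); nra.
Qed.

(* [p^2 |1 / h' - 1|^2], where [h' = hstep n h] and [h] has polar coordinates [r], [t]. *)
Definition crossing_poly n r t : R :=
  n.+1%:R ^+ 2 + (n%:R * r^-1) ^+ 2 + (r ^+ n) ^+ 2
  + 2 * (n%:R * r^-1) * r ^+ n * cos (n.+1%:R * t)
  - 2 * n.+1%:R * (n%:R * r^-1) * cos t
  - 2 * n.+1%:R * r ^+ n * cos (n%:R * t).

Lemma crossing_polyE n r t h : h = r%:C * cis t ->
  cabs (n%:R * h^-1 + h ^+ n - n.+1%:R) ^+ 2 = crossing_poly n r t.
Proof.
move=> ->; rewrite polarX polarV !polarE cosN sinN -!(rmorph_nat (real_complex R)).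
set w := _ - _.
have -> : w = (n%:R * r^-1 * cos t + r ^+ n * cos (n%:R * t) - n.+1%:R)
    +i* (- (n%:R * r^-1 * sin t) + r ^+ n * sin (n%:R * t)).
  by rewrite /w; simpc; rewrite !mulrA.
have ec : cos (n.+1%:R * t) = cos (n%:R * t) * cos t - sin (n%:R * t) * sin t.
  by rewrite -natr1 mulrDl mul1r cosD.
rewrite cabs_sqr /crossing_poly ec.
have := cos2Dsin2 t; have := cos2Dsin2 (n%:R * t).
move: (cos t) (sin t) (cos _) (sin _) (n%:R * r^-1) (r ^+ n) n.+1%:R => c s c' s' a b p e' e.
transitivity (p ^+ 2 + a ^+ 2 * (c ^+ 2 + s ^+ 2) + b ^+ 2 * (c' ^+ 2 + s' ^+ 2)
  + 2 * a * b * (c' * c - s' * s) - 2 * p * a * c - 2 * p * b * c'); first by ring.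
by rewrite e e'; ring.
Qed.

(** The worst argument is the boundary ray, because the derivative in the angle is nonnegative on
    [[0, alpha n]]. With the cosines bounded by [1], its bracket is at least
    [rho * (1 - x) * s - x * (rho - 1) * s'], where [rho = r^-1], [x = r ^+ n], [s = sin u] and
    [s' = sin (n * u)]. This is nonnegative since [s' <= n * s] and, by Bernoulli at [r^-1],
    [n * x * (rho - 1) <= rho * (1 - x)]. *)
Lemma crossing_poly_le n r t : 0 < r <= 1 -> `|t| <= alpha R n ->
  crossing_poly n r t <= crossing_poly n r (alpha R n).
Proof.
move=> /andP[r0 r1] ht.
have -> : crossing_poly n r t = crossing_poly n r `|t|.
  rewrite /crossing_poly -(cos_norm t) -(cos_norm (n%:R * t)) -(cos_norm (n.+1%:R * t)).
  by rewrite !normrM !normr_nat.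
have := normr_ge0 t; move: `|t| ht => {}t ta t0.
have D u : is_derive u (1 : R) (crossing_poly n r)
    (2 * n.+1%:R * n%:R * (r^-1 * sin u + r ^+ n * sin (n%:R * u)
      - r^-1 * r ^+ n * sin (n.+1%:R * u))).
  have dc k : is_derive u (1 : R) (fun t => cos (k * t)) (- sin (k * u) * k).
    have dk : is_derive u (1 : R) (k \*: id : R -> R) k.
      by apply: is_derive_eq; rewrite /GRing.scale/= mulr1.
    exact: (is_derive1_comp (is_derive_cos (k * u)) dk).
  rewrite (_ : crossing_poly n r =
    cst (n.+1%:R ^+ 2 + (n%:R * r^-1) ^+ 2 + (r ^+ n) ^+ 2)
    + (2 * (n%:R * r^-1) * r ^+ n) \*: (fun t => cos (n.+1%:R * t))
    - (2 * n.+1%:R * (n%:R * r^-1)) \*: @cos R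
    - (2 * n.+1%:R * r ^+ n) \*: (fun t => cos (n%:R * t)))//.
  by apply: is_derive_eq; rewrite /GRing.scale/=; ring.
apply: (le_of_derive_ge0 ta D) => u /andP[tu ua].
rewrite !mulr_ge0// subr_ge0.
have pi0 := @pi_gt0 R; have a0 := alpha_gt0 R n.
have u0 : 0 <= u by lra.
have n0 : (0 : R) <= n%:R by [].
have e : n.+1%:R * alpha R n = pi / 2 := alphaM R n.
have e' : n.+1%:R * u = n%:R * u + u by rewrite -natr1 mulrDl mul1r.
have e'' : n.+1%:R * alpha R n = n%:R * alpha R n + alpha R n by rewrite -natr1 mulrDl mul1r.
have nu : n%:R * u <= n%:R * alpha R n by rewrite ler_wpM2l.
have nu0 : 0 <= n%:R * u by rewrite mulr_ge0.
have su : 0 <= sin u by apply: sin_ge0_pi; nra.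
have snu : 0 <= sin (n%:R * u) by apply: sin_ge0_pi; lra.
have sn : sin (n%:R * u) <= n%:R * sin u by apply: sin_natmul_le => //; nra.
rewrite e' sinD.
have := cos_le1 u; have := cos_le1 (n%:R * u).
have : n%:R * r ^+ n * (1 - r) <= 1 - r ^+ n.
  have := @bernoulli_le r^-1 n; rewrite invr_ge0 ltW// => /(_ isT).
  rewrite exprVn => h.
  have rn : 0 < r ^+ n by rewrite exprn_gt0.
  have : (1 + n%:R * (r^-1 - 1)) * r ^+ n <= 1.
    by rewrite -ler_pdivlMr// mul1r.
  have : (1 - r) <= (r^-1 - 1).
    rewrite -subr_ge0 (_ : _ - _ = (r - 1) ^+ 2 / r); last by field; rewrite gt_eqF.
    by rewrite divr_ge0 ?sqr_ge0// ltW.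
  have : 0 <= n%:R * r ^+ n by rewrite mulr_ge0// ltW.
  nra.
have : 1 <= r^-1 by rewrite invf_ge1.
have : 0 < r ^+ n <= 1 by rewrite exprn_gt0// exprn_ile1// ltW.
have : r * r^-1 = 1 by rewrite mulfV// gt_eqF.
move: (r ^+ n) (r^-1) (cos u) (cos (n%:R * u)) (sin u) (sin (n%:R * u)) su snu sn =>
  x rho c c' s s' s0 s'0 s's rr /andP[x0 x1] rho1 hx c'1 c1.
have h1 : rho * s * x * c' <= rho * s * x by rewrite ler_piMr// !mulr_ge0//; lra.
have h2 : rho * s' * x * c <= rho * s' * x by rewrite ler_piMr// !mulr_ge0//; lra.
have h3 : x * (rho - 1) * s' <= x * (rho - 1) * (n%:R * s).
  by rewrite ler_wpM2l// mulr_ge0//; lra.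
have h4 : n%:R * x * (rho - 1) <= rho * (1 - x).
  have : rho * (n%:R * x * (1 - r)) <= rho * (1 - x) by rewrite ler_wpM2l//; lra.
  rewrite (_ : rho * (n%:R * x * (1 - r)) = n%:R * x * (rho - r * rho)); last by ring.
  by rewrite rr.
have h5 : n%:R * x * (rho - 1) * s <= rho * (1 - x) * s by rewrite ler_wpM2r.
lra.
Qed.

Lemma pi_sq4_le : (pi : R) ^+ 2 / 4 <= 62 / 25.
Proof. by have := @pi_lt R; have := @pi_gt R; nra. Qed.

Lemma cos_alpha n : 2 * n.+1%:R ^+ 2 * (1 - cos (alpha R n)) <= pi ^+ 2 / 4.
Proof.
have := alphaM R n; have := cos_ge (alpha R n).
move: (alpha R n) (cos _) (n.+1%:R) => a c p ca e.
have -> : pi ^+ 2 / 4 = (p * a) ^+ 2 :> R by rewrite e; field.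
by have := sqr_ge0 p; nra.
Qed.

Lemma sin_alpha n : 2 * n.+1%:R * sin (alpha R n) >= pi * (1 - alpha R n ^+ 2 / 6).
Proof.
have := alphaM R n; have := sin_ge3 (ltW (alpha_gt0 R n)).
have : (0 : R) <= n.+1%:R by [].
move: (alpha R n) (sin _) (n.+1%:R) => a s p p0 sa e.
have -> : pi = 2 * (p * a) :> R by rewrite e; field.
by nra.
Qed.

(** The quantity increases with [p] from [6 * sin (pi / 6) = 3] at [p = 3] towards [pi]. At [p = 2]
    it is only [2 * sqrt 2], which is why that case has its own constants. *)
Lemma sin_alpha_ge n : (1 < n)%N -> 299 / 100 <= 2 * n.+1%:R * sin (alpha R n).
Proof.
move=> n1; apply: le_trans (sin_alpha n).
have := alphaM R n; have : (3 : R) <= n.+1%:R by rewrite ler_nat.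
have := @pi_lt R; have := @pi_gt R; have := alpha_gt0 R n.
move: (alpha R n) (n.+1%:R) (pi : R) => a p q a0 q1 q2 p3 e.
have {}e : a <= 524 / 1000 by nra.
have : a ^+ 2 / 6 <= 46 / 1000 by nra.
nra.
Qed.

Lemma sin_alpha1_ge : 28 / 10 <= 2 * 2%:R * sin (alpha R 1).
Proof.
apply: le_trans (sin_alpha 1).
have := alphaM R 1.
have := @pi_lt R; have := @pi_gt R; have := alpha_gt0 R 1.
move: (alpha R 1) (pi : R) => a q a0 q1 q2 e.
have {}e : a <= 786 / 1000 by lra.
have : a ^+ 2 / 6 <= 103 / 1000 by nra.
nra.
Qed.

End Crossing.

Section HalfDiscImage.
Variable R : realType.
Local Notation C := R[i].
Implicit Types (h z : C) (r t x v : R) (n : nat).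

(** In the variable [v = n / r] the power [r ^+ n] becomes [(n / v) ^+ n]. The first bound is
    Bernoulli's inequality; the second follows from [(v / n) ^+ n <= exp (v - n)], with [11 / 30]
    just below [exp (- 1)]. *)
Lemma crossing_exp_ge n v : (0 < n)%N -> n%:R <= v < n.+1%:R ->
  n.+1%:R - v <= (n%:R / v) ^+ n /\ 11 / 30 * (1 + (n.+1%:R - v)) <= (n%:R / v) ^+ n.
Proof.
move=> n0 /andP[nv vp].
have n1 : (1 : R) <= n%:R by rewrite ler1n.
have v0 : 0 < v by lra.
rewrite -natr1 in vp *; split.
  have : 0 <= n%:R / v by rewrite divr_ge0// ltW.
  move=> /(@bernoulli_le R _ n); apply: le_trans.
  have : n%:R * (n%:R / v - 1) >= n%:R - v.
    rewrite -subr_ge0 (_ : _ - _ = (n%:R - v) ^+ 2 / v); last by field; rewrite gt_eqF.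
    by rewrite divr_ge0 ?sqr_ge0// ltW.
  lra.
set s := n%:R + 1 - v.
have h1 : (v / n%:R) ^+ n <= expR (1 - s).
  rewrite [1 - s](_ : _ = n%:R * ((1 - s) / n%:R)); last by field; rewrite pnatr_eq0 -lt0n.
  rewrite expRM_natl lerXn2r ?nnegrE ?expR_ge0 ?divr_ge0 ?(ltW v0)//.
    apply: le_trans _ (expR_ge1Dx _); rewrite /s le_eqVlt; apply/orP; left; apply/eqP.
  by field; rewrite pnatr_eq0 -lt0n.
have h2 : expR (- (1 - s)) <= (n%:R / v) ^+ n.
  rewrite expRN -[n%:R / v]invf_div exprVn lef_pV2 ?posrE ?expR_gt0//.
  by rewrite exprn_gt0// divr_gt0//; lra.
apply: le_trans h2; rewrite (_ : - (1 - s) = -1 + s); last by ring.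
rewrite expRD; have := expR_ge1Dx s; have := @expRN1_ge R; rewrite /s.
have := expR_ge0 (n%:R + 1 - v); nra.
Qed.

Lemma quadratic_ge (p v b0 b k c : R) : 0 < k -> c ^+ 2 <= 4 * k * b0 -> b0 <= b ->
  c * (v * p) - p ^+ 2 * b <= k * v ^+ 2.
Proof.
move=> k0 disc bb.
rewrite -subr_ge0; have k4 : 0 < 4 * k by rewrite mulr_gt0.
rewrite -(pmulr_rge0 _ k4).
rewrite (_ : 4 * k * _ = (2 * k * v - c * p) ^+ 2 + (4 * k * b0 - c ^+ 2) * p ^+ 2
  + 4 * k * p ^+ 2 * (b - b0)); last by ring.
have k4p : 0 <= 4 * k * p ^+ 2 by rewrite mulr_ge0 ?sqr_ge0// ltW.
have d0 : 0 <= (4 * k * b0 - c ^+ 2) * p ^+ 2 by rewrite mulr_ge0 ?sqr_ge0 ?subr_ge0.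
have e0 : 0 <= 4 * k * p ^+ 2 * (b - b0) by rewrite mulr_ge0 ?subr_ge0.
by rewrite !addr_ge0 ?sqr_ge0.
Qed.

Lemma concave_incr (c x y : R) : 2 <= c -> y <= x -> x <= 1 ->
  c * y - y ^+ 2 <= c * x - x ^+ 2.
Proof.
move=> c2 yx x1; rewrite -subr_ge0.
rewrite (_ : _ - _ = (x - y) * (c - x - y)); last by ring.
by rewrite mulr_ge0; lra.
Qed.

Lemma crossing_large (c x s : R) : 2 <= c -> c <= 3 -> 1 / 2 <= s -> s <= x -> x <= 1 ->
  c - 2 <= c * x - x ^+ 2 - s ^+ 2.
Proof.
move=> c2 c3 s2 sx x1; have := concave_incr c2 sx x1.
have : 0 <= (1 - s) * (2 * (1 + s) - c) by rewrite mulr_ge0; lra.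
lra.
Qed.

Lemma crossing_small_square (x s : R) : 0 <= s <= 1 / 2 -> 11 / 30 * (1 + s) <= x -> x <= 1 ->
  4 / 5 <= 14 / 5 * x - x ^+ 2 - s ^+ 2.
Proof.
move=> /andP[s0 s1] sx x1; have := @concave_incr (14 / 5) _ _ _ sx x1.
have : 0 <= s * (1 / 2 - s) by rewrite mulr_ge0; lra.
by move=> h1 /(_ ltac:(lra)) h2; lra.
Qed.

(** The discriminant test of [quadratic_ge] would need a bracket of at least about [0.984], but at
    [v = p], [x = 11 / 30] it is only about [0.962]. As [v] is close to [p] here, substituting
    [v = p - s] and estimating directly is enough. *)
Lemma crossing_small (p v x : R) : 3 <= p -> 0 <= p - v <= 1 / 2 ->
  11 / 30 * (1 + (p - v)) <= x -> x <= 1 ->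
  62 / 25 * (v * p) - p ^+ 2 * (299 / 100 * x - x ^+ 2 - (p - v) ^+ 2) <= 25 / 16 * v ^+ 2.
Proof.
have [s ->] : exists s, v = p - s by exists (p - v); ring.
rewrite subKr => p3 /andP[s0 s1] sx x1.
have := @concave_incr (299 / 100) _ _ _ sx x1 => /(_ ltac:(lra)).
move=> /(ler_wpM2l (sqr_ge0 p)) h.
have h0 : 0 <= s * (1 / 2 - s) by rewrite mulr_ge0//; lra.
have h1 : 0 <= s * p * (p - 3) by rewrite !mulr_ge0//; lra.
have h2 : 0 <= s * (1 / 2 - s) * p ^+ 2 by rewrite mulr_ge0 ?sqr_ge0.
have h4 := sqr_ge0 p; have h5 := mulr_ge0 s0 h4; have h6 := sqr_ge0 s.
lra.
Qed.

(** With [v = n / r] and [x = r ^+ n], the left side is [p ^+ 2] times the crossing polynomial on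
    the boundary ray, and the constants on the right are [(p * beta n) ^+ 2]. For [p - v > 1 / 2]
    the inequality [x >= p - v] bounds the bracket below well enough for a discriminant argument in
    [v] and [p]; for smaller [p - v] the exponential bound on [x] takes its place. *)
Lemma crossing_numeric n v (x c s : R) : (0 < n)%N -> n%:R <= v < n.+1%:R ->
  n.+1%:R - v <= x <= 1 -> 11 / 30 * (1 + (n.+1%:R - v)) <= x ->
  2 * n.+1%:R ^+ 2 * (1 - c) <= 62 / 25 ->
  (if n == 1 then 14 / 5 else 299 / 100) <= 2 * n.+1%:R * s ->
  n.+1%:R ^+ 2 * ((n.+1%:R - v) ^+ 2 + 2 * n.+1%:R * v * (1 - c) + x ^+ 2
     - 2 * n.+1%:R * x * s)
  <= (if n == 1 then 49 / 25 else 25 / 16) * v ^+ 2.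
Proof.
move=> n0 /andP[v1 v2] /andP[x1 x2] x3 hc hs.
set S0 : R := if _ then _ else _ in hs.
have p0 : (0 : R) < n.+1%:R by rewrite ltr0n.
have vn : 0 <= v by apply: le_trans v1.
have sg0 : 0 <= n.+1%:R - v by rewrite subr_ge0 ltW.
have x0 : 0 <= x by apply: le_trans x1.
have {}hc : 2 * n.+1%:R ^+ 2 * (1 - c) * (v * n.+1%:R) <= 62 / 25 * (v * n.+1%:R).
  by rewrite ler_wpM2r// mulr_ge0// ltW.
have {}hs : S0 * (x * n.+1%:R ^+ 2) <= 2 * n.+1%:R * s * (x * n.+1%:R ^+ 2).
  by rewrite ler_wpM2r// mulr_ge0// sqr_ge0.
apply: (@le_trans _ _ (62 / 25 * (v * n.+1%:R)
    - n.+1%:R ^+ 2 * (S0 * x - x ^+ 2 - (n.+1%:R - v) ^+ 2))).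
  by clear - hc hs; move: (S0) (n.+1%:R) hc hs => a p hc hs; lra.
rewrite /S0; have [s2|s2] := leP (n.+1%:R - v) (1 / 2); last first.
  have h a a2 a3 := @crossing_large a x (n.+1%:R - v) a2 a3 (ltW s2) x1 x2.
  clear - h; case: ifP => _.
    apply: (@quadratic_ge _ _ (4 / 5)); [lra | lra |].
    by apply: le_trans _ (h (14 / 5) _ _); lra.
  apply: (@quadratic_ge _ _ (99 / 100)); [lra | lra |].
  by apply: le_trans _ (h (299 / 100) _ _); lra.
have sgh : 0 <= n.+1%:R - v <= 1 / 2 by rewrite sg0.
case: eqP => [n1 | /eqP n1].
  have h := crossing_small_square sgh x3 x2.
  by apply: (@quadratic_ge _ _ (4 / 5)) => //; clear; lra.
apply: crossing_small => //.
by case: n n0 n1 {v1 v2 x1 x2 x3 hc hs S0 p0 sg0 sgh s2} => [|[|n]]// _ _; rewrite ler_nat.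
Qed.

End HalfDiscImage.

(** * Landing in a ball around 1 *)

Section Ball.
Variable R : realType.
Local Notation C := R[i].
Implicit Types (h z u : C) (r t x v y : R) (n : nat).

(* Large enough for the ball of this radius around [1] to catch every step that
   leaves the half disc, small enough for the ball to be stable. *)
Definition beta n : R := if n == 1 then 7 / 10 else 5 / 4 / n.+1%:R.

Lemma crossing_polyD n r t h : h = r%:C * cis t ->
  cabs (n%:R * h^-1 + h ^+ n) ^+ 2 =
  (n%:R * r^-1) ^+ 2 + (r ^+ n) ^+ 2 + 2 * (n%:R * r^-1) * r ^+ n * cos (n.+1%:R * t).
Proof.
move=> ->; rewrite polarX polarV !polarE cosN sinN -!(rmorph_nat (real_complex R)).
set w := _ + _.
have -> : w = (n%:R * r^-1 * cos t + r ^+ n * cos (n%:R * t))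
    +i* (- (n%:R * r^-1 * sin t) + r ^+ n * sin (n%:R * t)).
  by rewrite /w; simpc; rewrite !mulrA.
have ec : cos (n.+1%:R * t) = cos (n%:R * t) * cos t - sin (n%:R * t) * sin t.
  by rewrite -natr1 mulrDl mul1r cosD.
rewrite cabs_sqr ec.
have := cos2Dsin2 t; have := cos2Dsin2 (n%:R * t).
move: (cos t) (sin t) (cos _) (sin _) (n%:R * r^-1) (r ^+ n) => c s c' s' a b e' e.
transitivity (a ^+ 2 * (c ^+ 2 + s ^+ 2) + b ^+ 2 * (c' ^+ 2 + s' ^+ 2)
  + 2 * a * b * (c' * c - s' * s)); first by ring.
by rewrite e e'; ring.
Qed.

Lemma cos_alphaM_ge0 n t : `|t| <= alpha R n -> 0 <= cos (n.+1%:R * t).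
Proof.
move=> ht; apply: cos_ge0_pihalf; rewrite -ler_norml normrM normr_nat -(alphaM R n).
by rewrite ler_wpM2l.
Qed.

(** The arguments of [n / h] and [h ^ n] differ by [p * |t|], at most a right angle, so adding the
    second does not shorten the first. The radius may exceed [1]. *)
Lemma crossing_denom n r t h : 0 < r -> `|t| <= alpha R n -> h = r%:C * cis t ->
  n%:R * r^-1 <= cabs (n%:R * h^-1 + h ^+ n).
Proof.
move=> r0 ht eh; have v0 : 0 <= n%:R * r^-1 by rewrite divr_ge0// ltW.
rewrite -(@ler_pXn2r _ 2) ?nnegrE ?cabs_ge0//.
rewrite (crossing_polyD n eh) -addrA lerDl addr_ge0 ?sqr_ge0//.
by rewrite mulr_ge0 ?cos_alphaM_ge0// mulr_ge0 ?exprn_ge0 ?(ltW r0)// mulr_ge0.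
Qed.

Lemma crossing_poly_alpha n r : crossing_poly n r (alpha R n) =
  (n.+1%:R - n%:R * r^-1) ^+ 2 + 2 * n.+1%:R * (n%:R * r^-1) * (1 - cos (alpha R n))
  + (r ^+ n) ^+ 2 - 2 * n.+1%:R * r ^+ n * sin (alpha R n).
Proof.
have e : n%:R * alpha R n = pi / 2 - alpha R n.
  by rewrite -(alphaM R n) -natr1 mulrDl mul1r addrK.
rewrite /crossing_poly alphaM cos_pihalf e cosB cos_pihalf sin_pihalf; ring.
Qed.

Lemma hstep_sub1 n h : h != 0 -> n%:R * h^-1 + h ^+ n != 0 ->
  cabs (hstep n h - 1) = cabs (n%:R * h^-1 + h ^+ n - n.+1%:R) / cabs (n%:R * h^-1 + h ^+ n).
Proof.
move=> h0; have e : hstep n h = n.+1%:R / (n%:R * h^-1 + h ^+ n).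
  by rewrite -[LHS]invrK hstepV// invf_div.
rewrite e; move: (_ + _) => w w0.
by rewrite -[X in _ - X](mulfV w0) -mulrBl cabsM cabsV cabs_distC.
Qed.

Lemma sin_alpha_bound n : (0 < n)%N ->
  (if n == 1 then 14 / 5 else 299 / 100) <= 2 * n.+1%:R * sin (alpha R n).
Proof.
case: n => [|[|n]]// _; last exact: sin_alpha_ge.
by have := sin_alpha1_ge R; rewrite /=; apply: le_trans; lra.
Qed.

Lemma cos_alpha_bound n : 2 * n.+1%:R ^+ 2 * (1 - cos (alpha R n)) <= 62 / 25.
Proof. exact: le_trans (cos_alpha R n) (pi_sq4_le R). Qed.

(** Since [hstep n h = p / w] with [w = n / h + h ^ n], leaving the disc means [|w| < p]. Together
    with [n / r <= |w|] this confines [v = n / r] to the interval of [crossing_numeric], and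
    [|w| >= v] also serves for the denominator of [|w - p| / |w|]. *)
Lemma hstep_crossing n r t h : (0 < n)%N -> 0 < r <= 1 -> `|t| <= alpha R n ->
  h = r%:C * cis t -> 1 < cabs (hstep n h) -> cabs (hstep n h - 1) <= beta n.
Proof.
move=> n0 r01 ht eh; have /andP[r0 r1] := r01.
have h0 : h != 0 by rewrite eh mulf_neq0 ?cis_neq0// (inj_eq (@complexI R)) gt_eqF.
have hw := crossing_denom r0 ht eh.
have n1 : (1 : R) <= n%:R by rewrite ler1n.
have v1 : n%:R <= n%:R * r^-1 by rewrite ler_peMr// invf_ge1.
have p0 : (0 : R) < n.+1%:R by rewrite ltr0n.
have v0 : 0 < n%:R * r^-1 by rewrite (lt_le_trans _ v1)//; lra.
set w := n%:R * h^-1 + h ^+ n in hw.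
have w0 : 0 < cabs w by apply: lt_le_trans hw.
have wn0 : w != 0 by rewrite -cabs_gt0.
rewrite hstep_sub1// -[hstep n h]invrK hstepV// -/w invf_div cabsM cabsV cabs_nat.
rewrite ltr_pdivlMr// mul1r => wp.
have hv : n%:R <= n%:R * r^-1 < n.+1%:R by rewrite v1 (le_lt_trans hw).
have er : r = n%:R / (n%:R * r^-1).
  by rewrite invfM invrK mulrA mulfV ?mul1r// gt_eqF//; lra.
have [x1 x2] := crossing_exp_ge n0 hv; rewrite -er in x1 x2.
have x3 : n.+1%:R - n%:R * r^-1 <= r ^+ n <= 1 by rewrite x1 exprn_ile1// ltW.
have := crossing_numeric n0 hv x3 x2 (cos_alpha_bound n) (sin_alpha_bound n0).
rewrite -crossing_poly_alpha; have := crossing_poly_le r01 ht.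
rewrite -(crossing_polyE n eh) -/w => h1 h2.
rewrite ler_pdivrMr//.
have h3 : n.+1%:R ^+ 2 * cabs (w - n.+1%:R) ^+ 2
    <= (if n == 1 then 49 / 25 else 25 / 16) * cabs w ^+ 2.
  apply: le_trans (ler_wpM2l (sqr_ge0 _) h1) _; apply: le_trans h2 _.
  rewrite ler_wpM2l//; first by case: ifP => _; lra.
  by rewrite lerXn2r ?nnegrE ?cabs_ge0// ltW.
rewrite -(ler_pM2l p0) -(@ler_pXn2r _ 2) ?nnegrE ?mulr_ge0 ?cabs_ge0//; last first.
  by rewrite /beta; case: ifP => _; rewrite ?divr_ge0//; lra.
rewrite exprMn; apply: le_trans h3 _.
rewrite [leRHS](_ : _ = (n.+1%:R * beta n) ^+ 2 * cabs w ^+ 2); last by ring.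
rewrite le_eqVlt; apply/orP; left; apply/eqP; congr (_ * _); rewrite /beta.
by case: eqP => [->|_]; [lra | field; rewrite gt_eqF].
Qed.

(** The point is compared with [h1] of the same argument on the unit circle. There
    [p * |w1 - p| / n] is at most [111 / 80] or [1247 / 1000], slightly less than [p * beta n],
    which is [7 / 5] or [5 / 4]; the margin pays for replacing [w1] by [w]. *)
Lemma hstep_outside n r t h : (0 < n)%N -> 1 <= r -> r ^+ n.+1 <= 1 + 1 / 2000 ->
  `|t| <= alpha R n -> h = r%:C * cis t ->
  n%:R * h^-1 + h ^+ n != 0 /\ cabs (hstep n h - 1) <= beta n.
Proof.
have p0 : (0 : R) < n.+1%:R by rewrite ltr0n.
have k1 : 1 / 1000 < 1 :> R by lra.
have pb : n.+1%:R * beta n = if n == 1 then 7 / 5 else 5 / 4.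
  by rewrite /beta; case: eqP => [->|_]; [lra | field; rewrite gt_eqF].
move=> n0 r1 rp ht eh.
have r0 : 0 < r by lra.
have n1 : (1 : R) <= n%:R by rewrite ler1n.
have h0 : h != 0 by rewrite eh mulf_neq0 ?cis_neq0// (inj_eq (@complexI R)) gt_eqF.
have r01 : 0 < (1 : R) <= 1 by apply/andP; split; lra.
pose h1 : C := (1 : R)%:C * cis t.
set w := n%:R * h^-1 + h ^+ n; pose w1 := n%:R * h1^-1 + h1 ^+ n.
(* Both [n * (1 - 1 / r)] and [r ^+ n - 1] are at most [r ^+ n.+1 - 1 <= 1 / 2000]. *)
have e1 : cabs (w - w1) <= 1 / 1000.
  rewrite (_ : w - w1 = n%:R * (r^-1 - 1)%:C * cis (- t) + (r ^+ n - 1)%:C * cis (n%:R * t)).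
    rewrite (le_trans (cabsD _ _))// !cabsM !cabs_cis !mulr1 !cabs_real cabs_nat.
    rewrite ler0_norm ?subr_le0 ?invf_le1// ger0_norm ?subr_ge0 ?exprn_ege1// opprB.
    have b := bernoulli_le n (ltW r0).
    have : r ^+ n <= r ^+ n.+1 by rewrite ler_weXn2l.
    have : n%:R * (1 - r^-1) <= n%:R * (r - 1).
      rewrite ler_wpM2l// -subr_ge0 (_ : _ - _ = (r - 1) ^+ 2 / r).
        by rewrite divr_ge0 ?sqr_ge0// ltW.
      by field; rewrite gt_eqF.
    lra.
  rewrite /w /w1 /h1 eh !polarX !polarV invr1 expr1n !rmorphB /= !rmorph1; ring.
have n1v : n%:R <= cabs w1.
  by have := @crossing_denom n 1 t h1 ltr01 ht erefl; rewrite invr1 mulr1.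
have b1 : n.+1%:R * cabs (w1 - n.+1%:R) <= (if n == 1 then 111 / 80 else 1247 / 1000) * n%:R.
  rewrite -(@ler_pXn2r _ 2) ?nnegrE ?mulr_ge0 ?cabs_ge0//; last first.
    by case: ifP => _; lra.
  rewrite exprMn (crossing_polyE n (erefl h1)).
  apply: le_trans (ler_wpM2l (sqr_ge0 _) (crossing_poly_le r01 ht)) _.
  rewrite crossing_poly_alpha expr1n invr1 !mulr1 -natr1.
  have hc := cos_alpha_bound n; have hs := sin_alpha_bound n0.
  have {}hc : 2 * n.+1%:R ^+ 2 * (1 - cos (alpha R n)) * (n%:R * n.+1%:R) <= 62 / 25 * (n%:R * n.+1%:R).
    by rewrite ler_wpM2r// mulr_ge0.
  set S0 : R := if _ then _ else _ in hs.
  have {}hs : S0 * n.+1%:R ^+ 2 <= 2 * n.+1%:R * sin (alpha R n) * n.+1%:R ^+ 2.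
    by rewrite ler_wpM2r// sqr_ge0.
  apply: (@le_trans _ _ (62 / 25 * (n%:R * n.+1%:R) - n.+1%:R ^+ 2 * (S0 - 2))).
    move: hc hs; rewrite -natr1; clear; move: (S0) => a hc hs; lra.
  rewrite exprMn /S0; clear; case: ifP => _.
    by apply: (@quadratic_ge _ _ _ (4 / 5)); lra.
  by apply: (@quadratic_ge _ _ _ (99 / 100)); lra.
have dw : n%:R - 1 / 1000 <= cabs w.
  rewrite lerBlDr; apply: le_trans n1v _; rewrite -[w1](subrK w).
  by apply: le_trans (cabsD _ _) _; rewrite addrC lerD2l cabs_distC.
have w0 : 0 < cabs w by apply: lt_le_trans dw; rewrite subr_gt0; exact: lt_le_trans k1 n1.
have wn0 : w != 0 by rewrite -cabs_gt0.
split => //; rewrite hstep_sub1// -/w ler_pdivrMr// -(ler_pM2l p0).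
have dw2 : cabs (w - n.+1%:R) <= cabs (w1 - n.+1%:R) + 1 / 1000.
  have -> : w - n.+1%:R = (w1 - n.+1%:R) + (w - w1) by rewrite [RHS]addrC subrKA.
  by apply: le_trans (cabsD _ _) _; rewrite lerD2l.
apply: le_trans (ler_wpM2l (ltW p0) dw2) _; rewrite mulrDr.
apply: le_trans (lerD b1 (lexx _)) _; rewrite [leRHS]mulrA.
rewrite pb; have [e|n2] := eqVneq n 1%N.
  by move: dw; clear - e; rewrite e; lra.
have n3 : (2 : R) <= n%:R by rewrite ler_nat ltn_neqAle eq_sym n2.
by move: dw; clear - n3; rewrite -[n.+1%:R]natr1; lra.
Qed.

End Ball.

(** * Contraction in the ball around 1 *)

Section InvariantBall.
Variable R : realType.
Local Notation C := R[i].
Implicit Types (h z u : C) (r t x v y : R) (n : nat).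

Lemma beta_gt0 n : 0 < beta R n.
Proof. by rewrite /beta; case: ifP => _; [lra | rewrite divr_gt0// ltr0n]. Qed.

Lemma beta_ge n : (0 < n)%N -> 5 / 4 / n.+1%:R <= beta R n.
Proof. by rewrite /beta; case: eqP => [-> _|_ _ //]; rewrite ler_pdivrMr//; lra. Qed.

(** The sine is the distance from [1] to the boundary rays of the sector, so the ball lies inside
    the sector. *)
Lemma beta_le_sin n : (0 < n)%N -> beta R n <= sin (alpha R n).
Proof.
move=> n0; have := sin_alpha_bound R n0; rewrite /beta; case: eqP => [-> h|_ h]; first lra.
by rewrite ler_pdivrMr ?ltr0n//; lra.
Qed.

(** In polar coordinates the disc [|z - 1| <= 1] is [|z| <= 2 * cos (arg z)], here for [z = h ^ p].
    Everything is reduced to [c = cos (p * t)]: Bernoulli bounds [p * (r - 1)] by [2 * c - 1], and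
    the quartic bound of the cosine bounds [(p * t) ^+ 2] by a multiple of [1 - c]. *)
Lemma disc_in_ball n r t h : (0 < n)%N -> 1 <= r -> r ^+ n.+1 <= 2 * cos (n.+1%:R * t) ->
  `|t| <= alpha R n -> h = r%:C * cis t -> cabs (h - 1) <= beta R n.
Proof.
move=> n0 r1 rp ht ->.
have p0 : (0 : R) < n.+1%:R by rewrite ltr0n.
apply: le_trans (beta_ge n0); rewrite ler_pdivlMr//.
rewrite -(@ler_pXn2r _ 2) ?nnegrE ?mulr_ge0 ?cabs_ge0//.
rewrite exprMn cabs_distC cabs_1B_polar.
have b := @bernoulli_le R r n.+1 (le_trans ler01 r1).
have p2 : (2 : R) <= n.+1%:R by rewrite ler_nat.
have hb : (n.+1%:R * t) ^+ 2 <= 62 / 25.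
  apply: le_trans (pi_sq4_le R).
  rewrite (_ : pi ^+ 2 / 4 = (n.+1%:R * alpha R n) ^+ 2); last by rewrite alphaM; field.
  have a0 := ltW (alpha_gt0 R n).
  rewrite -(real_normK (num_real (_ * t))) normrM normr_nat.
  rewrite lerXn2r ?nnegrE//; do ?[exact: mulr_ge0 | exact: ler_wpM2l].
have h4 := cos_le4 (n.+1%:R * t); have ct := cos_ge t.
have c1 := cos_le1 (n.+1%:R * t).
move: (cos (n.+1%:R * t)) (cos t) (r ^+ n.+1) rp b h4 ct c1 => c c' q rp b h4 ct c1.
move: (n.+1%:R) p0 p2 b hb h4 => p p0 p2 b hb h4.
have {}h4 : 39 / 100 * (p * t) ^+ 2 <= 1 - c.
  rewrite (_ : (p * t) ^+ 4 = (p * t) ^+ 2 * (p * t) ^+ 2) in h4; last by ring.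
  have := ler_wpM2l (sqr_ge0 (p * t)) hb; lra.
have s0 : 0 <= p * (r - 1) <= 2 * c - 1 by rewrite mulr_ge0//; lra.
have s1 : r <= c + 1 / 2.
  have : 2 * (r - 1) <= p * (r - 1) by rewrite ler_wpM2r//; lra.
  lra.
have s2 : (p * (r - 1)) ^+ 2 <= (2 * c - 1) ^+ 2 by case/andP: s0 => *; rewrite lerXn2r// nnegrE; lra.
have s3 : r * (p * t) ^+ 2 <= (c + 1 / 2) * ((1 - c) * 100 / 39).
  by apply: ler_pM => //; [lra | exact: sqr_ge0 | lra].
have s4 : r * p ^+ 2 * (1 - c') *+ 2 <= r * (p * t) ^+ 2.
  have : 0 <= r * p ^+ 2 by rewrite mulr_ge0 ?sqr_ge0//; lra.
  move=> /ler_wpM2l /(_ _ _ ct); lra.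
have s5 : 0 <= (c - 1 / 2) * (1 - c) by rewrite mulr_ge0//; lra.
lra.
Qed.

(** The binomial remainder of order two has nonnegative coefficients. *)
Lemma newton_remainder_le u n :
  cabs ((1 + u) ^+ n - 1 - n%:R * u) <= (1 + cabs u) ^+ n - 1 - n%:R * cabs u.
Proof.
elim: n => [|n IH]; first by rewrite !expr0 !mul0r !subrr cabs0.
have -> : (1 + u) ^+ n.+1 - 1 - n.+1%:R * u =
   (1 + u) * ((1 + u) ^+ n - 1 - n%:R * u) + n%:R * u ^+ 2.
  by rewrite exprS -natr1; ring.
have -> : (1 + cabs u) ^+ n.+1 - 1 - n.+1%:R * cabs u =
   (1 + cabs u) * ((1 + cabs u) ^+ n - 1 - n%:R * cabs u) + n%:R * cabs u ^+ 2.
  by rewrite exprS -natr1; ring.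
rewrite (le_trans (cabsD _ _))// !cabsM cabs_nat lerD// ler_pM ?cabs_ge0//.
by rewrite (le_trans (cabsD _ _))// cabs1.
Qed.

Lemma newton_remainder_ge0 x n : 0 <= x -> 0 <= (1 + x) ^+ n - 1 - n%:R * x.
Proof. by move=> x0; have := @bernoulli_le R (1 + x) n ltac:(lra); lra. Qed.

(** The remainder divided by its argument is nondecreasing, so a contraction factor found at the
    radius of a ball is valid in the whole ball. *)
Lemma newton_remainder_chord x y n : 0 <= x <= y ->
  y * ((1 + x) ^+ n - 1 - n%:R * x) <= x * ((1 + y) ^+ n - 1 - n%:R * y).
Proof.
move=> /andP[x0 xy]; elim: n => [|n IH]; first by rewrite !expr0 !mul0r !subrr !mulr0.
have e (z : R) : (1 + z) ^+ n.+1 - 1 - n.+1%:R * z =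
   (1 + z) * ((1 + z) ^+ n - 1 - n%:R * z) + n%:R * z ^+ 2 :> R.
  by rewrite exprS -natr1; ring.
rewrite !e mulrDr [leRHS]mulrDr; apply: lerD.
  rewrite mulrCA [leRHS]mulrCA; apply: ler_pM => //; try lra.
  by rewrite mulr_ge0 ?newton_remainder_ge0//; lra.
rewrite -subr_ge0 (_ : _ - _ = n%:R * (x * y * (y - x))); last by ring.
by rewrite mulr_ge0// !mulr_ge0//; lra.
Qed.

Lemma expR_ge2 x : 0 <= x -> 1 + x + x ^+ 2 / 2 <= expR x.
Proof.
move=> x0.
have D (u : R) : is_derive u (1 : R) (expR - id - 2^-1 \*: id ^+ 2 : R -> R) (expR u - (1 + u)).
  by apply: is_derive_eq; rewrite /GRing.scale/=; field.
have h := le_of_derive_ge0 x0 D.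
have : expR 0 - 0 - 2^-1 * 0 ^+ 2 <= expR x - x - 2^-1 * x ^+ 2.
  by apply: h => u _; have := expR_ge1Dx u; lra.
rewrite expR0; lra.
Qed.

(** The right side is [1 + b + 999 / 1000 * b] at [b = 5 / 4]: this is the limit of the contraction
    condition as [p] grows. It holds by less than [1 / 100], so the exponential is computed as the
    fifth power of its value at [1 / 4]. *)
Lemma expR54_le : expR (5 / 4 : R) <= 7 / 2 - 1 / 800.
Proof.
have h := @expRN_ge3 R 4^-1 ltac:(lra).
have -> : (5 / 4 : R) = - (5%:R * (- 4^-1)) by field.
rewrite expRN expRM_natl; set e := expR _ in h *.
have {}h : 1557 / 2000 <= e by apply: le_trans h; lra.
have h2 : 303 / 500 <= e ^+ 2 by rewrite expr2; nra.
have h5 : (303 / 500) ^+ 2 * (1557 / 2000) <= e ^+ 5.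
  rewrite (_ : e ^+ 5 = e ^+ 2 ^+ 2 * e); last by ring.
  have h4 : (303 / 500) ^+ 2 <= e ^+ 2 ^+ 2 by move: (e ^+ 2) h2 => q h2; nra.
  move: (e ^+ 2 ^+ 2) h4 => q h4; clear h2; nra.
rewrite -div1r ler_pdivrMr; last by rewrite exprn_gt0// /e expR_gt0.
by move: (e ^+ 5) h5 => q h5; clear h h2; lra.
Qed.

(* With [y = 5/4/p], [1 + y] is at most [exp y / (1 + (y^2/2)/(1 + y))]. *)
Lemma beta_remainder n : (0 < n)%N ->
  (1 + beta R n) ^+ n.+1 - 1 - n.+1%:R * beta R n <= 999 / 1000 * (n%:R * beta R n).
Proof.
rewrite /beta; case: eqP => [->|/eqP n1] n0; first lra.
have p3 : (3 : R) <= n.+1%:R.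
  by rewrite ler_nat ltnS ltn_neqAle eq_sym n1.
have p0 : (0 : R) < n.+1%:R by rewrite ltr0n.
set y := _ / _.
have py : n.+1%:R * y = 5 / 4 by rewrite /y; field; rewrite gt_eqF.
have ny : n%:R * y = 5 / 4 - y by rewrite -py -natr1; ring.
have y0 : 0 < y by rewrite divr_gt0//; lra.
have y1 : y <= 5 / 12 by rewrite ler_pdivrMr//; lra.
rewrite py ny.
pose z := y ^+ 2 / 2 / (1 + y).
have z0 : 0 <= z by rewrite !divr_ge0 ?sqr_ge0//; lra.
have ez : (1 + y) * (1 + z) = 1 + y + y ^+ 2 / 2.
  by rewrite /z; field; rewrite gt_eqF//; lra.
have h1 : (1 + y) ^+ n.+1 * (1 + z) ^+ n.+1 <= 7 / 2 - 1 / 800.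
  rewrite -exprMn ez; apply: le_trans expR54_le.
  rewrite -py expRM_natl lerXn2r ?nnegrE ?expR_ge0 ?expR_ge2 ?(ltW y0)//.
  by have := sqr_ge0 y; lra.
have h2 : 1 + 44 / 100 * y <= (1 + z) ^+ n.+1.
  apply: le_trans _ (bernoulli_le _ _); last lra.
  rewrite lerD2l addrAC subrr add0r.
  have -> : n.+1%:R * z = 5 / 8 * y / (1 + y).
    have y10 : 1 + y != 0 by rewrite gt_eqF//; lra.
    transitivity ((n.+1%:R * y) * y / 2 / (1 + y)); last by rewrite py; field.
    by rewrite /z; move: (n.+1%:R) => p; field.
  rewrite ler_pdivlMr; last lra.
  have : 0 <= y * (5 / 12 - y) by rewrite mulr_ge0//; lra.
  lra.
have h3 : (1 + y) ^+ n.+1 * (1 + 44 / 100 * y) <= 7 / 2 - 1 / 800.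
  by apply: le_trans h1; rewrite ler_wpM2l// exprn_ge0//; lra.
suff : (1 + y) ^+ n.+1 <= 7 / 2 - 1 / 800 - 999 / 1000 * y by lra.
have d0 : 0 < 1 + 44 / 100 * y by lra.
rewrite -(ler_pM2r d0); apply: le_trans h3 _.
have : 0 <= y * (5 / 12 - y) by rewrite mulr_ge0//; lra.
clear - y0; lra.
Qed.

(** With [w = n / h + h ^ n], the product [h * (w - p)] is the binomial remainder at [u = h - 1],
    while [|h * w| >= n] because the ball lies in the sector. The quotient is largest, relative to
    [|u|], on the boundary of the ball. *)
Lemma hstep_ball n h : (0 < n)%N -> cabs (h - 1) <= beta R n ->
  [/\ h != 0, n%:R * h^-1 + h ^+ n != 0 &
  cabs (hstep n h - 1) <= 999 / 1000 * cabs (h - 1)].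
Proof.
move=> n0 hb; have bs := beta_le_sin n0.
have pi0 := @pi_gt0 R; have a0 := alpha_gt0 R n; have a1 := alpha_lt R n0.
have ha : 0 < alpha R n < pi / 2 by apply/andP; split => //; lra.
have b1 : beta R n <= 7 / 10.
  rewrite /beta; case: eqP => [_|/eqP n1]; first lra.
  have : (3 : R) <= n.+1%:R by rewrite ler_nat ltnS ltn_neqAle eq_sym n1.
  by move=> h3; rewrite ler_pdivrMr//; lra.
have h0 : h != 0.
  apply/eqP => e; move: hb; rewrite e sub0r cabsN cabs1; lra.
have s0 : 0 < sin (alpha R n) by apply: sin_gt0_pi; lra.
have c0 : 0 <= cos (alpha R n) by apply: cos_ge0_pihalf; lra.
have hw : `|complex.Im h| * cos (alpha R n) <= complex.Re h * sin (alpha R n).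
  have := cos2Dsin2 (alpha R n).
  have : cabs (h - 1) <= sin (alpha R n) by apply: le_trans bs.
  case: {hb h0} h => a b; rewrite (_ : a +i* b - 1 = (a - 1) +i* b); last by simpc.
  have := cabs_sqr (a - 1) b; have := cabs_ge0 ((a - 1) +i* b).
  move: (cabs _) (sin _) (cos _) s0 c0 => x s c s0 c0 x0 xe xs cs /=.
  have {xe}xe : (a - 1) ^+ 2 + b ^+ 2 <= s ^+ 2.
    by rewrite -xe lerXn2r// nnegrE// ltW.
  (* The signs [e = 1] and [e = -1] stand for the two boundary rays. The left side of the bound
     below is the component of [(a - 1, b)] along a unit normal of the ray, at most the length of
     that vector. *)
  have key e : e ^+ 2 = 1 -> e * b * c <= a * s.
    move=> e1; suff : e * b * c - (a - 1) * s <= s by lra.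
    have : (e * b * c - (a - 1) * s) ^+ 2 <= s ^+ 2.
      apply: le_trans xe; rewrite -subr_ge0.
      rewrite [X in 0 <= X](_ : _ = (e * b * s + (a - 1) * c) ^+ 2
        + ((a - 1) ^+ 2 + e ^+ 2 * b ^+ 2) * (1 - (c ^+ 2 + s ^+ 2))
        + (1 - e ^+ 2) * b ^+ 2); last by ring.
      by rewrite e1 cs !subrr mulr0 mul0r !addr0 sqr_ge0.
    by move=> h2; rewrite leNgt; apply/negP => h3; nra.
  have := key 1; have := key (- 1).
  rewrite sqrrN expr1n mulN1r mul1r => /(_ erefl) k1 /(_ erefl) k2.
  by case: (ger0P b) => _.
have [t ht eh] := polar_of_sector ha h0 hw.
have r0 : 0 < cabs h by rewrite cabs_gt0.
have n1 : (1 : R) <= n%:R by rewrite ler1n.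
have dw := crossing_denom r0 ht eh.
have w0 : 0 < cabs (n%:R * h^-1 + h ^+ n).
  by apply: lt_le_trans dw; rewrite divr_gt0// ltr0n.
split => //; first by rewrite -cabs_gt0.
have wn0 : n%:R * h^-1 + h ^+ n != 0 by rewrite -cabs_gt0.
rewrite hstep_sub1// ler_pdivrMr//.
have x0 := cabs_ge0 (h - 1); set x := cabs (h - 1) in hb x0 *.
have e1 : h * (n%:R * h^-1 + h ^+ n - n.+1%:R) = (1 + (h - 1)) ^+ n.+1 - 1 - n.+1%:R * (h - 1).
  rewrite (_ : 1 + (h - 1) = h); last by ring.
  rewrite exprS -[n.+1%:R]natr1; move: (h ^+ n) n%:R => q m; field; exact: h0.
have : cabs h * cabs (n%:R * h^-1 + h ^+ n - n.+1%:R) <= 999 / 1000 * x * n%:R.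
  rewrite -cabsM e1; apply: le_trans (newton_remainder_le _ _) _; rewrite -/x.
  have xb : 0 <= x <= beta R n by rewrite x0.
  have := newton_remainder_chord n.+1 xb => h1.
  have b0 := beta_gt0 n; rewrite -(ler_pM2l b0); apply: le_trans h1 _.
  apply: le_trans (ler_wpM2l x0 (beta_remainder n0)) _.
  by rewrite le_eqVlt; apply/orP; left; apply/eqP; ring.
move=> h2; rewrite -(ler_pM2l r0); apply: le_trans h2 _.
have k0 : 0 <= 999 / 1000 * x by lra.
move: (999 / 1000 * x) k0 => k k0; rewrite mulrCA ler_wpM2l//.
by rewrite mulrC -ler_pdivrMr.
Qed.

End InvariantBall.

(** * Uniform convergence of the scalar iteration *)

Section ScalarNewton.
Variable R : realType.
Local Notation C := R[i].
Implicit Types (h z u : C) (r t x v y : R) (n : nat).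

Lemma geometric_le (q M e : R) : 0 <= q < 1 -> 0 <= M -> 0 < e ->
  exists K, forall k, (K <= k)%N -> q ^+ k * M <= e.
Proof.
move=> /andP[q0 q1] M0 e0; pose s := 1 - q.
have s0 : 0 < s by rewrite subr_gt0.
have qs : q * (1 + s) <= 1.
  by have := sqr_ge0 s; rewrite (_ : q = 1 - s); [nra | rewrite /s; ring].
exists (Num.bound (M / (e * s))) => k Kk.
have kb : M / (e * s) <= k%:R.
  apply: ltW; apply: lt_le_trans (archi_boundP _) _; last by rewrite ler_nat.
  by rewrite divr_ge0// mulr_ge0// ltW.
rewrite ler_pdivrMr in kb; last by rewrite mulr_gt0.
have ks : 0 <= k%:R * s by rewrite mulr_ge0// ltW.
have h1 : q ^+ k * (1 + k%:R * s) <= 1.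
  apply: (@le_trans _ _ (q ^+ k * (1 + s) ^+ k)).
    rewrite ler_wpM2l ?exprn_ge0//.
    have := @bernoulli_le R (1 + s) k; rewrite addrAC subrr add0r; apply.
    by rewrite addr_ge0// ltW.
  by rewrite -exprMn exprn_ile1// mulr_ge0// addr_ge0// ltW.
have qk : 0 <= q ^+ k by rewrite exprn_ge0.
have : q ^+ k * (1 + k%:R * s) * e <= e by rewrite ler_piMl// ltW.
apply: le_trans; rewrite -mulrA ler_wpM2l//.
by apply: le_trans kb _; rewrite mulrDl mul1r; nra.
Qed.

(* In the first case the iterates stay in the ball around [1]; in the second,
   [h^-1] has approached [1] geometrically during the first [k] steps. *)
Definition newton_region n (M : R) (k : nat) h : Prop :=
  cabs (h - 1) <= beta R n \/
  exists r t, [/\ 0 < r <= 1, `|t| <= alpha R n, h = r%:C * cis t &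
    cabs (h^-1 - 1) <= (n%:R / n.+1%:R) ^+ k * M].

Lemma newton_region_step n M k h : (0 < n)%N -> newton_region n M k h ->
  [/\ h != 0, n%:R * h^-1 + h ^+ n != 0 & newton_region n M k.+1 (hstep n h)].
Proof.
move=> n0 [hb | [r [t [r01 ht eh hM]]]].
  have [h0 w0 hc] := hstep_ball n0 hb; split => //; left.
  apply: le_trans hc _; have := cabs_ge0 (h - 1); lra.
have /andP[r0 r1] := r01.
have h0 : h != 0 by rewrite eh mulf_neq0 ?cis_neq0// (inj_eq (@complexI R)) gt_eqF.
have w0 : n%:R * h^-1 + h ^+ n != 0.
  rewrite -cabs_gt0; apply: lt_le_trans (crossing_denom r0 ht eh).
  by rewrite mulr_gt0 ?invr_gt0// ltr0n.
split => //.
have [hs1|hs1] := ltP 1 (cabs (hstep n h)).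
  by left; exact: (hstep_crossing n0 r01 ht eh).
right; have [s hs es] := hstep_sector n0 r01 ht eh.
exists (cabs (hstep n h)), s; split => //.
  rewrite hs1 andbT cabs_gt0 -[hstep n h]invrK hstepV// invr_eq0.
  by rewrite mulf_neq0 ?invr_eq0 ?pnatr_eq0.
apply: le_trans (hstep_contract r01 ht eh) _.
by rewrite exprS -[leRHS]mulrA ler_wpM2l// divr_ge0.
Qed.

Lemma newton_region_iter n M k h j : (0 < n)%N -> newton_region n M k h ->
  newton_region n M (k + j) (iter j (hstep n) h).
Proof.
move=> n0; elim: j => [|j IH] hk; first by rewrite addn0.
by rewrite addnS /=; have [] := newton_region_step n0 (IH hk).
Qed.

(** The first [K] steps bring every point into the ball: in the sector [|h - 1| = |h| * |1 / h - 1|]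
    with [|h| <= 1]. Another [J] steps contract the ball to radius [eta]. Neither number depends on
    [h]. *)
Lemma newton_region_cvg n (M eta : R) : (0 < n)%N -> 0 <= M -> 0 < eta ->
  exists m, forall h, newton_region n M 1 h ->
  forall k, (m <= k)%N -> cabs (iter k (hstep n) h - 1) <= eta.
Proof.
move=> n0 M0 eta0.
have q1 : 0 <= (n%:R / n.+1%:R : R) < 1.
  by rewrite divr_ge0//= ltr_pdivrMr ?ltr0n// mul1r ltr_nat.
have [K HK] := geometric_le q1 M0 (beta_gt0 R n).
have c01 : 0 <= (999 / 1000 : R) < 1 by apply/andP; split; lra.
have [J HJ] := geometric_le c01 (ltW (beta_gt0 R n)) eta0.
move: (999 / 1000 : R) c01 J HJ (@hstep_ball R n) => c c01 J HJ hball.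
exists (K + J)%N => h hr k Kk.
have hK : cabs (iter K (hstep n) h - 1) <= beta R n.
  have [//|[r [t [/andP[r0 r1] ht eh hM]]]] := newton_region_iter K n0 hr.
  set g := iter _ _ _ in eh hM *.
  have g0 : g != 0 by rewrite eh mulf_neq0 ?cis_neq0// (inj_eq (@complexI R)) gt_eqF.
  have -> : g - 1 = - (g * (g^-1 - 1)) by rewrite mulrBr mulfV// mulr1 opprB.
  rewrite cabsN cabsM {1}eh cabs_polar ?(ltW r0)//.
  apply: le_trans (_ : cabs (g^-1 - 1) <= _); first by rewrite ler_piMl ?cabs_ge0.
  by apply: le_trans hM (HK _ _); rewrite add1n.
have {}HK j : cabs (iter (K + j) (hstep n) h - 1) <= c ^+ j * beta R n.
  elim: j => [|j IH]; first by rewrite addn0 mul1r.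
  rewrite addnS iterS; set g := iter _ _ _ in IH *.
  have gb : cabs (g - 1) <= beta R n.
    apply: le_trans IH _; case/andP: c01 => c0 c1.
    by rewrite ler_piMl ?exprn_ile1 ?(ltW (beta_gt0 _ _))// ltW.
  have [_ _ hg] := hball g n0 gb; apply: le_trans hg _.
  by rewrite exprS -mulrA ler_wpM2l//; case/andP: c01.
have -> : k = (K + (k - K))%N by rewrite subnKC// (leq_trans (leq_addr J K)).
by apply: le_trans (HK _) (HJ _ _); rewrite leq_subRL ?(leq_trans (leq_addr J K)).
Qed.

Definition scalar_newton n z k : C :=
  iter k (fun x : C => n.+1%:R^-1 * (x * (n%:R + x ^- n.+1 * z))) 1.

Lemma scalar_newton_step n z zeta (x : C) : zeta ^+ n.+1 = z -> zeta != 0 -> x != 0 ->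
  n%:R * (zeta / x)^-1 + (zeta / x) ^+ n != 0 ->
  let x' := n.+1%:R^-1 * (x * (n%:R + x ^- n.+1 * z)) in
  x' != 0 /\ zeta / x' = hstep n (zeta / x).
Proof.
move=> ez z0 x0 w0 x'.
have p0 : (n.+1%:R : C) != 0 by rewrite pnatr_eq0.
have h0 : zeta / x != 0 by rewrite mulf_neq0 ?invr_eq0.
have e : x' / zeta = (n%:R * (zeta / x)^-1 + (zeta / x) ^+ n) / n.+1%:R.
  rewrite /x' -ez expr_div_n exprS [zeta ^+ n.+1]exprS.
  have : x ^+ n != 0 by rewrite expf_neq0.
  move: (x ^+ n) (zeta ^+ n) n%:R n.+1%:R p0 => a b c d d0 a0.
  by field; apply/and4P.
split; last by rewrite -[LHS]invrK invf_div e -hstepV// invrK.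
have : x' / zeta != 0 by rewrite e mulf_neq0 ?invr_eq0.
by rewrite mulf_eq0 negb_or => /andP[].
Qed.

(** For [Re z > 0] this is the principal root: its argument is at most [alpha n], half of the angle
    [pi / p] that defines principal roots. *)
Definition half_sector_root n z zeta : Prop :=
  exists r t, [/\ 0 < r, `|t| <= alpha R n, zeta = r%:C * cis t & zeta ^+ n.+1 = z].

Lemma half_sector_root_exists n z : 0 < complex.Re z -> exists zeta, half_sector_root n z zeta.
Proof.
move=> z0; have [b hb ez] := polar_of_Re_gt0 z0.
have p0 : (0 : R) < n.+1%:R by rewrite ltr0n.
have cz : 0 < cabs z by apply: lt_le_trans (Re_le_cabs z).
pose r := expR (ln (cabs z) / n.+1%:R).
exists (r%:C * cis (b / n.+1%:R)), r, (b / n.+1%:R); split => //.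
- exact: expR_gt0.
- by rewrite normrM normfV normr_nat ler_pdivrMr// mulrC alphaM ltW.
- have pu : (n.+1%:R : R) != 0 by rewrite gt_eqF.
  rewrite polarX /r -expRM_natl.
  rewrite (_ : n.+1%:R * (ln _ / _) = ln (cabs z)); last by rewrite mulrC divfK.
  by rewrite (_ : n.+1%:R * (b / _) = b) ?lnK ?posrE// mulrC divfK.
Qed.

Lemma domainD_Re_gt0 (eps : R) z : domainD eps z -> 0 < complex.Re z.
Proof. by case=> -[]. Qed.

(** If [|z| <= 1], the root starts in the half disc, and [|zeta| >= |z| >= delta] bounds
    [|1 / zeta - 1|] by [1 + 1 / delta]. If [|z| > 1], the first part of [D] lands in the ball after
    one step, and the second part has its root in the ball already. One step therefore suits all
    cases. *)
Lemma newton_region_start n (delta : R) z zeta : (0 < n)%N -> 0 < delta <= 1 ->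
  domainD (1 / 2000) z -> delta <= cabs z -> half_sector_root n z zeta ->
  [/\ zeta != 0, n%:R * zeta^-1 + zeta ^+ n != 0 &
    newton_region n (1 + delta^-1) 1 (hstep n zeta)].
Proof.
move=> n0 /andP[d0 d1] hz dz [r [t [r0 ht ezeta ez]]].
have h0 : zeta != 0 by rewrite ezeta mulf_neq0 ?cis_neq0// (inj_eq (@complexI R)) gt_eqF.
have rz : cabs z = r ^+ n.+1 by rewrite -ez cabsX ezeta cabs_polar// ltW.
have [r1|r1] := leP r 1.
  have hr : newton_region n (1 + delta^-1) 0 zeta.
    right; exists r, t; split => //; first by rewrite r0.
    rewrite expr0 mul1r (le_trans (cabsB _ _))// cabs1 addrC lerD2l.
    rewrite cabsV ezeta cabs_polar ?(ltW r0)// lef_pV2 ?posrE//.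
    by apply: le_trans dz _; rewrite rz exprS ler_piMr ?exprn_ile1 ?(ltW r0).
  exact: newton_region_step hr.
have [[_ hz'] | [z0 hz']] := hz.
  have hrp : r ^+ n.+1 <= 1 + 1 / 2000 by rewrite -rz -lecR -cabsE.
  have [w0 hb] := hstep_outside n0 (ltW r1) hrp ht ezeta.
  by split => //; left.
have hb : cabs (zeta - 1) <= beta R n.
  apply: (disc_in_ball n0 (ltW r1) _ ht ezeta).
  move: hz'; rewrite cabsE -(rmorph1 (real_complex R)) lecR => hz'.
  have : cabs (1 - z) ^+ 2 <= 1 by rewrite cabs_distC exprn_ile1 ?cabs_ge0.
  rewrite -ez ezeta polarX cabs_1B_polar.
  have : 0 < r ^+ n.+1 by rewrite exprn_gt0.
  by move: (r ^+ n.+1) (cos _) => q c q0 h; nra.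
have hr : newton_region n (1 + delta^-1) 0 zeta by left.
exact: newton_region_step hr.
Qed.

Theorem scalar_newton_cvg n (delta eta : R) : (0 < n)%N -> 0 < delta <= 1 -> 0 < eta ->
  exists m, forall z zeta, domainD (1 / 2000) z -> delta <= cabs z ->
    half_sector_root n z zeta ->
    (forall k, scalar_newton n z k != 0) /\
    (forall k, (m <= k)%N -> cabs (zeta / scalar_newton n z k - 1) <= eta).
Proof.
move=> n0 hd eta0; have /andP[d0 d1] := hd.
have M0 : 0 <= 1 + delta^-1 by rewrite addr_ge0// invr_ge0 ltW.
have [m Hm] := newton_region_cvg n0 M0 eta0.
exists m.+1 => z zeta hz dz hzeta.
have [z0 w0 hr] := newton_region_start n0 hd hz dz hzeta.
have hiter k : iter k (hstep n) zeta != 0 /\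
    n%:R * (iter k (hstep n) zeta)^-1 + iter k (hstep n) zeta ^+ n != 0.
  case: k => [//|k]; rewrite iterSr.
  by have [] := newton_region_step n0 (newton_region_iter k n0 hr).
have hx k : scalar_newton n z k != 0 /\ zeta / scalar_newton n z k = iter k (hstep n) zeta.
  elim: k => [|k [IH1 IH2]]; first by rewrite /= oner_eq0 divr1.
  have [_ wk] := hiter k; rewrite -IH2 in wk.
  have [r [t [_ _ _ ez]]] := hzeta.
  by have [? ->] := scalar_newton_step ez z0 IH1 wk; rewrite IH2.
split => [k|k]; first by have [] := hx k.
case: k => [//|k]; rewrite ltnS => mk.
by have [_ ->] := hx k.+1; rewrite iterSr; exact: Hm.
Qed.

End ScalarNewton.

(** * Spectral theory in Banach algebras *)

(** Completeness is asked in the form in which it is applied, for sequences with geometrically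
    bounded steps: partial sums of Neumann series and Newton iterates. *)
Record banach_norm (R : realType) (A : unitAlgType R[i]) (nrm : A -> R) : Prop := {
  bn_ge0 : forall x, 0 <= nrm x;
  bn_eq0 : forall x, nrm x = 0 -> x = 0;
  bnD : forall x y, nrm (x + y) <= nrm x + nrm y;
  bnM : forall x y, nrm (x * y) <= nrm x * nrm y;
  bnZ : forall c x, nrm (c *: x) = cabs c * nrm x;
  bn1 : nrm 1 <= 1;
  bn_complete : forall (u : nat -> A) (c q : R), 0 <= q < 1 ->
    (forall k, nrm (u k.+1 - u k) <= c * q ^+ k) ->
    exists l, forall e, 0 < e -> exists K, forall k, (K <= k)%N -> nrm (u k - l) <= e }.

Section BanachAlgebra.
Variables (R : realType) (A : unitAlgType R[i]) (nrm : A -> R).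
Variable hN : banach_norm nrm.
Local Notation C := R[i].
Implicit Types (x y T l m : A) (u v : nat -> A) (z : C).

Let nrm_ge0 := bn_ge0 hN.
Let nrmD := bnD hN.
Let nrmM := bnM hN.
Let nrmZ := bnZ hN.

Lemma bn0 : nrm 0 = 0.
Proof. by rewrite -(scale0r 0) nrmZ cabs0 mul0r. Qed.

Lemma bnN x : nrm (- x) = nrm x.
Proof. by rewrite -scaleN1r nrmZ cabsN cabs1 mul1r. Qed.

Lemma bnB x y : nrm (x - y) <= nrm x + nrm y.
Proof. by rewrite (le_trans (nrmD _ _))// bnN. Qed.

Lemma bn_distC x y : nrm (x - y) = nrm (y - x).
Proof. by rewrite -bnN opprB. Qed.

Lemma bnX x k : nrm (x ^+ k) <= nrm x ^+ k.
Proof.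
elim: k => [|k IH]; first exact: bn1.
by rewrite !exprS (le_trans (nrmM _ _))// ler_wpM2l.
Qed.

Lemma bn1_eq : nrm 1 = 1.
Proof.
apply/eqP; rewrite eq_le bn1//=.
have n1 : 0 < nrm 1.
  by rewrite lt_def nrm_ge0 andbT; apply/eqP => /(bn_eq0 hN)/eqP; rewrite oner_eq0.
by have := nrmM 1 1; rewrite mulr1 ler_pMr.
Qed.

Lemma bn_le_eq0 x : (forall e, 0 < e -> nrm x <= e) -> x = 0.
Proof.
move=> h; apply: (bn_eq0 hN); apply/eqP; rewrite eq_le nrm_ge0 andbT.
by apply/ler_addgt0Pr => e e0; rewrite add0r h.
Qed.

Definition bconv (u : nat -> A) (l : A) :=
  forall e, 0 < e -> exists K, forall k, (K <= k)%N -> nrm (u k - l) <= e.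

Lemma bconv_cst x : bconv (fun=> x) x.
Proof. by move=> e e0; exists 0%N => k _; rewrite subrr bn0 ltW. Qed.

Lemma bconv_uniq u l l' : bconv u l -> bconv u l' -> l = l'.
Proof.
move=> h h'; apply/eqP; rewrite -subr_eq0; apply/eqP/bn_le_eq0 => e e0.
have e2 : 0 < e / 2 by rewrite divr_gt0.
have [K HK] := h _ e2; have [K' HK'] := h' _ e2.
have := HK _ (leq_maxl K K'); have := HK' _ (leq_maxr K K'); set w := u _ => h1 h2.
rewrite (_ : l - l' = (w - l') - (w - l)); last by rewrite opprB [RHS]addrC addrA subrK.
by apply: le_trans (bnB _ _) _; lra.
Qed.

Lemma bconvD u v l m : bconv u l -> bconv v m -> bconv (fun k => u k + v k) (l + m).
Proof.
move=> h h' e e0; have e2 : 0 < e / 2 by rewrite divr_gt0.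
have [K HK] := h _ e2; have [K' HK'] := h' _ e2.
exists (maxn K K') => k; rewrite geq_max => /andP[/HK h1 /HK' h2].
by rewrite opprD addrACA; apply: le_trans (nrmD _ _) _; lra.
Qed.

Lemma bconvM u v l m : bconv u l -> bconv v m -> bconv (fun k => u k * v k) (l * m).
Proof.
move=> h h' e e0; pose B := nrm l + nrm m + 1.
have B0 : 0 < B by rewrite ltr_wpDl// addr_ge0.
have e2 : 0 < e / (2 * B) by rewrite divr_gt0// mulr_gt0.
have [K HK] := h _ e2; have [K1 HK1] := h' _ ltr01; have [K' HK'] := h' _ e2.
exists (maxn K (maxn K1 K')) => k; rewrite !geq_max => /and3P[/HK h1 /HK1 h2 /HK' h3].
rewrite (_ : _ - _ = (u k - l) * v k + l * (v k - m)); last first.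
  by rewrite mulrBl mulrBr addrA subrK.
have h4 : nrm (v k) <= B.
  have := nrmD (v k - m) m; rewrite subrK /B; have := nrm_ge0 l; lra.
have h5 : nrm l <= B by rewrite /B; have := nrm_ge0 m; lra.
have eB : e = e / (2 * B) * B + B * (e / (2 * B)) by field; rewrite gt_eqF.
rewrite [leRHS]eB; apply: le_trans (nrmD _ _) _.
apply: lerD; apply: le_trans (nrmM _ _) _; exact: ler_pM.
Qed.

Lemma bconvN u l : bconv u l -> bconv (fun k => - u k) (- l).
Proof.
move=> h e e0; have [K HK] := h _ e0; exists K => k /HK.
by rewrite -opprD bnN.
Qed.

Lemma bconvB u v l m : bconv u l -> bconv v m -> bconv (fun k => u k - v k) (l - m).
Proof. by move=> h /bconvN; exact: bconvD. Qed.

Lemma bconvX u l j : bconv u l -> bconv (fun k => u k ^+ j) (l ^+ j).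
Proof.
move=> h; elim: j => [|j IH]; first exact: bconv_cst.
under eq_fun do rewrite exprS; rewrite exprS; exact: bconvM.
Qed.

Lemma bconv_sum (u : nat -> nat -> A) (l : nat -> A) j : (forall i, bconv (u i) (l i)) ->
  bconv (fun k => \sum_(i < j) u i k) (\sum_(i < j) l i).
Proof.
move=> h; elim: j => [|j IH].
  under eq_fun do rewrite big_ord0; rewrite big_ord0; exact: bconv_cst.
under eq_fun do rewrite big_ord_recr/=; rewrite big_ord_recr/=.
exact: bconvD IH (h _).
Qed.

Lemma bconv_comm u l x : bconv u l -> (forall k, GRing.comm x (u k)) -> GRing.comm x l.
Proof.
move=> h c; apply: (bconv_uniq (bconvM (bconv_cst x) h)).
under eq_fun do rewrite c; exact: bconvM h (bconv_cst x).
Qed.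

Lemma bconv_geometric (u : nat -> A) (c q : R) l : 0 <= q < 1 -> 0 <= c ->
  (forall k, nrm (u k - l) <= q ^+ k * c) -> bconv u l.
Proof.
move=> q01 c0 h e e0; have [K HK] := geometric_le q01 c0 e0.
by exists K => k /HK; apply: le_trans.
Qed.

Lemma neumann x : nrm x < 1 -> 1 - x \is a GRing.unit.
Proof.
move=> x1; have q01 : 0 <= nrm x < 1 by rewrite nrm_ge0.
pose u k := \sum_(i < k) x ^+ i.
have [k|l hl] := @bn_complete _ _ _ hN u 1 (nrm x) q01.
  by rewrite /u big_ord_recr/= addrAC subrr add0r mul1r bnX.
have e1 k : (1 - x) * u k = 1 - x ^+ k.
  by rewrite -opprB mulNr -subrX1 opprB.
have e2 k : u k * (1 - x) = 1 - x ^+ k.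
  rewrite -e1; apply/commr_sym/commr_sum => i _; apply/commr_sym/commrB; first exact: commr1.
  exact/commr_sym/commrX.
have h1 : bconv (fun k => 1 - x ^+ k) 1.
  apply: (bconv_geometric q01 ler01) => k.
  by rewrite addrAC subrr add0r bnN mulr1 bnX.
apply/unitrP; exists l; split.
  apply: (bconv_uniq (bconvM hl (bconv_cst (1 - x)))).
  by under eq_fun do rewrite e2.
apply: (bconv_uniq (bconvM (bconv_cst (1 - x)) hl)).
by under eq_fun do rewrite e1.
Qed.

Lemma unit_addr (u x : A) : u \is a GRing.unit -> nrm (u^-1 * x) < 1 -> u + x \is a GRing.unit.
Proof.
move=> uu h; have -> : u + x = u * (1 - (- (u^-1 * x))).
  by rewrite opprK mulrDr mulr1 mulrA divrr// mul1r.
by rewrite unitrMl// neumann// bnN.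
Qed.

Lemma inv_addr_le (u x : A) : u \is a GRing.unit -> u + x \is a GRing.unit ->
  nrm (u^-1 * x) <= 1 / 2 -> nrm (u + x)^-1 <= 2 * nrm u^-1.
Proof.
move=> uu uv h; have e : (u + x)^-1 = u^-1 - u^-1 * x * (u + x)^-1.
  have h1 : u^-1 * x * (u + x)^-1 * (u + x) = u^-1 * x by rewrite -mulrA mulVr// mulr1.
  by apply: (mulIr uv); rewrite mulVr// mulrBl h1 mulrDr mulVr// addrK.
have := bnB u^-1 (u^-1 * x * (u + x)^-1); rewrite -e.
have := nrmM (u^-1 * x) (u + x)^-1.
have := ler_wpM2r (nrm_ge0 (u + x)^-1) h; lra.
Qed.

Lemma unit_of_power x k : nrm (x ^+ k) < 1 -> 1 - x \is a GRing.unit.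
Proof.
move=> /neumann; rewrite -opprB unitrN subrX1 unitrM_comm; last first.
  by apply: commr_sum => i _; apply: commrX; apply/commr_sym/commrB; [exact: commr_refl|exact: commr1].
by move=> /andP[+ _]; rewrite -unitrN opprB.
Qed.

Lemma large_scalar_unit x z : nrm x < cabs z -> x - z%:A \is a GRing.unit.
Proof.
move=> h; have z0 : z != 0 by rewrite -cabs_gt0 (le_lt_trans _ h).
have -> : x - z%:A = (- z) *: (1 - z^-1 *: x).
  by rewrite scalerBr scalerA mulNr divff// scaleN1r opprK scaleNr addrC.
rewrite scaler_unit ?unitfE ?oppr_eq0// neumann// nrmZ cabsV.
by rewrite mulrC ltr_pdivrMr ?cabs_gt0// mul1r.
Qed.

End BanachAlgebra.

(** * The spectral radius by repeated squaring *)

Section SpectralRadius.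
Variables (R : realType) (A : unitAlgType R[i]) (nrm : A -> R).
Variable hN : banach_norm nrm.
Local Notation C := R[i].
Implicit Types (x y T : A) (z : C).

Let nrm_ge0 := bn_ge0 hN.
Let nrmM := bnM hN.
Let nrmZ := bnZ hN.

Lemma cabs_le_ReIm (a b : R) : cabs (a +i* b) <= `|a| + `|b|.
Proof.
rewrite (_ : a +i* b = a%:C + 'i%C * b%:C); last by simpc.
rewrite (le_trans (cabsD _ _))// cabsM !cabs_real.
rewrite (_ : cabs 'i%C = 1) ?mul1r//.
by apply/eqP; rewrite -sqrp_eq1 ?cabs_ge0// cabs_sqr expr0n add0r expr1n.
Qed.

Lemma ReIm_le_cabs z : `|complex.Re z| <= cabs z /\ `|complex.Im z| <= cabs z.
Proof.
case: z => a b /=; have := cabs_sqr a b; have := cabs_ge0 (a +i* b).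
move: (cabs _) => c c0 e; split; rewrite ler_norml; apply/andP;
  split; rewrite leNgt; apply/negP => h; have := sqr_ge0 a; have := sqr_ge0 b; nra.
Qed.

(** The compact set is the square [[-1, 1] ^ 2], which contains the unit disc and whose points have
    modulus at most [2]; this is the origin of the radius in the hypothesis. Local bounds on the
    inverse come from [inv_addr_le]. *)
Lemma resolvent_bounded T : (forall z, cabs z <= 2 -> 1 - z *: T \is a GRing.unit) ->
  exists2 M, 0 < M & forall z, cabs z <= 1 -> nrm (1 - z *: T)^-1 <= M.
Proof.
move=> hT.
pose K : set (R * R) := `[-1, 1]%classic `*` `[-1, 1]%classic.
have cK : compact K by apply: compact_setX; exact: segment_compact.
pose P (M : R) (w : R * R) := nrm (1 - (w.1 +i* w.2) *: T)^-1 <= M.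
have /compact_near_coveringP/(_ R (pinfty_nbhs R) P _) := cK.
case=> [[a b] [/=]|M [_ HM]]; last first.
  pose M' := Num.max 1 (M + 1).
  have M'1 : 1 <= M' by rewrite /M' le_max lexx.
  have MM' : M < M' by rewrite /M' lt_max ltrDl ltr01 orbT.
  exists M'; first by lra.
  move=> z z1; have [z2 z3] := ReIm_le_cabs z.
  have := HM _ MM' (complex.Re z, complex.Im z).
  rewrite /P /= (_ : _ +i* _ = z); last by case: (z).
  by apply; split; rewrite /= in_itv/= -ler_norml (le_trans _ z1).
move=> [ha hb].
have z2 : cabs (a +i* b) <= 2.
  rewrite (le_trans (cabs_le_ReIm _ _))//.
  by move: ha hb; rewrite !in_itv/= -!ler_norml; lra.
set u := 1 - (a +i* b) *: T; have uu : u \is a GRing.unit := hT _ z2.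
pose B := nrm u^-1 * nrm T; have B0 : 0 <= B by rewrite mulr_ge0.
pose d := (4 * (B + 1))^-1; have d0 : 0 < d by rewrite invr_gt0; lra.
exists (ball (a, b) d, [set M | 2 * nrm u^-1 <= M]).
  split => /=; first exact: nbhsx_ballx.
  exists (2 * nrm u^-1); split; first exact: num_real.
  by move=> M /ltW.
move=> [[a' b'] M] /= [[h1 h2] hM]; rewrite /P /=; apply: le_trans hM.
rewrite /ball /= in h1 h2.
pose x := - (((a' - a) +i* (b' - b)) *: T).
have -> : 1 - (a' +i* b') *: T = u + x.
  rewrite /u /x -addrA -opprD -scalerDl; congr (_ - _ *: _).
  by simpc; rewrite addrCA subrr addr0 addrCA subrr addr0.
have hx : nrm (u^-1 * x) <= 1 / 2.
  rewrite /x mulrN (bnN hN) -scalerAr nrmZ.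
  have h3 : cabs ((a' - a) +i* (b' - b)) <= 2 * d.
    rewrite (le_trans (cabs_le_ReIm _ _))// -[`|a' - a|]distrC -[`|b' - b|]distrC.
    lra.
  apply: le_trans (ler_wpM2l (cabs_ge0 _) (nrmM _ _)) _; rewrite -/B.
  apply: le_trans (ler_wpM2r B0 h3) _.
  have : d * (4 * (B + 1)) = 1 by rewrite /d mulVf// gt_eqF//; lra.
  lra.
have uv : u + x \is a GRing.unit by apply: (unit_addr hN) => //; lra.
exact: (inv_addr_le hN).
Qed.

Definition resolvent_close (s t e : R) T := forall z, cabs z <= 1 ->
  [/\ 1 - (s%:C * z) *: T \is a GRing.unit, 1 - (t%:C * z) *: T \is a GRing.unit &
  nrm ((1 - (s%:C * z) *: T)^-1 - (1 - (t%:C * z) *: T)^-1) <= e].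

Lemma inv_1B_sqr x : 1 - x \is a GRing.unit -> 1 + x \is a GRing.unit ->
  1 - x ^+ 2 \is a GRing.unit /\
  (1 - x ^+ 2)^-1 = 2^-1 *: ((1 - x)^-1 + (1 + x)^-1).
Proof.
move=> u1 u2.
have e : 1 - x ^+ 2 = (1 - x) * (1 + x).
  by rewrite mulrBl mul1r mulrDr mulr1 -expr2 opprD addrA addrK.
have e' : 1 - x ^+ 2 = (1 + x) * (1 - x).
  by rewrite mulrDl mul1r mulrBr mulr1 -expr2 addrA subrK.
have u : 1 - x ^+ 2 \is a GRing.unit by rewrite e unitrMl.
split => //; apply: (mulIr u); rewrite mulVr// -scalerAl mulrDl {1}e mulKr// e' mulKr//.
rewrite addrACA subrr addr0 (_ : 1 + 1 = (2 : C) *: (1 : A)); last by rewrite scaler_nat.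
by rewrite scalerA mulVf ?scale1r// pnatr_eq0.
Qed.

(** With [w] a square root of [z], the inverse of [1 - x ^+ 2] is the mean of those of [1 - x] and
    [1 + x], that is, of the resolvents at [w] and [- w]. The bound [e] thus survives any number of
    squarings. *)
Lemma resolvent_close_sqr s t e T : 0 <= s -> 0 <= t -> resolvent_close s t e T ->
  resolvent_close (s ^+ 2) (t ^+ 2) e (T ^+ 2).
Proof.
move=> s0 t0 h z z1.
pose w := sqrtc z; have ew : w ^+ 2 = z := sqr_sqrtc z.
have w1 : cabs w <= 1.
  by rewrite -(@expr_le1 _ 2)// ?cabs_ge0// -cabsX ew.
have e1 (r : R) : ((r ^+ 2)%:C * z) *: T ^+ 2 = ((r%:C * w) *: T) ^+ 2.
  by rewrite exprZn exprMn ew rmorphXn.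
have e2 (r : R) : 1 + (r%:C * w) *: T = 1 - (r%:C * - w) *: T.
  by rewrite mulrN scaleNr opprK.
have [u1 u2 h1] := h w w1.
have [u3 u4 h2] := h (- w) ltac:(by rewrite cabsN).
rewrite -!e2 in u3 u4 h2; rewrite !e1.
have [u5 ->] := inv_1B_sqr u1 u3; have [u6 ->] := inv_1B_sqr u2 u4.
split => //; rewrite -scalerBr nrmZ opprD addrACA.
have -> : cabs (2^-1 : C) = 2^-1 by rewrite cabsV cabs_nat.
have := bnD hN ((1 - (s%:C * w) *: T)^-1 - (1 - (t%:C * w) *: T)^-1)
 ((1 + (s%:C * w) *: T)^-1 - (1 + (t%:C * w) *: T)^-1).
lra.
Qed.

Lemma resolvent_close_exp s t e T k : 0 <= s -> 0 <= t -> resolvent_close s t e T ->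
  resolvent_close (s ^+ (2 ^ k)) (t ^+ (2 ^ k)) e (T ^+ (2 ^ k)).
Proof.
move=> s0 t0 h; elim: k => [//|k IH].
by rewrite expnS mulnC !exprM; apply: resolvent_close_sqr; rewrite ?exprn_ge0.
Qed.

(** For [a] and [b] the same power of [s T] and [t T]: if [a] is small, then the inverse of [1 - a],
    and hence that of [1 - b], is close to [1], which gives [nrm b <= 1 / 3]. Two more squarings
    restore the bound, as [1 / 81 <= 1 / 16]. *)
Lemma power_small_step s t T : 0 <= s -> 0 <= t -> resolvent_close s t (1 / 8) T ->
  (exists k, nrm ((s%:C *: T) ^+ (2 ^ k)) <= 1 / 16) ->
  exists k, nrm ((t%:C *: T) ^+ (2 ^ k)) <= 1 / 16.
Proof.
move=> s0 t0 h [k]; have c1 : cabs (1 : C) <= 1 by rewrite cabs1.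
have [] := resolvent_close_exp k s0 t0 h c1.
rewrite !mulr1 !rmorphXn /= -!exprZn; set a := _ ^+ _; set b := (t%:C *: T) ^+ _.
move=> ua ub hab ha; exists k.+2.
have e1 : 1 - (1 - b)^-1 = - (b * (1 - b)^-1).
  rewrite -[X in X - _](mulrV ub) -{2}[(1 - b)^-1]mul1r -mulrBl.
  by rewrite addrAC subrr add0r mulNr.
have ea : (1 - a)^-1 - 1 = a * (1 - a)^-1.
  rewrite -[X in _ - X](mulrV ua) -{1}[(1 - a)^-1]mul1r -mulrBl.
  by rewrite opprB addrCA subrr addr0.
have eb : (1 - b)^-1 - 1 = b * (1 - b)^-1 by rewrite -opprB e1 opprK.
have n1 := bn1_eq hN.
have ia : nrm (1 - a)^-1 <= 16 / 15.
  have := bnD hN ((1 - a)^-1 - 1) 1; rewrite subrK ea n1.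
  have := nrmM a (1 - a)^-1; have := ler_wpM2r (nrm_ge0 (1 - a)^-1) ha; lra.
have da : nrm ((1 - a)^-1 - 1) <= 1 / 15.
  rewrite ea; apply: le_trans (nrmM _ _) _.
  have := ler_wpM2r (nrm_ge0 (1 - a)^-1) ha; lra.
have db : nrm ((1 - b)^-1 - 1) <= 1 / 4.
  have -> : (1 - b)^-1 - 1 = (1 - a)^-1 - 1 - ((1 - a)^-1 - (1 - b)^-1).
    by rewrite opprB [RHS]addrC addrA subrK.
  have := bnB hN ((1 - a)^-1 - 1) ((1 - a)^-1 - (1 - b)^-1); lra.
have nb : nrm b <= 1 / 3.
  have e : b = ((1 - b)^-1 - 1) - ((1 - b)^-1 - 1) * b.
    by rewrite -[X in X - _]mulr1 -mulrBr eb -mulrA mulVr// mulr1.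
  have := bnB hN ((1 - b)^-1 - 1) (((1 - b)^-1 - 1) * b); rewrite -e.
  have := nrmM ((1 - b)^-1 - 1) b; have := ler_wpM2r (nrm_ge0 b) db; lra.
rewrite -[k.+2]addn2 expnD exprM -/b; apply: le_trans (bnX hN _ _) _.
have : nrm b ^+ (2 ^ 2) <= (1 / 3) ^+ (2 ^ 2).
  by rewrite lerXn2r// ?nnegrE ?nrm_ge0//; lra.
by move/le_trans; apply; rewrite (_ : (2 ^ 2)%N = 4)//; lra.
Qed.

(** No holomorphy of the resolvent enters. The parameter of [t T] moves from [0], where powers are
    trivially small, to [1] in [m] equal steps; by the resolvent identity each step changes the
    inverses by at most [M * M * nrm T / m <= 1 / 8], uniformly on the unit disc. *)
Theorem spectral_radius_lt1 T : (forall z, cabs z <= 2 -> 1 - z *: T \is a GRing.unit) ->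
  exists k, nrm (T ^+ (2 ^ k)) < 1.
Proof.
move=> hT; have [M M0 HM] := resolvent_bounded hT.
have B0 : 0 <= M * M * nrm T by rewrite !mulr_ge0// ltW.
pose m := (Num.bound (8 * (M * M * nrm T))).+1.
have m0 : (0 : R) < m%:R by rewrite ltr0n.
have mB : 8 * (M * M * nrm T) <= m%:R.
  apply: ltW; apply: lt_trans (archi_boundP _) _; first lra.
  by rewrite ltr_nat ltnSn.
have close (s t : R) : 0 <= s <= 1 -> 0 <= t <= 1 -> `|s - t| <= m%:R^-1 ->
    resolvent_close s t (1 / 8) T.
  move=> /andP[s0 s1] /andP[t0 t1] st z z1.
  have cs (r : R) : 0 <= r -> r <= 1 -> cabs (r%:C * z) <= 1.
    by move=> r0 r1; rewrite cabsM cabs_real ger0_norm// mulr_ile1 ?cabs_ge0.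
  have cs2 (r : R) : 0 <= r -> r <= 1 -> 1 - (r%:C * z) *: T \is a GRing.unit.
    by move=> r0 r1; apply: hT; have := cs r r0 r1; lra.
  have us := cs2 s s0 s1; have ut := cs2 t t0 t1.
  have hs := HM _ (cs s s0 s1); have ht := HM _ (cs t t0 t1).
  split => //.
  set a := 1 - (s%:C * z) *: T in us hs *; set b := 1 - (t%:C * z) *: T in ut ht *.
  have -> : a^-1 - b^-1 = a^-1 * (b - a) * b^-1.
    by rewrite mulrBr mulVr// mulrBl mul1r -mulrA mulrV// mulr1.
  have -> : b - a = ((s - t)%:C * z) *: T.
    by rewrite /a /b opprB [LHS]addrC addrA subrK -scalerBl -mulrBl -rmorphB.
  apply: le_trans (nrmM _ _) _.
  have h1 : nrm (a^-1 * (((s - t)%:C * z) *: T)) <= M * (m%:R^-1 * nrm T).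
    apply: le_trans (nrmM _ _) _; apply: ler_pM => //.
    rewrite nrmZ ler_wpM2r// cabsM cabs_real -[leRHS]mulr1.
    exact: ler_pM (cabs_ge0 _) st z1.
  apply: le_trans (ler_pM (nrm_ge0 _) (nrm_ge0 _) h1 ht) _.
  have -> : M * (m%:R^-1 * nrm T) * M = (8 * (M * M * nrm T)) / m%:R / 8.
    by field; rewrite gt_eqF.
  rewrite ler_pM2r ?invr_gt0// ler_pdivrMr// mul1r //.
have step j : (j <= m)%N -> exists k, nrm (((j%:R / m%:R)%:C *: T) ^+ (2 ^ k)) <= 1 / 16.
  elim: j => [_|j IH jm].
    exists 0%N; rewrite mul0r scale0r expr1 (bn0 hN); lra.
  have jm' : (j <= m)%N := ltnW jm.
  apply: (power_small_step _ _ _ (IH jm')); rewrite ?divr_ge0//.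
  apply: close.
  - by rewrite divr_ge0//= ler_pdivrMr// mul1r ler_nat.
  - by rewrite divr_ge0//= ler_pdivrMr// mul1r ler_nat.
  rewrite -mulrBl -natr1 opprD addrA subrr sub0r mulN1r normrN.
  by rewrite ger0_norm// invr_ge0 ltW.
have [k hk] := step m (leqnn m); exists k.
by move: hk; rewrite divff ?gt_eqF// scale1r; lra.
Qed.

(** The factor [2] reflects the radius [2] in [spectral_radius_lt1], applied to [T / (2 * d)]. An
    exponent is divided by the [N] for which the [N]-th power has norm below [1], and the finitely
    many remainders go into [c]. *)
Lemma power_bounded T (d : R) : 0 < d -> (forall z, d <= cabs z -> T - z%:A \is a GRing.unit) ->
  exists2 c : R, 0 < c & forall j, nrm (T ^+ j) <= c * (2 * d) ^+ j.
Proof.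
move=> d0 hT; pose T' := (2 * d)^-1%:C *: T.
have d20 : 0 < 2 * d by rewrite mulr_gt0.
have [|k hk] := @spectral_radius_lt1 T'.
  move=> z z2; have [->|z0] := eqVneq z 0; first by rewrite scale0r subr0 unitr1.
  pose w := z * (2 * d)^-1%:C.
  have w0 : w != 0 by rewrite mulf_neq0// (inj_eq (@complexI R)) invr_eq0 gt_eqF.
  have -> : 1 - z *: T' = (- w) *: (T - w^-1%:A).
    by rewrite /T' scalerA -/w scalerBr scalerA mulNr divff// scaleN1r scaleNr opprK addrC.
  rewrite scaler_unit ?unitfE ?oppr_eq0//; apply: hT.
  rewrite cabsV /w cabsM cabs_real ger0_norm ?invr_ge0 ?(ltW d20)//.
  rewrite invfM invrK mulrC ler_pdivlMr ?cabs_gt0// mulrC ler_wpM2r// ltW//.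
set N := (2 ^ k)%N in hk.
have N0 : (0 < N)%N by rewrite expn_gt0.
pose c := 1 + \sum_(i < N) nrm (T' ^+ i).
have c0 : 0 < c by rewrite ltr_pwDl// sumr_ge0.
have h1 i : (i < N)%N -> nrm (T' ^+ i) <= c.
  move=> iN; rewrite /c (bigD1 (Ordinal iN))//= addrCA lerDl addr_ge0// sumr_ge0//.
have h2 j : nrm (T' ^+ j) <= c.
  rewrite (divn_eq j N) exprD mulnC exprM; apply: le_trans (nrmM _ _) _.
  rewrite -[leRHS]mul1r; apply: ler_pM => //; last by apply: h1; rewrite ltn_mod.
  by apply: le_trans (bnX hN _ _) _; rewrite exprn_ile1// ltW.
exists c => // j.
have -> : T ^+ j = (2 * d)%:C ^+ j *: T' ^+ j.
  by rewrite -exprZn /T' scalerA -rmorphM mulfV ?gt_eqF// scale1r.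
rewrite nrmZ cabsX cabs_real ger0_norm ?(ltW d20)// mulrC.
by rewrite ler_wpM2r// exprn_ge0// ltW.
Qed.

(** The admissible size of [y] depends on the spectrum of [x] and not on the norm of [x^-1]: as [x]
    and [y] commute, a high power of [x^-1 * y] splits into powers of [(d / 2) x^-1] and of
    [(2 / d) y]. *)
Lemma spectral_perturb x y (d : R) : 0 < d ->
  (forall z, cabs z <= d -> x - z%:A \is a GRing.unit) ->
  GRing.comm x y -> nrm y < d / 2 -> x + y \is a GRing.unit.
Proof.
move=> d0 hx cxy hy.
have ux : x \is a GRing.unit.
  by have := hx 0; rewrite cabs0 scale0r subr0; apply; exact: ltW.
have d20 : 0 < d / 2 by rewrite divr_gt0.
have [|k hk] := @spectral_radius_lt1 ((d / 2)%:C *: x^-1).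
  move=> z z2; have -> : 1 - z *: ((d / 2)%:C *: x^-1) = x^-1 * (x - (z * (d / 2)%:C)%:A).
    by rewrite mulrBr mulVr// scalerA -scalerAr mulr1.
  rewrite unitrMl ?unitrV//; apply: hx.
  rewrite cabsM cabs_real ger0_norm ?(ltW d20)//.
  have := ler_wpM2r (ltW d20) z2; lra.
have -> : x + y = x * (1 - (- (x^-1 * y))).
  by rewrite opprK mulrDr mulr1 mulrA divrr// mul1r.
rewrite unitrMl//; apply: (unit_of_power hN (k := (2 ^ k)%N)).
have cv : GRing.comm x^-1 y by apply/commr_sym/commrV/commr_sym.
have c2 : GRing.comm ((d / 2)%:C *: x^-1) ((d / 2)^-1%:C *: (- y)).
  by rewrite /GRing.comm -!scalerAl -!scalerAr mulrN mulNr cv scalerA mulrC -scalerA.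
have -> : - (x^-1 * y) = ((d / 2)%:C *: x^-1) * ((d / 2)^-1%:C *: (- y)).
  by rewrite -scalerAl -scalerAr scalerA -rmorphM mulfV ?gt_eqF// scale1r mulrN.
rewrite exprMn_comm//; apply: le_lt_trans (nrmM _ _) _.
have hy2 : nrm (((d / 2)^-1%:C *: - y) ^+ (2 ^ k)) <= 1.
  apply: le_trans (bnX hN _ _) _; rewrite exprn_ile1//.
  rewrite nrmZ (bnN hN) cabs_real ger0_norm ?invr_ge0 ?(ltW d20)//.
  by rewrite mulrC ler_pdivrMr// mul1r ltW.
by apply: le_lt_trans hk; rewrite ler_piMr.
Qed.

(** If the spectrum were empty, some power of [T] and some power of [T^-1] would have norm below
    [1]; raised to a common exponent, their product is [1]. *)
Lemma spectrum_nonempty T : exists z, T - z%:A \isn't a GRing.unit.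
Proof.
apply: contrapT => h.
have hT z : T - z%:A \is a GRing.unit.
  by apply/negPn/negP => hz; apply: h; exists z.
have uT : T \is a GRing.unit by have := hT 0; rewrite scale0r subr0.
have [|k hk] := @spectral_radius_lt1 T.
  move=> z _; have [->|z0] := eqVneq z 0; first by rewrite scale0r subr0 unitr1.
  have -> : 1 - z *: T = (- z) *: (T - z^-1%:A).
    by rewrite scalerBr scalerA mulNr divff// scaleN1r scaleNr opprK addrC.
  by rewrite scaler_unit ?unitfE ?oppr_eq0.
have [|j hj] := @spectral_radius_lt1 T^-1.
  move=> z _; have -> : 1 - z *: T^-1 = T^-1 * (T - z%:A).
    by rewrite mulrBr mulVr// -scalerAr mulr1.
  by rewrite unitrMl ?unitrV.
have e : 1 = (T ^+ (2 ^ k)) ^+ (2 ^ j) * (T^-1 ^+ (2 ^ j)) ^+ (2 ^ k).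
  by rewrite -!exprM mulnC -exprMn_comm ?mulrV ?expr1n//; apply: commrV; exact: commr_refl.
have := bn1_eq hN; apply/eqP; rewrite lt_eqF// {1}e.
apply: le_lt_trans (nrmM _ _) _.
have h1 : nrm ((T ^+ (2 ^ k)) ^+ (2 ^ j)) < 1.
  by apply: le_lt_trans (bnX hN _ _) _; rewrite exprn_ilt1// -lt0n expn_gt0.
have h2 : nrm ((T^-1 ^+ (2 ^ j)) ^+ (2 ^ k)) <= 1.
  by apply: le_trans (bnX hN _ _) _; rewrite exprn_ile1// ltW.
by apply: le_lt_trans h1; rewrite ler_piMr.
Qed.

End SpectralRadius.

(** * Rational functions of an element and spectral mapping *)

Section RationalCalculus.
Variables (R : realType) (A : unitAlgType R[i]) (nrm : A -> R).
Variable hN : banach_norm nrm.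
Local Notation C := R[i].
Implicit Types (s x y T : A) (z : C) (f g : C -> C).

Definition spectral s z := s - z%:A \isn't a GRing.unit.

(* [x] is a rational function of [s] whose scalar values, needed only on the
   spectrum of [s], are given by [f]. *)
Definition rational_in s x f := exists N Q : {poly C},
  [/\ horner_alg s Q \is a GRing.unit, x * horner_alg s Q = horner_alg s N &
      forall z, spectral s z -> f z = N.[z] / Q.[z]].

Lemma horner_alg_comm s (P Q : {poly C}) : GRing.comm (horner_alg s P) (horner_alg s Q).
Proof. by rewrite /GRing.comm -!rmorphM mulrC. Qed.

Lemma root_spectral_nunit s (Q : {poly C}) z : spectral s z -> root Q z ->
  horner_alg s Q \isn't a GRing.unit.
Proof.
move=> hz /factor_theorem[q ->]; apply: contra hz.
rewrite rmorphM unitrM_comm; last exact: horner_alg_comm.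
by rewrite rmorphB /= horner_algX horner_algC => /andP[].
Qed.

Lemma unit_spectral_neq0 s (Q : {poly C}) z : spectral s z ->
  horner_alg s Q \is a GRing.unit -> Q.[z] != 0.
Proof. by move=> hz; apply: contraL => /(root_spectral_nunit hz). Qed.

Lemma rational_cst s z : rational_in s z%:A (fun=> z).
Proof.
exists z%:P, 1; rewrite rmorph1 unitr1 mulr1 horner_algC; split => // w _.
by rewrite !hornerE divr1.
Qed.

Lemma rational_id s : rational_in s s id.
Proof.
exists 'X, 1; rewrite rmorph1 unitr1 mulr1 horner_algX; split => // z _.
by rewrite !hornerE divr1.
Qed.

Lemma rational_comm s x f (P : {poly C}) : rational_in s x f -> GRing.comm x (horner_alg s P).
Proof.
move=> [N [Q [uQ e _]]]; have -> : x = horner_alg s N / horner_alg s Q by rewrite -e mulrK.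
apply/commr_sym/commrM; first exact: horner_alg_comm.
exact/commrV/horner_alg_comm.
Qed.

Lemma rational_comm2 s x y f g : rational_in s x f -> rational_in s y g -> GRing.comm x y.
Proof.
move=> hx [N [Q [uQ e _]]]; have -> : y = horner_alg s N / horner_alg s Q by rewrite -e mulrK.
by apply: commrM; [|apply: commrV]; exact: rational_comm hx.
Qed.

Lemma rational_add s x y f g : rational_in s x f -> rational_in s y g ->
  rational_in s (x + y) (fun z => f z + g z).
Proof.
move=> [N [Q [uQ e hf]]] [N' [Q' [uQ' e' hg]]]; exists (N * Q' + N' * Q), (Q * Q'); split.
- by rewrite rmorphM unitrMl.
- rewrite mulrDl {2}[Q * _]mulrC !rmorphD !rmorphM /= !mulrA e e' //.
- move=> z hz; rewrite hf// hg// ?hornerD !hornerM.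
  have := unit_spectral_neq0 hz uQ; have := unit_spectral_neq0 hz uQ' => q' q.
  by field; apply/andP.
Qed.

Lemma rational_mul s x y f g : rational_in s x f -> rational_in s y g ->
  rational_in s (x * y) (fun z => f z * g z).
Proof.
move=> [N [Q [uQ e hf]]] hy; have [N' [Q' [uQ' e' hg]]] := hy.
exists (N * N'), (Q * Q'); split.
- by rewrite rmorphM unitrMl.
- rewrite !rmorphM /= -mulrA [y * _]mulrA (rational_comm Q hy) -mulrA e'.
  by rewrite mulrA e.
- move=> z hz; rewrite hf// hg// ?hornerD !hornerM.
  have := unit_spectral_neq0 hz uQ; have := unit_spectral_neq0 hz uQ' => q' q.
  by field; apply/andP.
Qed.

Lemma rational_scale s x f z : rational_in s x f -> rational_in s (z *: x) (fun w => z * f w).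
Proof.
move=> hx; have -> : z *: x = z%:A * x by rewrite -scalerAl mul1r.
exact: (rational_mul (rational_cst s z) hx).
Qed.

Lemma rational_sub s x y f g : rational_in s x f -> rational_in s y g ->
  rational_in s (x - y) (fun z => f z - g z).
Proof.
move=> hx hy; rewrite -scaleN1r.
have [N [Q [uQ e h]]] := rational_add hx (rational_scale (-1) hy).
by exists N, Q; split => // z /h <-; rewrite mulN1r.
Qed.

Lemma rational_exp s x f k : rational_in s x f -> rational_in s (x ^+ k) (fun z => f z ^+ k).
Proof.
move=> hx; elim: k => [|k IH].
  by have := rational_cst s 1; rewrite scale1r.
have [N [Q [uQ e h]]] := rational_mul hx IH.
by rewrite exprS; exists N, Q; split => // z /h <-; rewrite exprS.
Qed.

Lemma rational_sum s (x : nat -> A) (f : nat -> C -> C) k :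
  (forall i, rational_in s (x i) (f i)) ->
  rational_in s (\sum_(i < k) x i) (fun z => \sum_(i < k) f i z).
Proof.
move=> hx; elim: k => [|k IH].
  have [N [Q [uQ e h]]] := rational_cst s 0.
  rewrite big_ord0 -(scale0r 1); exists N, Q; split => // z /h <-.
  by rewrite big_ord0.
have [N [Q [uQ e h]]] := rational_add IH (hx k).
by rewrite big_ord_recr; exists N, Q; split => // z /h <-; rewrite big_ord_recr.
Qed.

Lemma rational_inv s x f : x \is a GRing.unit -> rational_in s x f ->
  rational_in s x^-1 (fun z => (f z)^-1).
Proof.
move=> ux [N [Q [uQ e hf]]]; have uN : horner_alg s N \is a GRing.unit.
  by rewrite -e unitrMl.
exists Q, N; split => //; first by rewrite -e mulKr.
by move=> z hz; rewrite hf// invf_div.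
Qed.

Lemma spectral_map s x f z : rational_in s x f -> spectral s z -> spectral x (f z).
Proof.
move=> [N [Q [uQ e hf]]] hz; have q := unit_spectral_neq0 hz uQ.
rewrite /spectral; have : root (N - (f z)%:P * Q) z.
  by rewrite /root hf// !hornerE divfK// subrr.
move=> /(root_spectral_nunit hz); apply: contra => u.
by rewrite rmorphB rmorphM /= horner_algC -e -mulrBl unitrMl.
Qed.

(** The numerator splits into linear factors, and a factor that is not invertible at [s] would give
    a spectral zero of [f]. A zero numerator is excluded because the spectrum is nonempty. *)
Lemma rational_unit s x f : rational_in s x f -> (forall z, spectral s z -> f z != 0) ->
  x \is a GRing.unit.
Proof.
move=> [N [Q [uQ e hf]]] h.
suff : horner_alg s N \is a GRing.unit by rewrite -e unitrMl.
have [N0|N0] := eqVneq N 0.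
  have [z hz] := spectrum_nonempty hN s.
  by have := h z hz; rewrite hf// N0 hornerE mul0r eqxx.
have [r eN] := closed_field_poly_normal N.
rewrite eN linearZ /= -scalerAl mul1r scaler_unit ?unitfE ?lead_coef_eq0//.
rewrite rmorph_prod /= big_seq; apply: rpred_prod => z zr.
rewrite rmorphB /= horner_algX horner_algC; apply/negPn/negP => hz.
have := h z hz; rewrite hf// eN hornerZ.
have : root (\prod_(w <- r) ('X - w%:P)) z by rewrite root_prod_XsubC.
by move=> /rootP ->; rewrite mulr0 mul0r eqxx.
Qed.

Lemma rational_unit_sub s x f z : rational_in s x f -> (forall w, spectral s w -> f w != z) ->
  x - z%:A \is a GRing.unit.
Proof.
move=> hx h; apply: (rational_unit (rational_sub hx (rational_cst s z))) => w hw.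
by rewrite subr_eq0 h.
Qed.

End RationalCalculus.

(** * Renorming and multiplier bounds *)

Section Multipliers.
Variables (R : realType) (A : unitAlgType R[i]) (nrm : A -> R).
Variable hN : banach_norm nrm.
Local Notation C := R[i].
Implicit Types (x y T r : A) (z : C).

(** The norm is [sup_j nrm (r ^+ j * y) / e ^+ j]; multiplying [y] by [r] shifts the index and costs
    one factor [e]. *)
Lemma equivalent_norm r (c e : R) : 0 < e -> (forall j, nrm (r ^+ j) <= c * e ^+ j) ->
  exists N : A -> R, [/\ forall y, 0 <= N y, forall y, nrm y <= N y,
    forall x y, N (x + y) <= N x + N y, forall z y, N (z *: y) = cabs z * N y &
    forall y, N (r * y) <= e * N y].
Proof.
move=> e0 hr.
pose S y := [set nrm (r ^+ j * y) / e ^+ j | j in [set: nat]].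
have ej j : 0 < e ^+ j by rewrite exprn_gt0.
have hub y : has_ubound (S y).
  exists (c * nrm y) => _ [j _ <-]; rewrite ler_pdivrMr//.
  apply: le_trans (bnM hN _ _) _; rewrite mulrAC ler_wpM2r//; exact: bn_ge0 hN _.
have hub' y j : nrm (r ^+ j * y) / e ^+ j <= sup (S y).
  by apply: ub_le_sup => //; exists j.
have hne y : S y !=set0 by exists (nrm (r ^+ 0 * y) / e ^+ 0); exists 0%N.
have h1 y : nrm y <= sup (S y) by have := hub' y 0%N; rewrite expr0 mul1r divr1.
have h0 y : 0 <= sup (S y) by apply: le_trans (h1 y); exact: bn_ge0 hN _.
exists (fun y => sup (S y)); split => //.
- move=> x y; apply: ge_sup => // _ [j _ <-].
  apply: le_trans (lerD (hub' x j) (hub' y j)); rewrite -mulrDl ler_pM2r ?invr_gt0//.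
  by rewrite mulrDr (bnD hN).
- have le1 z y : sup (S (z *: y)) <= cabs z * sup (S y).
    apply: ge_sup => // _ [j _ <-]; rewrite -scalerAr (bnZ hN) -mulrA.
    by rewrite ler_wpM2l// cabs_ge0.
  move=> z y; apply/eqP; rewrite eq_le le1/=.
  have [->|z0] := eqVneq z 0; first by rewrite cabs0 mul0r.
  have cz : 0 < cabs z by rewrite cabs_gt0.
  rewrite mulrC -ler_pdivlMr//.
  have := le1 z^-1 (z *: y); rewrite scalerA mulVf// scale1r cabsV mulrC.
  by [].
- move=> y; apply: ge_sup => // _ [j _ <-].
  rewrite mulrA -exprSr ler_pdivrMr// mulrAC mulrC -ler_pdivrMr; last first.
    by rewrite mulr_gt0.
  by rewrite -exprS; exact: hub'.
Qed.

Variables (N : A -> R).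
Hypotheses (N0 : forall y, 0 <= N y) (ND : forall x y, N (x + y) <= N x + N y)
  (NZ : forall z y, N (z *: y) = cabs z * N y).

Definition multiplier (c : R) x := forall y, N (x * y) <= c * N y.

Lemma multiplier_le c c' x : c <= c' -> multiplier c x -> multiplier c' x.
Proof. by move=> cc h y; apply: le_trans (h y) _; rewrite ler_wpM2r. Qed.

Lemma multiplierD c c' x x' : multiplier c x -> multiplier c' x' -> multiplier (c + c') (x + x').
Proof. by move=> h h' y; rewrite !mulrDl; apply: le_trans (ND _ _) (lerD (h y) (h' y)). Qed.

Lemma multiplierZ c x z : multiplier c x -> multiplier (cabs z * c) (z *: x).
Proof. by move=> h y; rewrite -scalerAl NZ -mulrA ler_wpM2l ?cabs_ge0. Qed.

Lemma multiplierN c x : multiplier c x -> multiplier c (- x).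
Proof. by move=> /(multiplierZ (-1)); rewrite cabsN cabs1 mul1r scaleN1r. Qed.

Lemma multiplierM c c' x x' : 0 <= c -> multiplier c x -> multiplier c' x' ->
  multiplier (c * c') (x * x').
Proof.
move=> c0 h h' y; rewrite -!mulrA; apply: le_trans (h _) _.
by rewrite ler_wpM2l.
Qed.

Lemma multiplier1 : multiplier 1 1.
Proof. by move=> y; rewrite !mul1r. Qed.

Lemma multiplierX c x k : 0 <= c -> multiplier c x -> multiplier (c ^+ k) (x ^+ k).
Proof.
move=> c0 h; elim: k => [|k IH]; first exact: multiplier1.
by rewrite !exprS; exact: multiplierM.
Qed.

Lemma multiplier_inv c x : c < 1 -> 1 - x \is a GRing.unit -> multiplier c x ->
  multiplier (1 - c)^-1 (1 - x)^-1.
Proof.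
move=> c1 u h y; set w := (1 - x)^-1 * y.
have e : w = y + x * w.
  by rewrite -{1}[y](mulVKr u) -/w mulrBl mul1r subrK.
rewrite mulrC ler_pdivlMr ?subr_gt0//.
by have := ND y (x * w); rewrite -e; have := h w; lra.
Qed.

Lemma multiplier_remainder c x k : 0 <= c <= 1 -> multiplier c x ->
  multiplier (3 ^+ k * c ^+ 2) ((1 - x) ^+ k - 1 + x *+ k).
Proof.
move=> /andP[c0 c1] h; elim: k => [|k IH].
  move=> y; rewrite expr0 subrr mulr0n add0r mul0r -(scale0r 0) NZ cabs0 mul0r.
  by rewrite mulr_ge0// mulr_ge0 ?sqr_ge0.
have -> : (1 - x) ^+ k.+1 - 1 + x *+ k.+1 =
    (1 - x) * ((1 - x) ^+ k - 1 + x *+ k) + (k%:R : C) *: x ^+ 2.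
  rewrite exprS scaler_nat mulrDr mulrBr mulr1 mulrnAr.
  rewrite [(1 - x) * x]mulrBl mul1r -expr2 mulrnBl -[RHS]addrA subrK.
  by rewrite opprB mulrS !addrA; congr (_ + _); rewrite addrAC.
apply: multiplier_le (multiplierD (multiplierM _ (multiplierD multiplier1 (multiplierN h)) IH)
  (multiplierZ k%:R (multiplierX 2 c0 h))); last lra.
rewrite cabs_nat [3 ^+ k.+1]exprS.
have k3 : (k%:R : R) <= 3 ^+ k by rewrite -natrX ler_nat ltnW// ltn_expl.
have p0 : 0 <= 3 ^+ k * c ^+ 2 by rewrite mulr_ge0 ?sqr_ge0// exprn_ge0.
have := ler_wpM2r (sqr_ge0 c) k3; have := ler_wpM2r p0 c1; move: (3 ^+ k) => q; lra.
Qed.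

End Multipliers.

(** * Newton's method in a Banach algebra *)

Section NewtonAlgebra.
Variables (R : realType) (A : unitAlgType R[i]) (nrm : A -> R).
Variable hN : banach_norm nrm.
Local Notation C := R[i].
Implicit Types (x y T r s : A) (z : C).

Variables (n : nat) (a : A) (delta : R).
Hypotheses (n_gt0 : (0 < n)%N) (delta01 : 0 < delta <= 1).
Hypothesis spec_a : forall z, spectral a z -> domainD (1 / 2000) z /\ delta <= cabs z.

Definition newton_alg k : A :=
  iter k (fun X => (n.+1%:R : C)^-1 *: (X * (n%:R + X ^- n.+1 * a))) 1.

(** Besides [s = a], this serves with [s] a [p]-th root of [a]: the iterates become rational
    functions of that root and can be compared with it on its spectrum. *)
Lemma newton_alg_rational_step s f k : rational_in s a f -> newton_alg k \is a GRing.unit ->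
  rational_in s (newton_alg k) (fun z => scalar_newton n (f z) k) ->
  rational_in s (newton_alg k.+1) (fun z => scalar_newton n (f z) k.+1).
Proof.
move=> ha uX hX; rewrite /newton_alg iterS -/(newton_alg k).
have uXp : newton_alg k ^+ n.+1 \is a GRing.unit by rewrite unitrX.
apply: (rational_scale _ (rational_mul hX (rational_add _ _))).
  by rewrite -(scaler_nat n 1); exact: rational_cst.
exact: rational_mul (rational_inv uXp (rational_exp n.+1 hX)) ha.
Qed.

Lemma scalar_newton_neq0 z k : spectral a z -> scalar_newton n z k != 0.
Proof.
move=> /spec_a[hz dz].
have [m Hm] := scalar_newton_cvg n_gt0 delta01 (@ltr01 R).
have [zeta hzeta] := half_sector_root_exists n (domainD_Re_gt0 hz).
by have [h _] := Hm z zeta hz dz hzeta.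
Qed.

Lemma newton_alg_unit_rational k : newton_alg k \is a GRing.unit /\
  rational_in a (newton_alg k) (fun z => scalar_newton n z k).
Proof.
elim: k => [|k [IH1 IH2]].
  split; first exact: unitr1.
  by have := rational_cst a 1; rewrite scale1r.
have h := newton_alg_rational_step (rational_id a) IH1 IH2.
by split => //; apply: (rational_unit hN h) => z; exact: scalar_newton_neq0.
Qed.

Lemma newton_alg_unit k : newton_alg k \is a GRing.unit.
Proof. by have [] := newton_alg_unit_rational k. Qed.

Lemma newton_alg_rational s f k : rational_in s a f ->
  rational_in s (newton_alg k) (fun z => scalar_newton n (f z) k).
Proof.
move=> ha; elim: k => [|k IH]; first by have := rational_cst s 1; rewrite scale1r.
exact: newton_alg_rational_step ha (newton_alg_unit k) IH.
Qed.

Lemma cabs_exp1D_le (u : C) k : cabs u <= 1 -> cabs ((1 + u) ^+ k - 1) <= 2 ^+ k * cabs u.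
Proof.
move=> u1; suff : cabs ((1 + u) ^+ k - 1) <= (2 ^+ k - 1) * cabs u.
  by move/le_trans; apply; rewrite ler_wpM2r ?cabs_ge0//; lra.
elim: k => [|k IH]; first by rewrite !expr0 !subrr cabs0 mul0r.
have -> : (1 + u) ^+ k.+1 - 1 = (1 + u) * ((1 + u) ^+ k - 1) + u by rewrite exprS; ring.
have h : cabs (1 + u) <= 2 by apply: le_trans (cabsD _ _) _; rewrite cabs1; lra.
apply: le_trans (cabsD _ _) _; rewrite cabsM.
have := ler_pM (cabs_ge0 _) (cabs_ge0 _) h IH; rewrite [2 ^+ k.+1]exprS; lra.
Qed.

Definition residual k := 1 - newton_alg k ^- n.+1 * a.

Lemma residual_rational k :
  rational_in a (residual k) (fun z => 1 - scalar_newton n z k ^- n.+1 * z).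
Proof.
have uXp : newton_alg k ^+ n.+1 \is a GRing.unit by rewrite unitrX ?newton_alg_unit.
have h1 : rational_in a 1 (fun=> 1) by have := rational_cst a 1; rewrite scale1r.
apply: (rational_sub h1 (rational_mul (rational_inv uXp _) (rational_id a))).
by apply: rational_exp; have [] := newton_alg_unit_rational k.
Qed.

Lemma residual_value_small (e : R) : 0 < e -> exists m, forall z, spectral a z ->
  cabs (1 - scalar_newton n z m ^- n.+1 * z) <= e.
Proof.
move=> e0; pose eta := Num.min 1 (e / 2 ^+ n.+1).
have eta0 : 0 < eta by rewrite lt_min ltr01 divr_gt0// exprn_gt0.
have [m Hm] := scalar_newton_cvg n_gt0 delta01 eta0.
exists m => z /spec_a[hz dz].
have [zeta hzeta] := half_sector_root_exists n (domainD_Re_gt0 hz).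
have [_ /(_ m (leqnn m))] := Hm z zeta hz dz hzeta.
set x := scalar_newton n z m; rewrite le_min => /andP[h1 h2].
have [r [t [_ _ _ ez]]] := hzeta.
have -> : x ^- n.+1 * z = (1 + (zeta / x - 1)) ^+ n.+1.
  by rewrite addrC subrK expr_div_n ez mulrC.
rewrite cabs_distC; apply: le_trans (cabs_exp1D_le _ h1) _.
by rewrite mulrC -ler_pdivlMr// exprn_gt0.
Qed.

Lemma newton_algS k : newton_alg k.+1 = newton_alg k * (1 - (n.+1%:R : C)^-1 *: residual k).
Proof.
have p0 : (n.+1%:R : C) != 0 by rewrite pnatr_eq0.
rewrite /newton_alg iterS -/(newton_alg k) scalerAr; congr (_ * _).
have -> : n%:R + newton_alg k ^- n.+1 * a = n.+1%:R - residual k.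
  by rewrite /residual opprB -[n.+1%:R]natr1 -addrA; congr (_ + _); rewrite addrCA subrr addr0.
have -> : n.+1%:R = (n.+1%:R : C) *: (1 : A) by rewrite scaler_nat.
by rewrite scalerBr scalerA mulVf// scale1r.
Qed.

(** Since [residual k = p u], the linear terms of the binomial expansion cancel: the new residual is
    quadratic in [u], up to an invertible factor. *)
Lemma residualS k (u := (n.+1%:R : C)^-1 *: residual k) :
  residual k.+1 = (1 - u)^-1 ^+ n.+1 * ((1 - u) ^+ n.+1 - 1 + u *+ n.+1) /\
  1 - u \is a GRing.unit.
Proof.
have p0 : (n.+1%:R : C) != 0 by rewrite pnatr_eq0.
have uX := newton_alg_unit k; have uX' := newton_alg_unit k.+1.
have [_ rX] := newton_alg_unit_rational k.
have cXu : GRing.comm (newton_alg k) (1 - u).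
  apply: commrB; first exact: commr1.
  exact: rational_comm2 rX (rational_scale _ (residual_rational k)).
have u1 : 1 - u \is a GRing.unit by move: uX'; rewrite newton_algS unitrMr.
split => //.
have up : (1 - u) ^+ n.+1 \is a GRing.unit by rewrite unitrX.
have pu : u *+ n.+1 = residual k.
  by rewrite /u -scaler_nat scalerA mulfV// scale1r.
rewrite pu [X in _ = _ * X](_ : _ = (1 - u) ^+ n.+1 - (1 - residual k)); last first.
  by rewrite opprB [RHS]addrA addrAC.
rewrite mulrBr exprVn mulVr//.
rewrite {1}/residual newton_algS -/u exprMn_comm// invrM ?unitrX//.
by rewrite -mulrA /residual opprB addrCA subrr addr0.
Qed.

Lemma residual_geometric : exists (m : nat) (c : R),
  0 <= c /\ forall j, nrm (residual (m + j)) <= c * 2^-1 ^+ j.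
Proof.
(* From a multiplier bound [t <= 1 / 2], the next residual gets [2 ^ p * 3 ^ p * t ^ 2]: [2 ^ p] for
   the inverse factor, [3 ^ p] for the binomial remainder. For [t <= e] this is at most [t / 2]. *)
pose e : R := (2 * 6 ^+ n.+1)^-1.
have p6 : (1 : R) <= 6 ^+ n.+1 by apply: exprn_ege1; lra.
have e0 : 0 < e by rewrite invr_gt0; lra.
have e1 : 2 * 6 ^+ n.+1 * e = 1 by rewrite mulfV// gt_eqF//; lra.
have e2 : e <= 1 / 2 by move: (6 ^+ n.+1) p6 e1 => q; nra.
have e40 : 0 < e / 4 by rewrite divr_gt0.
(* Values of modulus at most [e / 4] keep the spectrum strictly inside the disc of radius [e / 2];
   [power_bounded] doubles that radius and returns [e]. *)
have [m Hm] := residual_value_small e40.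
have [|z dz|c c0 hc] := power_bounded hN (T := residual m) (d := e / 2).
- by rewrite divr_gt0.
- apply: (rational_unit_sub hN (residual_rational m)) => w /Hm hw.
  by apply/eqP => ew; move: hw dz; rewrite -ew; lra.
have {}hc j : nrm (residual m ^+ j) <= c * e ^+ j.
  by have := hc j; rewrite (_ : 2 * (e / 2) = e)//; field.
have [N [N0 Nn ND NZ Nr]] := equivalent_norm hN e0 hc.
exists m, (e * N 1); split; first by rewrite mulr_ge0// ltW.
(* The norm [N] is built from the residual at [m] alone; [residualS] carries multiplier bounds to
   all later ones. Evaluation at [1] leads back to [nrm]. *)
suff H j : multiplier N (e * 2^-1 ^+ j) (residual (m + j)).
  move=> j; apply: le_trans (Nn _) _.
  by have := H j 1; rewrite mulr1 mulrAC.
elim: j => [|j IH]; first by rewrite addn0 expr0 mulr1.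
have [eS u1] := residualS (m + j).
rewrite addnS eS; set u := _ *: residual (m + j) in eS u1 *.
set t := e * 2^-1 ^+ j in IH.
have q1 : 0 <= (2^-1 : R) ^+ j <= 1 by rewrite exprn_ge0// exprn_ile1//; lra.
have t0 : 0 <= t by rewrite mulr_ge0// ?(ltW e0)//; case/andP: q1.
have te : t <= e by rewrite ler_piMr ?(ltW e0)//; case/andP: q1.
have hu : multiplier N t u.
  apply: (multiplier_le N0 _ (multiplierZ NZ _ IH)).
  by rewrite ler_piMl// cabsV cabs_nat invf_le1 ?ler1n ?ltr0n.
have h1 : multiplier N 2 (1 - u)^-1.
  apply: (multiplier_le N0 _ (multiplier_inv ND _ u1 hu)); last lra.
  rewrite -[leRHS]invrK lef_pV2 ?posrE ?invr_gt0//; lra.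
have h2 : multiplier N (2 ^+ n.+1) ((1 - u)^-1 ^+ n.+1) by apply: multiplierX.
have t01 : 0 <= t <= 1 by rewrite t0/=; lra.
have h3 := multiplier_remainder N0 ND NZ n.+1 t01 hu.
have p2 : (0 : R) <= 2 ^+ n.+1 by rewrite exprn_ge0.
apply: (multiplier_le N0 _ (multiplierM p2 h2 h3)).
have e6 : (2 : R) ^+ n.+1 * 3 ^+ n.+1 = 6 ^+ n.+1.
  by rewrite -exprMn; congr (_ ^+ _); ring.
have -> : 2 ^+ n.+1 * (3 ^+ n.+1 * t ^+ 2) = 6 ^+ n.+1 * t * t by rewrite -e6; ring.
have -> : e * 2^-1 ^+ j.+1 = 2^-1 * t by rewrite /t exprS; ring.
rewrite ler_wpM2r//.
have : 6 ^+ n.+1 * t <= 6 ^+ n.+1 * e by rewrite ler_wpM2l//; lra.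
lra.
Qed.

End NewtonAlgebra.

(** * Existence, spectrum and uniqueness of the limit *)

Section NewtonLimit.
Variables (R : realType) (A : unitAlgType R[i]) (nrm : A -> R).
Variable hN : banach_norm nrm.
Local Notation C := R[i].
Implicit Types (x y T r s : A) (z : C).

Variables (n : nat) (a : A) (delta : R).
Hypotheses (n_gt0 : (0 < n)%N) (delta01 : 0 < delta <= 1).
Hypothesis spec_a : forall z, spectral a z -> domainD (1 / 2000) z /\ delta <= cabs z.

Local Notation X := (newton_alg n a).
Local Notation conv := (bconv nrm).

Let nrm_ge0 := bn_ge0 hN.
Let uX := newton_alg_unit hN n_gt0 delta01 spec_a.

Lemma bconv_shift (u : nat -> A) l m : conv (fun j => u (m + j)%N) l -> conv u l.
Proof.
move=> h e e0; have [K HK] := h e e0; exists (m + K)%N => k mk.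
have := HK (k - m)%N; rewrite subnKC ?(leq_trans (leq_addr K m))//; apply.
by rewrite leq_subRL ?(leq_trans (leq_addr K m)).
Qed.

Lemma residual_cvg : conv (residual n a) 0.
Proof.
have [m [c [c0 hc]]] := residual_geometric hN n_gt0 delta01 spec_a.
apply: (@bconv_shift _ _ m).
apply: (@bconv_geometric _ _ _ _ c 2^-1) => //; first by apply/andP; split; lra.
by move=> k; rewrite subr0 mulrC.
Qed.

(** The step from [X k] is [- X k * residual k / p], so the size of [X k] has to be controlled too.
    The crude growth [(3 / 2) ^ j] is enough: against the decay [2 ^ - j] of the residuals it leaves
    steps of order [(3 / 4) ^ j]. *)
Lemma newton_alg_cvg : exists r, conv X r.
Proof.
have [m [c [c0 hc]]] := residual_geometric hN n_gt0 delta01 spec_a.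
have h01 : 0 <= (2^-1 : R) < 1 by apply/andP; split; lra.
have h2 : 0 < (1 / 2 : R) by lra.
have [j0 Hj0] := geometric_le h01 c0 h2.
pose v j := X (m + j0 + j).
have hR j : nrm (residual n a (m + j0 + j)) <= 1 / 2 * 2^-1 ^+ j.
  rewrite -addnA; apply: le_trans (hc _) _.
  rewrite exprD mulrA [c * _]mulrC ler_wpM2r ?exprn_ge0//.
  exact: Hj0.
have p1 : (n.+1%:R^-1 : R) <= 1 by rewrite invf_le1 ?ler1n ?ltr0n.
have hd j : nrm (v j.+1 - v j) <= nrm (v j) * (1 / 2 * 2^-1 ^+ j).
  rewrite /v addnS newton_algS mulrBr mulr1 addrAC subrr add0r (bnN hN).
  apply: le_trans (bnM hN _ _) _; rewrite ler_wpM2l//.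
  rewrite (bnZ hN) cabsV cabs_nat; apply: le_trans (hR j).
  by rewrite ler_piMl.
have q1 j : 0 <= (2^-1 : R) ^+ j <= 1 by rewrite exprn_ge0// exprn_ile1//; lra.
have hv j : nrm (v j) <= nrm (v 0%N) * (3 / 2) ^+ j.
  elim: j => [|j IH]; first by rewrite expr0 mulr1.
  have := bnD hN (v j.+1 - v j) (v j); rewrite subrK => h3.
  apply: le_trans h3 _; rewrite exprS mulrCA.
  have := hd j; have := nrm_ge0 (v j); case/andP: (q1 j) => q0 q2 v0 h4.
  have h5 : nrm (v j) * (1 / 2 * 2^-1 ^+ j) <= nrm (v j) * (1 / 2).
    by rewrite ler_wpM2l//; lra.
  have : 3 / 2 * nrm (v j) <= 3 / 2 * (nrm (v 0%N) * (3 / 2) ^+ j) by rewrite ler_wpM2l//; lra.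
  by move: (3 / 2 * (_ * _)) => w; lra.
have h34 : 0 <= (3 / 4 : R) < 1 by apply/andP; split; lra.
have [j|l hl] := @bn_complete _ _ _ hN v (nrm (v 0%N) / 2) (3 / 4) h34.
  apply: le_trans (hd j) _; apply: le_trans (ler_wpM2r _ (hv j)) _.
    by case/andP: (q1 j) => q0 _; rewrite mulr_ge0//; lra.
  have -> : (3 / 4 : R) ^+ j = (3 / 2) ^+ j * 2^-1 ^+ j.
    by rewrite -exprMn; congr (_ ^+ _); field.
  by rewrite le_eqVlt; apply/orP; left; apply/eqP; ring.
by exists l; exact: (@bconv_shift _ _ (m + j0)).
Qed.

Variable r : A.
Hypothesis Xr : conv X r.

Lemma newton_limit_root : r ^+ n.+1 = a.
Proof.
have e k : X k ^+ n.+1 * residual n a k = X k ^+ n.+1 - a.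
  by rewrite /residual mulrBr mulr1 mulrA divrr ?mul1r// unitrX.
have h1 := bconvM hN (bconvX hN n.+1 Xr) residual_cvg.
have h2 := bconvB hN (bconvX hN n.+1 Xr) (bconv_cst hN a).
have := bconv_uniq hN h1; rewrite mulr0; under eq_fun do rewrite e.
by move=> /(_ _ h2)/esym/eqP; rewrite subr_eq0 => /eqP.
Qed.

Lemma rational_root s : s ^+ n.+1 = a -> rational_in s a (fun z => z ^+ n.+1).
Proof. by move=> <-; exact: rational_exp (rational_id s). Qed.

Lemma spectral_root s z : s ^+ n.+1 = a -> spectral s z -> spectral a (z ^+ n.+1).
Proof. by move=> /rational_root hs; exact: spectral_map hs. Qed.

(** As [X k] is a rational function of [r], the number [x - z], with [x] the scalar iterate for
    [z ^ p], belongs to the spectrum of [X k - r]. It is thus bounded by a norm tending to [0],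
    while [x] tends to the principal root of [z ^ p]. *)
Lemma newton_limit_spectrum z : spectral r z -> half_sector_root n (z ^+ n.+1) z.
Proof.
move=> hz; have er := newton_limit_root.
have [hD hd] := spec_a (spectral_root er hz).
have [zeta hzeta] := half_sector_root_exists n (domainD_Re_gt0 hD).
suff -> : z = zeta by have [p [t [? ? ? ez]]] := hzeta; exists p, t; split.
apply/eqP; rewrite -subr_eq0 -cabs_eq0 eq_le cabs_ge0 andbT.
apply/ler_addgt0Pr => e e0; rewrite add0r.
pose e1 := Num.min 1 (e / 2); have e10 : 0 < e1 by rewrite lt_min ltr01 divr_gt0.
have z1 : 0 < cabs z + 1 by rewrite ltr_wpDl ?cabs_ge0.
pose e2 := e / 2 / (cabs z + 1); have e20 : 0 < e2 by rewrite !divr_gt0.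
have [m Hm] := scalar_newton_cvg n_gt0 delta01 e20.
have [nz Hz] := Hm _ _ hD hd hzeta.
have [K HK] := Xr e10.
pose k := maxn m K; set x := scalar_newton n (z ^+ n.+1) k.
have hx : cabs (x - z) <= e1.
  apply: le_trans (HK k (leq_maxr m K)); rewrite leNgt; apply/negP => h.
  have := rational_sub (newton_alg_rational hN n_gt0 delta01 spec_a k (rational_root er)) (rational_id r).
  by move=> /spectral_map/(_ hz); rewrite /spectral (large_scalar_unit hN h).
have hx2 : cabs (zeta / x - 1) <= e2 by apply: Hz; exact: leq_maxl.
move: hx; rewrite le_min => /andP[hx1 hx3].
have x0 : x != 0 by exact: nz.
have cx : cabs x <= cabs z + 1.
  have := cabsD (x - z) z; rewrite subrK; lra.
have -> : z - zeta = - (x - z) - x * (zeta / x - 1) by field.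
apply: le_trans (cabsB _ _) _; rewrite cabsN cabsM.
have := ler_pM (cabs_ge0 _) (cabs_ge0 _) cx hx2.
have -> : (cabs z + 1) * e2 = e / 2 by rewrite /e2; field; rewrite gt_eqF.
lra.
Qed.

(** In [r ^ p - s ^ p = (r - s) * G'] the second factor must be invertible. The limit [r] is not
    known to be rational in [s], but the iterates [X k] are; the corresponding sums [G k] have
    spectrum away from [0] uniformly in [k], which [spectral_perturb] transfers to [G']. *)
Lemma newton_limit_unique s : s ^+ n.+1 = a ->
  (forall z, spectral s z -> half_sector_root n (z ^+ n.+1) z) -> s = r.
Proof.
move=> es hs; have er := newton_limit_root.
have /andP[d0 d1] := delta01.
(* If [|h - 1| <= eta], each [h ^ i] with [i <= n] is within [1 / 2] of [1], so their sum has
   modulus at least [p / 2]. *)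
pose eta : R := Num.min 1 (2 ^+ n.+1 * 2)^-1.
have p2 : (1 : R) <= 2 ^+ n.+1 by apply: exprn_ege1; lra.
have eta0 : 0 < eta by rewrite lt_min ltr01 invr_gt0; lra.
have [m Hm] := scalar_newton_cvg n_gt0 delta01 eta0.
pose G k := \sum_(i < n.+1) X k ^+ (n - i) * s ^+ i.
pose G' := \sum_(i < n.+1) r ^+ (n - i) * s ^+ i.
have hG : conv G G'.
  have h i : conv (fun k => X k ^+ (n - i) * s ^+ i) (r ^+ (n - i) * s ^+ i).
    exact: (bconvM hN (bconvX hN _ Xr) (bconv_cst hN _)).
  exact: (bconv_sum hN n.+1 h).
(* Half of the lower bound for the values of [G k] on the spectrum of [s], which comes from
   [|x| >= delta / 2]. *)
pose d := (delta / 2) ^+ n / 4.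
have d20 : 0 < (delta / 2) ^+ n by rewrite exprn_gt0// divr_gt0.
have dd0 : 0 < d by rewrite divr_gt0.
have d40 : 0 < d / 4 by rewrite divr_gt0.
have rX k := newton_alg_rational hN n_gt0 delta01 spec_a k (rational_root es).
pose g k z := \sum_(i < n.+1) scalar_newton n (z ^+ n.+1) k ^+ (n - i) * z ^+ i.
have rG k : rational_in s (G k) (g k).
  apply: (@rational_sum _ _ s (fun i => X k ^+ (n - i) * s ^+ i)
    (fun i z => scalar_newton n (z ^+ n.+1) k ^+ (n - i) * z ^+ i)) => i.
  apply: rational_mul; apply: rational_exp; [exact: rX | exact: rational_id].
have hg k z : (m <= k)%N -> spectral s z -> (delta / 2) ^+ n / 2 <= cabs (g k z).
  move=> mk hz; have [hD hd] := spec_a (spectral_root es hz).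
  have [nz /(_ k mk)] := Hm _ _ hD hd (hs z hz).
  have := nz k; rewrite /g; set x := scalar_newton _ _ _ => x0.
  rewrite le_min => /andP[h1 h2].
  have -> : \sum_(i < n.+1) x ^+ (n - i) * z ^+ i = x ^+ n * \sum_(i < n.+1) (z / x) ^+ i.
    rewrite mulr_sumr; apply: eq_bigr => i _.
    have le_in : (i <= n)%N by rewrite -ltnS.
    have -> : x ^+ n = x ^+ (n - i) * x ^+ i by rewrite -exprD subnK.
    rewrite expr_div_n.
    by have : x ^+ i != 0; [rewrite expf_neq0 | move: (x ^+ i) => q q0; field].
  set h := z / x in h1 h2 *.
  have ch : cabs h <= 2.
    by have := cabsD (h - 1) 1; rewrite subrK cabs1; lra.
  have hi i : (i < n.+1)%N -> cabs (h ^+ i - 1) <= 1 / 2.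
    move=> ip; have := cabs_exp1D_le i h1; rewrite (_ : 1 + (h - 1) = h); last by ring.
    have h3 : (2 : R) ^+ i <= 2 ^+ n.+1 by rewrite ler_weXn2l ?ler1n// ltnW.
    have h4 := ler_pM (exprn_ge0 i (ler0n R 2)) (cabs_ge0 _) h3 h2.
    move=> h5; apply: le_trans h5 _; apply: le_trans h4 _.
    by rewrite invfM mulrA mulfV ?mul1r ?gt_eqF//; lra.
  have hsum : 1 / 2 <= cabs (\sum_(i < n.+1) h ^+ i).
    have e : (n.+1%:R : C) = \sum_(i < n.+1) h ^+ i - \sum_(i < n.+1) (h ^+ i - 1).
      rewrite sumrB opprB addrCA subrr addr0 sumr_const card_ord //.
    have := cabsB (\sum_(i < n.+1) h ^+ i) (\sum_(i < n.+1) (h ^+ i - 1)).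
    rewrite -e cabs_nat.
    have : cabs (\sum_(i < n.+1) (h ^+ i - 1)) <= \sum_(i < n.+1) (1 / 2).
      apply: le_trans (cabs_sum _ (fun i => h ^+ i - 1)) _.
      by apply: ler_sum => i _; exact: hi.
    rewrite sumr_const card_ord -mulr_natl.
    have : (1 : R) <= n.+1%:R by rewrite ler1n.
    lra.
  have cz : delta <= cabs z.
    have [z1|z1] := leP (cabs z) 1; last lra.
    by apply: le_trans hd _; rewrite cabsX exprS ler_piMr ?cabs_ge0 ?exprn_ile1 ?cabs_ge0.
  have cx : delta / 2 <= cabs x.
    have zx : cabs z = cabs h * cabs x by rewrite -cabsM /h divfK.
    by have := ler_wpM2r (cabs_ge0 x) ch; rewrite -zx; lra.
  rewrite cabsM cabsX (_ : _ / 2 = (delta / 2) ^+ n * (1 / 2)); last by rewrite div1r.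
  have hx : (delta / 2) ^+ n <= cabs x ^+ n.
    by rewrite lerXn2r// nnegrE ?cabs_ge0//; lra.
  by apply: (ler_pM _ _ hx hsum); [exact: ltW | lra].
have uGz k : (m <= k)%N -> forall z, cabs z <= d -> G k - z%:A \is a GRing.unit.
  move=> mk z zd; apply: (rational_unit_sub hN (rG k)) => w hw.
  have := hg k w mk hw; apply: contraTneq => ->; rewrite -ltNge.
  by apply: le_lt_trans zd _; rewrite /d; lra.
have cXs k : GRing.comm s (X k) by exact: rational_comm2 (rational_id s) (rX k).
have crs : GRing.comm s r by exact: (bconv_comm hN Xr).
have crX k : GRing.comm (X k) r.
  apply: (bconv_comm hN Xr) => j.
  by exact: rational_comm2 (rX k) (rX j).
have uG : G' \is a GRing.unit.
  have [K HK] := hG _ d40.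
  pose k := maxn m K.
  have -> : G' = G k + (G' - G k) by rewrite addrC subrK.
  apply: (spectral_perturb hN dd0 (uGz k (leq_maxl _ _))).
    apply: commrB; last exact: commr_refl.
    have c1 v : GRing.comm (X k) v -> GRing.comm s v -> GRing.comm (G k) v.
      move=> h1 h2; apply/commr_sym/commr_sum => i _.
      by apply: commrM; apply: commrX; apply: commr_sym.
    apply: commr_sum => j _; apply: commrM; apply: commrX; apply: c1 => //.
    exact/commr_sym/cXs.
  rewrite (bn_distC hN); apply: le_lt_trans (HK k (leq_maxr _ _)) _; lra.
have : (r - s) * G' = 0.
  have := subrXX_comm n.+1 (commr_sym crs); rewrite er es subrr => ->.
  by rewrite /G'; congr (_ * _).
by move=> /(canRL (mulrK uG))/eqP; rewrite mul0r subr_eq0 => /eqP.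
Qed.

End NewtonLimit.

(** * Bounded operators *)

Section NormedSpace.
Variables (R : realType) (H : completeNormedModType R[i]).
Local Notation C := R[i].
Implicit Types (x y : H) (f g : H -> H) (z : C).

Definition rnorm x : R := complex.Re `|x|.

Lemma rnormE x : `|x| = (rnorm x)%:C.
Proof. by rewrite /rnorm RRe_real// ger0_real. Qed.

Lemma rnorm_ge0 x : 0 <= rnorm x.
Proof. by rewrite -lecR -rnormE normr_ge0. Qed.

Lemma rnormD x y : rnorm (x + y) <= rnorm x + rnorm y.
Proof. by rewrite -lecR rmorphD /= -!rnormE ler_normD. Qed.

Lemma rnormZ z x : rnorm (z *: x) = cabs z * rnorm x.
Proof. by apply: complexI; rewrite -rnormE normrZ rmorphM /= -cabsE -rnormE. Qed.

Lemma rnorm0 : rnorm 0 = 0.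
Proof. by rewrite /rnorm normr0. Qed.

Lemma rnormN x : rnorm (- x) = rnorm x.
Proof. by rewrite /rnorm normrN. Qed.

Lemma rnorm_distC x y : rnorm (x - y) = rnorm (y - x).
Proof. by rewrite /rnorm distrC. Qed.

Lemma rnorm_eq0 x : (rnorm x == 0) = (x == 0).
Proof. by rewrite -(inj_eq (@complexI R)) /= -rnormE normr_eq0. Qed.

Lemma bounded_opP f : linear f -> bounded_op f <-> exists M, forall x, rnorm (f x) <= M * rnorm x.
Proof.
move=> lf; split=> [[_ [M hM]]|[M hM]].
  by exists M => x; have := hM x; rewrite !rnormE -rmorphM lecR.
by split => //; exists M => x; rewrite !rnormE -rmorphM lecR.
Qed.

Lemma linear_op0 f : linear f -> f 0 = 0.
Proof. by move=> lf; have := lf (-1) 0 0; rewrite scaler0 add0r scaleN1r addNr. Qed.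

Lemma linear_opZ f z x : linear f -> f (z *: x) = z *: f x.
Proof. by move=> lf; have := lf z x 0; rewrite !addr0 linear_op0// addr0. Qed.

Lemma linear_opD f x y : linear f -> f (x + y) = f x + f y.
Proof. by move=> lf; have := lf 1 x y; rewrite !scale1r. Qed.

Lemma opnorm_le f (c : R) : 0 <= c -> (forall x, rnorm (f x) <= c * rnorm x) -> opnorm f <= c.
Proof.
move=> c0 h; apply: ge_sup.
  by exists (rnorm (f 0)), 0 => //=; rewrite normr0.
move=> _ [x /= x1 <-]; apply: le_trans (h x) _.
by rewrite ler_piMr// -lecR -rnormE.
Qed.

Lemma opnorm_ub f : bounded_op f -> has_ubound [set complex.Re `|f x| | x in [set x : H | `|x| <= 1]].
Proof.
move=> hf; have [M hM] := (bounded_opP hf.1).1 hf.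
exists `|M| => _ [x /= x1 <-]; apply: le_trans (hM x) _.
have x1' : rnorm x <= 1 by rewrite -lecR -rnormE.
apply: le_trans (ler_wpM2r (rnorm_ge0 x) (ler_norm M)) _.
by rewrite ler_piMr.
Qed.

Lemma opnorm_ge0 f : bounded_op f -> 0 <= opnorm f.
Proof.
move=> hf; apply: le_trans (rnorm_ge0 (f 0)) _.
by apply: ub_le_sup; [exact: opnorm_ub | exists 0 => //=; rewrite normr0].
Qed.

Lemma le_opnorm f x : bounded_op f -> rnorm (f x) <= opnorm f * rnorm x.
Proof.
move=> hf; have [->|x0] := eqVneq x 0.
  by rewrite (linear_op0 hf.1) rnorm0 mulr0.
have rx : 0 < rnorm x by rewrite lt_def rnorm_eq0 x0 rnorm_ge0.
rewrite -ler_pdivrMr//.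
have -> : rnorm (f x) / rnorm x = rnorm (f ((rnorm x)^-1%:C *: x)).
  by rewrite (linear_opZ _ _ hf.1) rnormZ cabs_real ger0_norm ?invr_ge0 ?(ltW rx)// mulrC.
apply: ub_le_sup; first exact: opnorm_ub.
exists ((rnorm x)^-1%:C *: x) => //=.
rewrite rnormE rnormZ cabs_real ger0_norm ?invr_ge0 ?(ltW rx)//.
by rewrite mulVf ?gt_eqF// rmorph1.
Qed.

Lemma geometric_sequence_cvg (u : nat -> H) (c q : R) : 0 <= q < 1 -> 0 <= c ->
  (forall k, rnorm (u k.+1 - u k) <= c * q ^+ k) ->
  exists l, forall k, rnorm (u k - l) <= q ^+ k * (c / (1 - q)).
Proof.
move=> q01 c0 hu; have /andP[q0 q1] := q01.
have q10 : 0 < 1 - q by rewrite subr_gt0.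
have B0 : 0 <= c / (1 - q) by rewrite divr_ge0// ltW.
have hkj k j : rnorm (u (k + j)%N - u k) <= q ^+ k * (c / (1 - q)) * (1 - q ^+ j).
  elim: j => [|j IH]; first by rewrite addn0 subrr rnorm0 expr0 subrr mulr0.
  rewrite addnS -(subrK (u (k + j)%N) (u (k + j).+1)) -addrA.
  apply: le_trans (rnormD _ _) _.
  apply: le_trans (lerD (hu _) IH) _.
  rewrite le_eqVlt; apply/orP; left; apply/eqP.
  rewrite exprD exprS; field; rewrite gt_eqF//.
have hkj' k j : (k <= j)%N -> rnorm (u j - u k) <= q ^+ k * (c / (1 - q)).
  move=> kj; rewrite -(subnKC kj); apply: le_trans (hkj _ _) _.
  have h1 : 1 - q ^+ (j - k) <= 1 by rewrite gerBl exprn_ge0.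
  by rewrite ler_piMr// mulr_ge0// exprn_ge0.
have cu : cauchy (u @ \oo).
  apply: cauchy_exP => e e0; have e1 : 0 < complex.Re e.
    by rewrite -ltcR RRe_real// gtr0_real.
  have e2 : 0 < complex.Re e / 2 by rewrite divr_gt0.
  have [K HK] := geometric_le q01 B0 e2.
  exists (u K), K => // k /= Kk; rewrite -ball_normE /= rnormE.
  rewrite -(RRe_real (gtr0_real e0)) ltcR rnorm_distC.
  apply: le_lt_trans (hkj' _ _ Kk) _; apply: le_lt_trans (HK K (leqnn K)) _; lra.
have /cauchy_cvgP/cvg_ex[l hl] := cu.
exists l => k; apply/ler_addgt0Pr => e e0.
have /cvgrPdist_lt/(_ e%:C) := hl; rewrite ltcR => /(_ e0)[K _ HK].
have := HK (maxn k K) (leq_maxr k K); rewrite /= rnormE ltcR => h1.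
have h2 := hkj' _ _ (leq_maxl k K).
have := rnormD (u k - u (maxn k K)) (u (maxn k K) - l); rewrite addrA subrK.
move: h1 h2; rewrite [rnorm (l - _)]rnorm_distC [rnorm (u _ - u k)]rnorm_distC; lra.
Qed.

End NormedSpace.

(** * The Banach algebra of bounded operators *)

Section BoundedOperators.
Variables (R : realType) (H : completeNormedModType R[i]).
Local Notation C := R[i].

Record bop := Bop { bop_fun :> H -> H; bopP : bounded_op bop_fun }.
Implicit Types (f g h : bop) (x y : H) (z : C).

Lemma bop_eq f g : f =1 g -> f = g.
Proof.
case: f => f hf; case: g => g hg /= fg.
have e : f = g by apply/funext.
by subst g; congr Bop; exact: Prop_irrelevance.
Qed.

HB.instance Definition _ := gen_eqMixin bop.
HB.instance Definition _ := gen_choiceMixin bop.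

Lemma bop_bound f : exists M, forall x, rnorm (f x) <= M * rnorm x.
Proof. exact: (bounded_opP (bopP f).1).1 (bopP f). Qed.

Lemma bounded_op_make (F : H -> H) : linear F ->
  (exists M, forall x, rnorm (F x) <= M * rnorm x) -> bounded_op F.
Proof. by move=> lF; exact: (bounded_opP lF).2. Qed.

Lemma bop_zero_subproof : bounded_op (fun _ : H => 0 : H).
Proof.
apply: bounded_op_make => [z x y|]; first by rewrite scaler0 addr0.
by exists 0 => x; rewrite rnorm0 mul0r.
Qed.

Lemma bop_one_subproof : bounded_op (fun x : H => x).
Proof. by apply: bounded_op_make => [z x y //|]; exists 1 => x; rewrite mul1r. Qed.

Lemma bop_add_subproof f g : bounded_op (fun x => f x + g x).
Proof.
apply: bounded_op_make => [z x y|].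
  by rewrite !(bopP _).1 scalerDr addrACA.
have [M hM] := bop_bound f; have [N hN] := bop_bound g.
by exists (M + N) => x; apply: le_trans (rnormD _ _) _; rewrite mulrDl lerD.
Qed.

Lemma bop_scale_subproof z f : bounded_op (fun x => z *: f x).
Proof.
apply: bounded_op_make => [w x y|].
  by rewrite (bopP f).1 scalerDr !scalerA mulrC.
have [M hM] := bop_bound f.
by exists (cabs z * M) => x; rewrite rnormZ -mulrA ler_wpM2l// cabs_ge0.
Qed.

Lemma bop_mul_subproof f g : bounded_op (fun x => f (g x)).
Proof.
apply: bounded_op_make => [z x y|]; first by rewrite !(bopP _).1.
have [M hM] := bop_bound f; have [N hN] := bop_bound g.
exists (`|M| * N) => x; apply: le_trans (hM _) _.
apply: le_trans (ler_wpM2r (rnorm_ge0 _) (ler_norm M)) _.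
by rewrite -mulrA ler_wpM2l.
Qed.

Definition bop_zero := Bop bop_zero_subproof.
Definition bop_one := Bop bop_one_subproof.
Definition bop_add f g := Bop (bop_add_subproof f g).
Definition bop_scale z f := Bop (bop_scale_subproof z f).
Definition bop_mul f g := Bop (bop_mul_subproof f g).
Definition bop_opp f := bop_scale (-1) f.

Lemma bop_addA : associative bop_add.
Proof. by move=> f g h; apply: bop_eq => x /=; rewrite addrA. Qed.
Lemma bop_addC : commutative bop_add.
Proof. by move=> f g; apply: bop_eq => x /=; rewrite addrC. Qed.
Lemma bop_add0 : left_id bop_zero bop_add.
Proof. by move=> f; apply: bop_eq => x /=; rewrite add0r. Qed.
Lemma bop_addN : left_inverse bop_zero bop_opp bop_add.
Proof. by move=> f; apply: bop_eq => x /=; rewrite scaleN1r addNr. Qed.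

HB.instance Definition _ := GRing.isZmodule.Build bop bop_addA bop_addC bop_add0 bop_addN.

Lemma bop_scaleA z w f : bop_scale z (bop_scale w f) = bop_scale (z * w) f.
Proof. by apply: bop_eq => x /=; rewrite scalerA. Qed.
Lemma bop_scale1 : left_id 1 bop_scale.
Proof. by move=> f; apply: bop_eq => x /=; rewrite scale1r. Qed.
Lemma bop_scaleDr : right_distributive bop_scale +%R.
Proof. by move=> z f g; apply: bop_eq => x /=; rewrite scalerDr. Qed.
Lemma bop_scaleDl f : {morph bop_scale^~ f : z w / z + w}.
Proof. by move=> z w; apply: bop_eq => x /=; rewrite scalerDl. Qed.

HB.instance Definition _ :=
  GRing.Zmodule_isLmodule.Build C bop bop_scaleA bop_scale1 bop_scaleDr bop_scaleDl.

Lemma bop_mulA : associative bop_mul.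
Proof. by move=> f g h; apply: bop_eq. Qed.
Lemma bop_mul1l : left_id bop_one bop_mul.
Proof. by move=> f; apply: bop_eq. Qed.
Lemma bop_mul1r : right_id bop_one bop_mul.
Proof. by move=> f; apply: bop_eq. Qed.
Lemma bop_mulDl : left_distributive bop_mul +%R.
Proof. by move=> f g h; apply: bop_eq. Qed.
Lemma bop_mulDr : right_distributive bop_mul +%R.
Proof. by move=> f g h; apply: bop_eq => x /=; rewrite (linear_opD _ _ (bopP f).1). Qed.

End BoundedOperators.

(* Mathcomp's algebras are nontrivial, hence the nonzero vector as a parameter. *)
Definition bopalg (R : realType) (H : completeNormedModType R[i]) (x0 : H)
  of x0 != 0 := bop H.

Section BoundedOperatorAlgebra.
Variables (R : realType) (H : completeNormedModType R[i]) (x0 : H) (x0_neq0 : x0 != 0).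
Local Notation C := R[i].
Local Notation A := (bopalg x0_neq0).

HB.instance Definition _ := GRing.Lmodule.on A.

Lemma bop_one_neq0 : bop_one H != 0.
Proof.
apply/eqP => /(congr1 (fun f : bop H => f x0)) /= e.
by move: x0_neq0; rewrite e eqxx.
Qed.

HB.instance Definition _ := GRing.Zmodule_isNzRing.Build A
  (@bop_mulA R H) (@bop_mul1l R H) (@bop_mul1r R H) (@bop_mulDl R H) (@bop_mulDr R H)
  bop_one_neq0.

Lemma bop_scaleAl (z : C) (f g : A) : z *: (f * g) = z *: f * g.
Proof. exact: bop_eq. Qed.

HB.instance Definition _ := GRing.Lmodule_isLalgebra.Build C A bop_scaleAl.

Lemma bop_scaleAr (z : C) (f g : A) : z *: (f * g) = f * (z *: g).
Proof. by apply: bop_eq => x /=; rewrite (linear_opZ _ _ (bopP f).1). Qed.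

HB.instance Definition _ := GRing.Lalgebra_isAlgebra.Build C A bop_scaleAr.

Definition bop_unit : pred A := fun f => `[< exists g : A, g * f = 1 /\ f * g = 1 >].

(** Outside the units the value is [f], as the unit ring structure requires, whereas [op_inv] is
    then zero; the two inverses are therefore compared on units only. *)
Definition bop_inv (f : A) : A :=
  if pselect (exists g : A, g * f = 1 /\ f * g = 1) is left e then projT1 (cid e) else f.

Lemma bop_mulVf : {in bop_unit, left_inverse 1 bop_inv *%R}.
Proof.
move=> f /asboolP hf; rewrite /bop_inv; case: pselect => [e|//].
by case: cid => g /= [].
Qed.

Lemma bop_mulfV : {in bop_unit, right_inverse 1 bop_inv *%R}.
Proof.
move=> f /asboolP hf; rewrite /bop_inv; case: pselect => [e|//].
by case: cid => g /= [].
Qed.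

Lemma bop_unitP (f g : A) : g * f = 1 /\ f * g = 1 -> bop_unit f.
Proof. by move=> h; apply/asboolP; exists g. Qed.

Lemma bop_inv_out : {in [predC bop_unit], bop_inv =1 id}.
Proof.
move=> f; rewrite inE /= => /asboolP hf; rewrite /bop_inv.
by case: pselect => [e|//]; case: hf.
Qed.

HB.instance Definition _ := GRing.NzRing_hasMulInverse.Build A
  bop_mulVf bop_mulfV bop_unitP bop_inv_out.

End BoundedOperatorAlgebra.

Section OperatorNorm.
Variables (R : realType) (H : completeNormedModType R[i]) (x0 : H) (x0_neq0 : x0 != 0).
Local Notation C := R[i].
Local Notation A := (bopalg x0_neq0).
Implicit Types (f g : A) (z : C) (x y : H).

Definition bopnorm f : R := opnorm (bop_fun f).

Lemma bopB_apply f g x : bop_fun (f - g) x = f x - g x.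
Proof. by rewrite -[bop_fun (f - g) x]/(f x + (-1) *: g x) scaleN1r. Qed.

Lemma bop_scalar_apply z x : bop_fun (z%:A : A) x = z *: x.
Proof. by []. Qed.

Lemma bopX_apply f k x : bop_fun (f ^+ k) x = iter k f x.
Proof.
elim: k x => [//|k IH] x.
by rewrite exprS -[bop_fun _ x]/(f (bop_fun (f ^+ k) x)) IH.
Qed.

(** For completeness, the pointwise limits have a rate proportional to [rnorm x]; this makes the
    limit linear and bounded, and the convergence one in operator norm. *)
Lemma bopnorm_banach : banach_norm bopnorm.
Proof.
have nge0 f : 0 <= bopnorm f by exact: opnorm_ge0 (bopP f).
have nle f x : rnorm (f x) <= bopnorm f * rnorm x by exact: le_opnorm (bopP f).
have nZ z f : bopnorm (z *: f) <= cabs z * bopnorm f.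
  apply: opnorm_le => [|x]; first by rewrite mulr_ge0 ?cabs_ge0.
  by rewrite rnormZ -mulrA ler_wpM2l ?cabs_ge0.
split => //.
- move=> f f0; apply: bop_eq => x; apply/eqP; rewrite -rnorm_eq0 eq_le rnorm_ge0 andbT.
  by have := nle f x; rewrite f0 mul0r.
- move=> f g; apply: opnorm_le => [|x]; first by rewrite addr_ge0.
  by apply: le_trans (rnormD _ _) _; rewrite mulrDl lerD.
- move=> f g; apply: opnorm_le => [|x]; first by rewrite mulr_ge0.
  by apply: le_trans (nle f _) _; rewrite -mulrA ler_wpM2l.
- move=> z f; apply/eqP; rewrite eq_le nZ/=.
  have [->|z0] := eqVneq z 0; first by rewrite cabs0 mul0r.
  have cz : 0 < cabs z by rewrite cabs_gt0.
  rewrite mulrC -ler_pdivlMr//.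
  by have := nZ z^-1 (z *: f); rewrite scalerA mulVf// scale1r cabsV mulrC.
- by apply: opnorm_le => // x; rewrite mul1r.
move=> u c q q01 hu; have /andP[q0 q1] := q01.
have c0 : 0 <= c by have := hu 0%N; rewrite expr0 mulr1; apply: le_trans.
have hx x : exists l, forall k, rnorm (u k x - l) <= q ^+ k * (c * rnorm x / (1 - q)).
  apply: geometric_sequence_cvg => // [|k]; first by rewrite mulr_ge0 ?rnorm_ge0.
  rewrite -bopB_apply; apply: le_trans (nle _ _) _.
  by rewrite mulrAC ler_wpM2r ?rnorm_ge0.
have [l hl] := choice hx.
have B0 : 0 <= c / (1 - q) by rewrite divr_ge0// subr_ge0 ltW.
have hl' x k : rnorm (u k x - l x) <= q ^+ k * (c / (1 - q)) * rnorm x.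
  by apply: le_trans (hl x k) _; rewrite le_eqVlt; apply/orP; left; apply/eqP; ring.
have ll : linear l.
  move=> z x y; apply/eqP; rewrite -subr_eq0 -rnorm_eq0 eq_le rnorm_ge0 andbT.
  apply/ler_addgt0Pr => e e0; rewrite add0r.
  set w := z *: x + y.
  pose M := c / (1 - q) * (rnorm w + cabs z * rnorm x + rnorm y).
  have M0 : 0 <= M by rewrite mulr_ge0// !addr_ge0 ?rnorm_ge0// mulr_ge0 ?cabs_ge0 ?rnorm_ge0.
  have [K HK] := geometric_le q01 M0 e0.
  apply: le_trans (HK K (leqnn K)).
  have -> : l w - (z *: l x + l y) = - (u K w - l w) + (z *: (u K x - l x) + (u K y - l y)).
    have uw : u K w = z *: u K x + u K y := (bopP (u K)).1 z x y.
    by rewrite opprB uw scalerBr [X in _ = _ + X]addrACA -opprD addrA subrK.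
  apply: le_trans (rnormD _ _) _; rewrite rnormN.
  apply: le_trans (lerD (hl' w K) (le_trans (rnormD _ _) (lerD (le_refl _) (hl' y K)))) _.
  rewrite rnormZ; have := ler_wpM2l (cabs_ge0 z) (hl' x K); rewrite /M; lra.
have bl : bounded_op l.
  apply: bounded_op_make => //; exists (bopnorm (u 0%N) + c / (1 - q)) => x.
  have := rnormD (u 0%N x) (- (u 0%N x - l x)); rewrite opprB addrC subrK.
  have := hl' x 0%N; rewrite expr0 mul1r rnorm_distC; have := nle (u 0%N) x; lra.
exists (Bop bl : A) => e e0; have [K HK] := geometric_le q01 B0 e0.
exists K => k /HK; apply: le_trans; apply: opnorm_le.
  by rewrite mulr_ge0 ?exprn_ge0.
by move=> x; rewrite bopB_apply.
Qed.

Lemma bop_invertibleP f : op_invertible (bop_fun f) <-> f \is a GRing.unit.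
Proof.
split=> [[g [bg fg gf]]|uf].
  apply/unitrP; exists (Bop bg : A); split; apply: bop_eq => x.
    by have /(congr1 (fun F => F x)) := gf.
  by have /(congr1 (fun F => F x)) := fg.
exists (bop_fun f^-1); split; first exact: bopP.
  by apply/funext => x; have /(congr1 (fun F : A => bop_fun F x)) := mulrV uf.
by apply/funext => x; have /(congr1 (fun F : A => bop_fun F x)) := mulVr uf.
Qed.

Lemma bop_invE f : f \is a GRing.unit -> op_inv (bop_fun f) = bop_fun f^-1.
Proof.
move=> uf; apply: xget_unique.
  split; first exact: bopP.
    by apply/funext => x; have /(congr1 (fun F : A => bop_fun F x)) := mulrV uf.
  by apply/funext => x; have /(congr1 (fun F : A => bop_fun F x)) := mulVr uf.
move=> g [bg fg gf]; apply/funext => x.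
have h1 : f (bop_fun f^-1 x) = x.
  by have /(congr1 (fun F : A => bop_fun F x)) := mulrV uf.
have /(congr1 (fun F => F (bop_fun f^-1 x))) := gf; rewrite /= h1.
by [].
Qed.

Lemma bop_spectralP f z : op_spectrum (bop_fun f) z <-> spectral f z.
Proof.
rewrite /op_spectrum /spectral /=.
have -> : (fun x => f x - z *: x) = bop_fun (f - z%:A).
  by apply/funext => x; rewrite bopB_apply bop_scalar_apply.
by split=> [h|/negP h]; [apply/negP|]; move=> /bop_invertibleP.
Qed.

Lemma newton_bopE n (a : A) k : (forall j, newton_alg n a j \is a GRing.unit) ->
  newton n.+1 (bop_fun a) k = bop_fun (newton_alg n a k).
Proof.
move=> ua; elim: k => [//|k IH].
rewrite /newton iterS -/(newton _ _ _) IH /newton_step bop_invE//.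
apply/funext => x; rewrite /newton_alg iterS -/(newton_alg n a k).
rewrite -[RHS]/(_ *: bop_fun (newton_alg n a k) (bop_fun (n%:R + newton_alg n a k ^- n.+1 * a) x)).
congr (_ *: bop_fun _ _).
rewrite -[RHS]/(bop_fun (n%:R : A) x + bop_fun (newton_alg n a k ^- n.+1 : A) (a x)).
rewrite -exprVn bopX_apply -[n.+1%:R]natr1 addrK; congr (_ + _).
have -> : (n%:R : A) = (n%:R : C)%:A by rewrite scaler_nat.
by rewrite bop_scalar_apply.
Qed.

End OperatorNorm.

(** * Numerical range and location of the spectrum *)

Section NumericalRange.
Variables (R : realType) (H : completeNormedModType R[i]) (x0 : H) (x0_neq0 : x0 != 0).
Local Notation C := R[i].
Local Notation A := (bopalg x0_neq0).
Variable dot : {dot H for Num.conj}.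
Hypothesis dotE : forall x : H, `|x| ^+ 2 = dot x x.
Implicit Types (x y : H) (z : C) (a : A).

Lemma cauchy_schwarz_unit x y : rnorm y = 1 -> cabs (dot x y) <= rnorm x.
Proof.
move=> y1; have dy : dot y y = 1 by rewrite -dotE rnormE y1 rmorph1 expr1n.
set c := dot x y; rewrite -(@ler_pXn2r _ 2) ?nnegrE ?cabs_ge0 ?rnorm_ge0//.
rewrite -lecR !rmorphXn /= -cabsE -rnormE dotE.
have := dnorm_ge0 dot (x - c *: y).
rewrite (dnormB dot x (c *: y)) dnormZ dy mulr1 linearZr_LR /= -/c.
rewrite [c^* * c]mulrC -normCK conj_Creal; last by rewrite rpredX// normr_real.
by rewrite opprD addrA addrK subr_ge0.
Qed.

(** For a unit vector [y], Cauchy-Schwarz bounds [|dot (a y) y - z| = |dot (a y - z y) y|] by the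
    norm of [a y - z y]. *)
Lemma far_from_range_bounded_below a z (d : R) : 0 < d ->
  (forall w, [set dot (a y) y | y in [set y : H | `|y| = 1]] w -> d <= cabs (w - z)) ->
  forall x, d * rnorm x <= rnorm (a x - z *: x).
Proof.
move=> d0 hd x; have [->|xn0] := eqVneq x 0.
  by rewrite rnorm0 mulr0 rnorm_ge0.
have rx : 0 < rnorm x by rewrite lt_def rnorm_eq0 xn0 rnorm_ge0.
pose y := (rnorm x)^-1%:C *: x.
have y1 : rnorm y = 1.
  by rewrite rnormZ cabs_real ger0_norm ?invr_ge0 ?(ltW rx)// mulVf ?gt_eqF.
have ny : `|y| = 1 by rewrite rnormE y1 rmorph1.
have := hd (dot (a y) y) (ex_intro2 _ _ y ny erefl).
have -> : dot (a y) y - z = dot (a y - z *: y) y.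
  by rewrite linearBl linearZl_LR /= -dotE ny expr1n mulr1.
move=> /le_trans/(_ (cauchy_schwarz_unit _ y1)).
have -> : a y - z *: y = (rnorm x)^-1%:C *: (a x - z *: x).
  by rewrite /y (linear_opZ _ _ (bopP a).1) scalerBr !scalerA mulrC.
rewrite rnormZ cabs_real ger0_norm ?invr_ge0 ?(ltW rx)// mulrC.
by rewrite ler_pdivlMr.
Qed.

Lemma notin_closure_dist (S : set C^o) z : ~ closure S z ->
  exists2 d : R, 0 < d & forall w, S w -> d <= cabs (w - z).
Proof.
move=> hz.
have : nbhs (z : C^o) (~` S).
  by move: hz; rewrite -[closure S z]/(forall B, _) => /existsNP[B] /not_implyP[hB hS];
     apply: filterS hB => w Bw Sw; apply: hS; exists w.
rewrite -nbhs_ballE => -[e /= e0 he].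
have e1 : 0 < complex.Re e by rewrite -ltcR RRe_real// gtr0_real.
exists (complex.Re e) => // w Sw; rewrite leNgt; apply/negP => h.
apply: (he w) => //; rewrite -ball_normE /= -(RRe_real (gtr0_real e0)).
by rewrite (cabsE (z - w)) ltcR cabs_distC.
Qed.

End NumericalRange.

Section Ray.
Variables (R : realType) (A : unitAlgType R[i]) (nrm : A -> R).
Variable hN : banach_norm nrm.
Local Notation C := R[i].

Definition ray (z : C) (t : R) : C := 1 + t%:C * (z - 1).

Lemma ray1 z : ray z 1 = z.
Proof. by rewrite /ray mul1r addrC subrK. Qed.

Lemma ray_dist z s t : cabs (ray z s - ray z t) = `|s - t| * cabs (z - 1).
Proof.
have -> : ray z s - ray z t = (s - t)%:C * (z - 1) by rewrite /ray rmorphB; ring.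
by rewrite cabsM cabs_real.
Qed.

(** A lower bound for [a - z] does not make it surjective, so invertibility is carried in from
    infinity. If it failed at [z], let [T] be the supremum of the parameters where it fails. Just
    beyond [T] the inverse exists with norm at most [1 / d], and a Neumann series then covers the
    parameters just below [T]. *)
Lemma ray_unit (a : A) z :
  (forall t, 1 <= t -> exists2 d : R, 0 < d & forall s, cabs (ray z s - ray z t) <= d ->
     a - (ray z s)%:A \is a GRing.unit -> nrm (a - (ray z s)%:A)^-1 <= d^-1) ->
  z != 1 -> a - z%:A \is a GRing.unit.
Proof.
move=> hd z1; apply: contrapT => /negP nu.
pose L := cabs (z - 1); have L0 : 0 < L by rewrite cabs_gt0 subr_eq0.
pose S := [set t : R | 1 <= t /\ a - (ray z t)%:A \isn't a GRing.unit].
have S1 : S 1 by split; rewrite ?ray1.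
have ubS : ubound S ((nrm a + 1) / L).
  move=> t [t1 nt]; rewrite leNgt; apply/negP; rewrite ltr_pdivrMr// => h.
  move/negP: nt; apply; apply: (large_scalar_unit hN).
  have := cabsB (ray z t) 1; rewrite {1}/ray addrC addKr cabsM cabs_real cabs1 -/L.
  rewrite ger0_norm; last lra.
  lra.
have hS : has_sup S by split; [exists 1 | exists ((nrm a + 1) / L)].
pose T := sup S.
have T1 : 1 <= T by apply: ub_le_sup => //; exact: hS.2.
have [d d0 hT] := hd T T1.
(* The points at [T + e] and [T] have distance [d / 4], and those at [T + e] and [s > T - e] at most
   [2 * e * L = d / 2 < d]. *)
pose e := d / (4 * L).
have e0 : 0 < e by rewrite divr_gt0// mulr_gt0.
have eL : e * L = d / 4 by rewrite /e; field; rewrite gt_eqF.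
have [s [s1 ns] sT] := sup_adherent e0 hS; rewrite -/T in sT.
have sT' : s <= T by apply: ub_le_sup => //; exact: hS.2.
have uT : a - (ray z (T + e))%:A \is a GRing.unit.
  apply: contrapT => /negP nT.
  have : T + e <= T by apply: ub_le_sup; [exact: hS.2 | split => //; lra].
  lra.
have h1 : nrm (a - (ray z (T + e))%:A)^-1 <= d^-1.
  by apply: hT => //; rewrite ray_dist addrAC subrr add0r (gtr0_norm e0) -/L eL; lra.
move/negP: ns; apply.
have -> : a - (ray z s)%:A = (a - (ray z (T + e))%:A) + (ray z (T + e) - ray z s)%:A.
  by rewrite scalerBl addrA subrK.
apply: (unit_addr hN) => //.
rewrite -scalerAr mulr1 (bnZ hN) ray_dist -/L ger0_norm; last lra.
have h2 : (T + e - s) * L <= d / 2.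
  have := eL; have : T + e - s <= 2 * e by lra.
  nra.
have h3 : d / 2 * d^-1 < 1 by rewrite mulrAC divff ?gt_eqF//; lra.
apply: le_lt_trans h3; apply: ler_pM => //; last exact: bn_ge0 hN _.
by apply: mulr_ge0; [lra | exact: ltW].
Qed.

End Ray.

Section SpectrumInDomain.
Variables (R : realType) (H : completeNormedModType R[i]) (x0 : H) (x0_neq0 : x0 != 0).
Local Notation C := R[i].
Local Notation A := (bopalg x0_neq0).
Variable dot : {dot H for Num.conj}.
Hypothesis dotE : forall x : H, `|x| ^+ 2 = dot x x.
Variables (eps : R) (a : A).
Hypothesis eps0 : 0 < eps.
Hypothesis range_a : numerical_range dot a `<=` domainD eps.
Local Notation nrm := (@bopnorm R H x0 x0_neq0).
Local Notation hN := (bopnorm_banach x0_neq0).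

(** The set is star-shaped about [1], since each of its two pieces is convex and contains [1]. *)
Lemma domainD_ray z t : 1 <= t -> domainD eps (ray z t) -> domainD eps z.
Proof.
move=> t1 h; have t0 : 0 < t by lra.
pose s := t^-1; have s0 : 0 < s by rewrite invr_gt0.
have s1 : s <= 1 by rewrite invf_le1.
have st : s%:C * t%:C = 1 by rewrite -rmorphM mulVf ?gt_eqF.
have e' : z - 1 = s%:C * (ray z t - 1) by rewrite /ray [1 + _]addrC addrK mulrA st mul1r.
have e : z = (1 - s)%:C + s%:C * ray z t.
  rewrite -[LHS](subrK 1) e' rmorphB rmorph1; ring.
have reE (w : C) : complex.Re ((1 - s)%:C + s%:C * w) = 1 - s + s * complex.Re w.
  by case: w => x y /=; rewrite mul0r subr0.
case: h => /= -[h1 h2]; [left | right]; (split; first by rewrite e reE; nra).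
  rewrite cabsE lecR e; rewrite cabsE lecR in h2.
  apply: le_trans (cabsD _ _) _; rewrite cabsM !cabs_real.
  rewrite ger0_norm; last lra.
  rewrite (gtr0_norm s0); have h3 := ler_wpM2l (ltW s0) h2.
  have h4 : s * eps <= 1 * eps by apply: ler_wpM2r => //; exact: ltW.
  lra.
rewrite cabsE lecR e' cabsM cabs_real (gtr0_norm s0).
rewrite cabsE lecR in h2.
by have := cabs_ge0 (ray z t - 1); nra.
Qed.

Lemma inverse_norm_le (f : A) (d : R) : 0 < d -> f \is a GRing.unit ->
  (forall x, d * rnorm x <= rnorm (f x)) -> nrm f^-1 <= d^-1.
Proof.
move=> d0 uf h; apply: opnorm_le => [|x]; first by rewrite invr_ge0 ltW.
have := h (bop_fun f^-1 x).
have -> : f (bop_fun f^-1 x) = x by have /(congr1 (fun F : A => bop_fun F x)) := mulrV uf.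
by rewrite mulrC [d^-1 * _]mulrC ler_pdivlMr.
Qed.

Lemma spectrum_domainD z : spectral a z -> domainD eps z.
Proof.
move=> hz; apply: contrapT => nz; move/negP: hz; apply.
have z1 : z != 1.
  apply/eqP => ez; apply: nz; left; rewrite ez /=; split; first exact: ltr01.
  by rewrite normr1 -(rmorph1 (real_complex R)) lecR lerDl ltW.
apply: (ray_unit hN) z1 => t t1.
have : ~ numerical_range dot a (ray z t).
  by move=> /range_a /(domainD_ray t1).
move=> /notin_closure_dist[d d0 hd]; have d20 : 0 < d / 2 by rewrite divr_gt0.
exists (d / 2) => // s hs us; apply: inverse_norm_le => // x.
rewrite bopB_apply bop_scalar_apply.
apply: (far_from_range_bounded_below dotE) => // w /hd.
have := cabsD (w - ray z s) (ray z s - ray z t); rewrite addrA subrK; lra.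
Qed.

(** The origin is a limit point of [D] but not in it, so the distance comes from [numerical_range]
    being closed: it stays at some distance [d] from [0], and [a^-1] has norm at most [1 / d]. *)
Lemma spectrum_away_from_zero : exists2 delta : R, 0 < delta <= 1 &
  forall z, spectral a z -> delta <= cabs z.
Proof.
have n0 : ~ domainD eps (0 : C) by move=> [] [] /=; rewrite ltxx.
have u0 : a \is a GRing.unit.
  apply: contrapT => /negP h; apply: n0; apply: spectrum_domainD.
  by rewrite /spectral scale0r subr0.
have : ~ numerical_range dot a (0 : C) by move=> /range_a.
move=> /notin_closure_dist[d d0 hd].
have hi : nrm a^-1 <= d^-1.
  apply: inverse_norm_le => // x.
  by have := far_from_range_bounded_below dotE d0 hd x; rewrite scale0r subr0.
exists (Num.min 1 d) => [|z hz].
  by rewrite lt_min ltr01 d0 ge_min lexx.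
rewrite ge_min; apply/orP; right; rewrite leNgt; apply/negP => zd.
move/negP: hz; apply; apply: (unit_addr hN) => //.
rewrite mulrN -scalerAr mulr1 (bnN hN) (bnZ hN).
by apply: le_lt_trans (ler_wpM2l (cabs_ge0 z) hi) _; rewrite ltr_pdivrMr// mul1r.
Qed.

End SpectrumInDomain.

(** * Sectors and principal roots *)

Section Sectors.
Variable R : realType.
Local Notation C := R[i].
Implicit Types (z w : C).

(** A point [w] of a small ball is [z * (1 + u)] with [|u| <= sin (alpha n) / 2], so its argument
    differs from that of [z] by at most [alpha n], and [2 * alpha n = pi / p]. *)
Lemma half_sector_root_interior n z : (0 < n)%N -> half_sector_root n (z ^+ n.+1) z ->
  interior (sector (pi / n.+1%:R)) (z : C^o).
Proof.
move=> n0 [r [t [r0 ht ez _]]].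
have al0 := @alpha_gt0 R n; have al1 := @alpha_lt R n n0; have p0 := @pi_gt0 R.
pose al := alpha R n.
have sa : 0 < sin al by apply: sin_gt0_pihalf; rewrite /al; apply/andP; split; lra.
have alp : 0 < al < pi / 2 by rewrite /al; apply/andP; split; lra.
have cr : cabs z = r by rewrite ez cabs_polar// ltW.
have z0 : z != 0 by rewrite -cabs_gt0 cr.
have al2 : pi / n.+1%:R = al + al.
  by rewrite /al /alpha; field; rewrite addrC natr1 pnatr_eq0.
have e0 : 0 < (r * sin al / 2)%:C by rewrite ltcR divr_gt0// mulr_gt0.
rewrite /interior /= -nbhs_ballE; exists (r * sin al / 2)%:C => // w.
rewrite -ball_normE /= cabsE ltcR cabs_distC => hw.
have ew : w = z * (1 + (w - z) / z) by field.
set u := (w - z) / z in ew.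
have cu : cabs u <= sin al / 2.
  rewrite /u cabsM cabsV cr ler_pdivrMr//; move: hw; lra.
have [u1 u2] := ReIm_le_cabs u.
have s1 : sin al <= 1 := sin_le1 al.
have c1 : cos al <= 1 := cos_le1 al.
have c0 : 0 < cos al by apply: cos_gt0_pihalf; case/andP: alp => *; apply/andP; split; lra.
have re : 1 / 2 <= complex.Re (1 + u).
  have -> : complex.Re (1 + u) = 1 + complex.Re u by case: (u).
  move: u1; rewrite ler_norml => /andP[u1 _]; lra.
have v0 : 1 + u != 0.
  by apply/eqP => e; move: re; rewrite e /=; lra.
have him : `|complex.Im (1 + u)| * cos al <= complex.Re (1 + u) * sin al.
  have -> : complex.Im (1 + u) = complex.Im u by case: (u) => x y /=; rewrite add0r.
  by have := normr_ge0 (complex.Im u); nra.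
have [b hb eb] := polar_of_sector alp v0 him.
exists (r * cabs (1 + u)), (t + b); split.
- by rewrite mulr_ge0 ?cabs_ge0 ?(ltW r0).
- by rewrite al2; apply: le_trans (ler_normD _ _) _; rewrite lerD.
by rewrite -polarE {1}ew {1}eb {1}ez cisD rmorphM /= mulrACA.
Qed.

(** The sector gives [|p * t| <= pi], and the positive real part of [z ^ p] gives [cos (p * t) > 0];
    together they force [|p * t| < pi / 2]. *)
Lemma sector_half_sector_root n z : 0 < complex.Re (z ^+ n.+1) ->
  sector (pi / n.+1%:R) z -> half_sector_root n (z ^+ n.+1) z.
Proof.
move=> re [r [t [r0 ht ez]]]; rewrite -polarE in ez.
have p0 := @pi_gt0 R; have n0 : (0 : R) < n.+1%:R by rewrite ltr0n.
move: re; rewrite {1}ez polarX polarE /= => re.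
have r1 : 0 < r.
  by rewrite lt_def r0 andbT; apply: contraTneq re => ->; rewrite expr0n mul0r ltxx.
have c0 : 0 < cos (n.+1%:R * t) by rewrite -(pmulr_rgt0 _ (exprn_gt0 n.+1 r1)).
have ha : `|n.+1%:R * t| <= pi.
  by rewrite normrM ger0_norm ?(ltW n0)// mulrC -ler_pdivlMr.
exists r, t; split => //.
have : `|n.+1%:R * t| < pi / 2.
  rewrite -ltr_cos ?in_itv/= ?normr_ge0 ?ha//; last by apply/andP; split; lra.
  rewrite cos_pihalf; case: (ger0P (n.+1%:R * t)) => // _; by rewrite cosN.
by rewrite normrM (gtr0_norm n0) -(alphaM R n) ltr_pM2l// => /ltW.
Qed.

End Sectors.

Lemma opnorm_cvg0 (R : realType) (H : completeNormedModType R[i]) (u : nat -> H -> H) :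
  (forall k, 0 <= opnorm (u k)) ->
  (forall e : R, 0 < e -> exists K, forall k, (K <= k)%N -> opnorm (u k) <= e) ->
  opnorm (u k) @[k --> \oo] --> (0 : R).
Proof.
move=> u0 h; apply/cvgrPdist_le => e /h[K HK]; exists K => // k /= /HK.
by rewrite sub0r normrN ger0_norm.
Qed.

(** The zero space has no nontrivial algebra of operators and is treated apart: all maps coincide
    and every spectrum is empty. *)
Lemma newton_trivial_space (R : realType) (H : completeNormedModType R[i])
    (p : nat) (a : H -> H) : (forall x : H, x = 0) ->
  (forall k, op_invertible (newton p a k)) /\
  exists2 r : H -> H, is_the_principal_root p a r &
    opnorm (newton p a k \- r) @[k --> \oo] --> (0 : R).
Proof.
move=> triv; have eqf (f g : H -> H) : f = g.
  by apply/funext => x; rewrite (triv (f x)) (triv (g x)).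
have bf (f : H -> H) : bounded_op f by rewrite (eqf f (fun=> 0)); exact: bop_zero_subproof.
have inv (f : H -> H) : op_invertible f by exists f; split.
split=> //; exists idfun.
  split=> [|s _]; last exact: eqf.
  by split => // z /= nz; exfalso; apply: nz; exact: inv.
have on0 (f : H -> H) : opnorm f <= 0.
  by apply: opnorm_le => // x; rewrite (triv (f x)) rnorm0 mul0r.
by apply: opnorm_cvg0 => [k|e e0]; [exact: opnorm_ge0 | exists 0%N => k _; exact: le_trans (on0 _) (ltW e0)].
Qed.

Theorem proposition7p1 (R : realType) (p : nat) (p_gt1 : (1 < p)%N) :
  exists2 eps : R, 0 < eps &
    forall (H : completeNormedModType R[i]) (dot : {dot H for Num.conj})
      (dotE : forall x : H, `|x| ^+ 2 = dot x x)
      (a : H -> H) (a_bounded : bounded_op a),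
      numerical_range dot a `<=` domainD eps ->
      (forall k, op_invertible (newton p a k)) /\
      exists2 r : H -> H, is_the_principal_root p a r &
        opnorm (newton p a k \- r) @[k --> \oo] --> (0 : R).
Proof.
have eps0 : 0 < 1 / 2000 :> R by lra.
(* The margin left in [hstep_outside], the same for all [p]. *)
exists (1 / 2000) => // H dot dotE a a_bounded range_a.
have [triv|] := pselect (forall x : H, x = 0); first exact: newton_trivial_space.
move=> /existsNP[x0 /eqP x0_neq0].
case: p p_gt1 => [//|n]; rewrite ltnS => n_gt0.
pose b : bopalg x0_neq0 := Bop a_bounded.
have [delta delta01 hdelta] := spectrum_away_from_zero (a := b) dotE eps0 range_a.
have spec_b z : spectral b z -> domainD (1 / 2000) z /\ delta <= cabs z.
  by move=> hz; split; [exact: (spectrum_domainD (a := b) dotE eps0 range_a hz) | exact: hdelta].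
have hN := bopnorm_banach x0_neq0.
have ub := newton_alg_unit hN n_gt0 delta01 spec_b.
have nE k : newton n.+1 a k = bop_fun (newton_alg n b k) by exact: (newton_bopE k ub).
split=> [k|]; first by rewrite nE; exact/bop_invertibleP.
have [r hr] := newton_alg_cvg hN n_gt0 delta01 spec_b.
have powE (s : bopalg x0_neq0) : iter n.+1 s = a <-> s ^+ n.+1 = b.
  split=> e; first by apply: bop_eq => x; rewrite bopX_apply e.
  by apply/funext => x; rewrite -bopX_apply e.
exists (bop_fun r).
  split; first split.
  - exact: bopP.
  - by apply/powE; exact: (newton_limit_root hN n_gt0 delta01 spec_b hr).
  - move=> z /bop_spectralP hz; apply: half_sector_root_interior => //.
    exact: (newton_limit_spectrum hN n_gt0 delta01 spec_b hr).
  move=> s [bs es hs]; pose s' : bopalg x0_neq0 := Bop bs.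
  have es' : s' ^+ n.+1 = b by apply/powE.
  suff -> : r = s' by [].
  apply/esym/(newton_limit_unique hN n_gt0 delta01 spec_b hr) => // z hz.
  apply: sector_half_sector_root.
    by have [/domainD_Re_gt0] := spec_b _ (spectral_root es' hz).
  by apply: (@interior_subset R[i]^o); apply: hs; apply/(bop_spectralP s').
have dE k : newton n.+1 a k \- bop_fun r = bop_fun (newton_alg n b k - r).
  by rewrite nE; apply/funext => x; rewrite bopB_apply.
apply: opnorm_cvg0 => [k|e /hr[K HK]]; first by rewrite dE; exact: opnorm_ge0 (bopP _).
by exists K => k /HK; rewrite dE.
Qed.
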